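(* Let $\mathcal{F}$ be a holomorphic foliation on $\mathbb{P}_{\mathbb{C}}^2$ of degree $d\geq 2$ that does not admit a rational first integral of degree $\leq k$. Let $D$ be an algebraic curve of degree $k$ invariant by $\mathcal{F}$. Then $$2-2g(D)\leq\frac{d(k^3+6k^2+11k+6)-k^3-6k^2+13k+2}{4}-2\mathscr{N}(d,k),$$ where $g(D)$ is the virtual genus of $D$ and $\mathscr{N}(d,k)$ is the number of $\mathcal{F}$-invariant curves of degree $k$.
   Context: A (one-dimensional) holomorphic foliation $\mathcal{F}$ on $\mathbb{P}^2_{\mathbb{C}}$ is given by an open cover $\{U_\alpha\}$, holomorphic vector fields $\vartheta_\alpha$ on $U_\alpha$ (not identically zero) and $g_{\alpha\beta}\in\mathscr{O}^*(U_\alpha\cap U_\beta)$ with $\vartheta_\alpha=g_{\alpha\beta}\vartheta_\beta$; $T_{\mathcal{F}}^*$ is the line bundle with cocycle $\{g_{\alpha\beta}\}$. The foliation has degree $d$ when $T_{\mathcal{F}}^*\cong\mathcal{O}_{\mathbb{P}^2}(d-1)$ (equivalently, $d$ is the number of tangencies of $\mathcal{F}$ with a generic line). A curve with local equations $f_\alpha=0$ is invariant by $\mathcal{F}$ if $\vartheta_\alpha(f_\alpha)$ vanishes identically on it, i.e. lies in the ideal generated by $f_\alpha$, for every $\alpha$. The virtual genus of a curve $D$ is $g(D)=\frac{D\cdot D+D\cdot K}{2}+1$, with $K$ the canonical divisor of $\mathbb{P}^2_{\mathbb{C}}$. A rational first integral for $\mathcal{F}$ is a nonconstant rational map from $\mathbb{P}^2_{\mathbb{C}}$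 to an algebraic variety whose fibers are $\mathcal{F}$-invariant; it has degree $m$ if it is written as $P/Q$ with $P,Q$ coprime homogeneous polynomials of the same degree $m$.
   Formalization: N(d,k) counts only the irreducible invariant curves of degree k (and is proved finite); counting reducible ones makes the claim false: a generic p(x)∂x+q(y)∂y of degree 4 has 9 invariant lines, hence 36 line pairs, exceeding the bound 28.5 for k=2. *)

(* Defs.v *)
From HB Require Import structures.
From mathcomp Require Import all_boot all_order all_algebra.
From mathcomp Require Import all_classical all_reals all_analysis.
From mathcomp Require Import complex finmap.
From mathcomp Require mpoly.
Import (canonicals, coercions) mpoly.

Set Implicit Arguments.
Unset Strict Implicit.
Unset Printing Implicit Defensive.

Import Order.TTheory GRing.Theory Num.Theory.
Import numFieldNormedType.Exports.

Local Open Scope classical_set_scope.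
Local Open Scope ring_scope.

(* [R[i]] itself has no canonical topology; a [numClosedFieldType] has one. *)
Definition complexes (R : realType) : numClosedFieldType := R[i].

Section ProjectivePlane.
Variable R : realType.
Local Notation C := (complexes R).

(* A point of the projective plane is a line through the origin of C^3. *)
Definition P2 : Type := {L : {vspace 'rV[C]_3} | \dim L == 1%N}.

(* Homogeneous coordinates of the point with affine coordinates [w] in the
   [i]-th standard chart: 1 in position [i], [w] in the two other positions.  *)
Definition homc (i : 'I_3) (w : 'rV[C]_2) : 'rV[C]_3 :=
  \row_j (if unlift i j is Some j' then w 0 j' else 1).

Lemma dim_homc (i : 'I_3) (w : 'rV[C]_2) : \dim <[homc i w]>%VS == 1%N.
Proof.
rewrite dim_vline eqb1; apply/eqP => /rowP/(_ i).
by rewrite !mxE unlift_none; exact/eqP/oner_neq0.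
Qed.

Definition chart (i : 'I_3) (w : 'rV[C]_2) : P2 :=
  exist (fun L : {vspace 'rV[C]_3} => \dim L == 1%N) _ (dim_homc i w).

(* [chart j (transition i j w) = chart i w] wherever [homc i w 0 j != 0]. *)
Definition transition (i j : 'I_3) (w : 'rV[C]_2) : 'rV[C]_2 :=
  \row_l (homc i w 0 (lift j l) / homc i w 0 j).

Definition hcoord (p : P2) : 'rV[C]_3 := vpick (val p).

(* The chart domain x_i <> 0. *)
Definition chart_dom (i : 'I_3) : set P2 := [set p | hcoord p 0 i != 0].

Definition open_P2 (U : set P2) : Prop :=
  forall i : 'I_3, open (chart i @^-1` U).

(* Holomorphic functions of two variables are the functions that are locally
   sums of absolutely convergent double power series.                         *)
Definition holomorphic_at (f : 'rV[C]_2 -> C) (a : 'rV[C]_2) : Prop :=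
  exists c : nat -> nat -> C,
    let t (w : 'rV[C]_2) (m n : nat) : C :=
      c m n * (w 0 0 - a 0 0) ^+ m * (w 0 1 - a 0 1) ^+ n in
    \forall w \near a,
      (exists M : C, forall N : nat,
         \sum_(m < N) \sum_(n < N) `|t w m n| <= M) /\
      ((fun N : nat => \sum_(m < N) \sum_(n < N) t w m n) @ \oo
         --> f w).

Definition holomorphic_on (U : set P2) (f : P2 -> C) : Prop :=
  forall (i : 'I_3) (w : 'rV[C]_2),
    U (chart i w) -> holomorphic_at (f \o chart i) w.

Definition invertible_on (U : set P2) (f : P2 -> C) : Prop :=
  holomorphic_on U f /\ forall p, U p -> f p != 0.

(* Expressions of a vector field in the three standard charts; only the values
   on the preimage of the set where the field lives are meaningful.           *)
Definition vfield : Type := 'I_3 -> 'rV[C]_2 -> 'rV[C]_2.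

Definition holomorphic_vfield_on (U : set P2) (th : vfield) : Prop :=
  (forall (i : 'I_3) (w : 'rV[C]_2) (l : 'I_2), U (chart i w) ->
     holomorphic_at (fun w' => th i w' 0 l) w) /\
  (forall (i j : 'I_3) (w : 'rV[C]_2), U (chart i w) -> homc i w 0 j != 0 ->
     'D_(th i w) (transition i j) w = th j (transition i j w)).

Record foliation : Type := Foliation {
  fol_index : Type;
  fol_dom : fol_index -> set P2;
  fol_vf : fol_index -> vfield;
  fol_cocycle : fol_index -> fol_index -> P2 -> C;
  fol_open : forall a, open_P2 (fol_dom a);
  fol_cover : forall p, exists a, fol_dom a p;
  fol_holo : forall a, holomorphic_vfield_on (fol_dom a) (fol_vf a);
  fol_neq0 : forall a, exists i w,
    fol_dom a (chart i w) /\ fol_vf a i w != 0;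
  fol_invertible : forall a b,
    invertible_on (fol_dom a `&` fol_dom b) (fol_cocycle a b);
  fol_glue : forall a b i w, (fol_dom a `&` fol_dom b) (chart i w) ->
    fol_vf a i w = fol_cocycle a b (chart i w) *: fol_vf b i w
}.

(* Cocycle (x_j / x_i)^m of O(m) on the standard cover. As for [fol_cocycle],
   the sections of the bundle of a cocycle g are the families with
   s_a = g_ab s_b.                                                            *)
Definition twist_cocycle (m : int) (i j : 'I_3) (p : P2) : C :=
  (hcoord p 0 j / hcoord p 0 i) ^ m.

(* The line bundle of [fol_cocycle F] is isomorphic to O(m): an isomorphism is
   given in the two families of local frames by the functions [s i a].        *)
Definition cotangent_iso_twist (F : foliation) (m : int) : Prop :=
  exists s : 'I_3 -> fol_index F -> P2 -> C,
    (forall i a, invertible_on (chart_dom i `&` fol_dom a) (s i a)) /\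
    (forall i j a b p, chart_dom i p -> chart_dom j p ->
       fol_dom a p -> fol_dom b p ->
       s i a p * fol_cocycle a b p = twist_cocycle m i j p * s j b p).

Definition foliation_degree (F : foliation) (d : nat) : Prop :=
  cotangent_iso_twist F (d%:Z - 1).

Local Notation poly3 := (mpoly.mpoly 3 C).

Definition homogeneous (k : nat) (f : poly3) : Prop :=
  f \is mpoly.ishomog1 k mpoly.mdeg.

(* A plane curve, possibly reducible or nonreduced, is given by an equation. *)
Definition curve_equation (k : nat) (f : poly3) : Prop :=
  [/\ f != 0, homogeneous k f & (0 < k)%N].

Definition local_equation (f : poly3) (i : 'I_3) (w : 'rV[C]_2) : C :=
  mpoly.meval (fun j => homc i w 0 j) f.

(* On every chart, the derivative of the local equation along the vector field
   is a holomorphic multiple [h] of the local equation.                       *)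
Definition invariant_curve (F : foliation) (f : poly3) : Prop :=
  forall (a : fol_index F) (i : 'I_3), exists h : 'rV[C]_2 -> C,
    forall w, fol_dom a (chart i w) ->
      holomorphic_at h w /\
      'D_(fol_vf a i w) (local_equation f i) w = h w * local_equation f i w.

Definition irreducible_poly3 (f : poly3) : Prop :=
  [/\ f != 0, f \isn't a GRing.unit &
      forall g h, f = g * h -> g \is a GRing.unit \/ h \is a GRing.unit].

Definition coprime_poly3 (f g : poly3) : Prop :=
  forall h u v : poly3, f = h * u -> g = h * v -> h \is a GRing.unit.

(* The fibers of P / Q are the curves a P + b Q = 0. *)
Definition rational_first_integral (F : foliation) (m : nat) (P Q : poly3) :
    Prop :=
  [/\ homogeneous m P, homogeneous m Q, coprime_poly3 P Q,
      (Q != 0 /\ forall c : C, P <> c *: Q) &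
      forall a b : C, (a != 0) || (b != 0) ->
        invariant_curve F (a *: P + b *: Q)].

Definition has_rational_first_integral (F : foliation) (m : nat) : Prop :=
  exists P Q, rational_first_integral F m P Q.

Definition zero_locus (f : poly3) : set P2 :=
  [set p | mpoly.meval (fun j => hcoord p 0 j) f = 0].

(* Irreducible invariant curves of degree k, as subsets of the plane. Products
   of curves of lower degree are not counted: p(x) d/dx + q(y) d/dy, with p and
   q generic of degree 4, has degree 4, no rational first integral and 9
   invariant lines; the 36 pairs of them would exceed the bound 28 for k = 2. *)
Definition invariant_curves (F : foliation) (k : nat) : set (set P2) :=
  [set Z | exists f, [/\ curve_equation k f, irreducible_poly3 f,
                         invariant_curve F f & Z = zero_locus f]].

Definition num_invariant_curves (F : foliation) (k : nat) : nat :=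
  #|` fset_set (invariant_curves F k)|.

(* A divisor on the plane is linearly equivalent to its degree times a line, so
   intersection numbers are products of degrees (Bezout).                     *)
Definition intersection_number (a b : int) : int := a * b.

(* The form dx dy has a pole of order 3 along the line at infinity. *)
Definition canonical_degree : int := - 3%:Z.

Definition curve_degree (f : poly3) : int := (mpoly.msize f).-1%:Z.

Definition virtual_genus (f : poly3) : rat :=
  (intersection_number (curve_degree f) (curve_degree f)
   + intersection_number (curve_degree f) canonical_degree)%:~R / 2 + 1.

End ProjectivePlane.

(* Main.v *)
(** In the affine charts the foliation is given by vector fields with values in
    O(d-1); the minors of these fields against the radial field are sections of
    O(d+1), hence (Liouville in each variable) homogeneous polynomials, and a
    Koszul argument produces a homogeneous polynomial field X of degree d on C^3
    inducing the foliation.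

    Following Pereira, let f_1, ..., f_n be the monomials of degree k and consider
    the extactic determinant E = det(X^j f_i), of degree n k + (d-1) n (n-1) / 2.
    An invariant irreducible curve f of degree k divides X f by the Nullstellensatz,
    hence divides E; distinct ones are coprime, so their number is at most
    deg E / k unless E = 0.

    If E = 0, the Wronskian gives a relation sum a_i f_i = 0 whose coefficients are
    constant along X up to a common factor. The bihomogeneous form
    G(x, x') = sum a_i(x) f_i(x') vanishes on the diagonal; an irreducible factor
    of it that does so divides P(x') Q(x) - P(x) Q(x') for two of its coefficients
    P, Q in x, and comparing degrees in x and x' makes P / Q a first integral of
    degree at most k. The bound on deg E / k is the stated one, as the genus
    formula gives 2 - 2 g(D) = 3 k - k^2. *)

Require Import Defs.
From HB Require Import structures.
From mathcomp Require Import all_boot all_order all_algebra.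
From mathcomp Require boolp.

(** The coefficients [a_i] have a large degree in x; only the degree k in x' is under control. The
    pencil form has one and the same degree m in both points, so m is at most k once a factor of G
    divides it with a constant cofactor. Comparing degrees in x leaves a cofactor in x' alone, and
    coprimality of P and Q makes it constant. The divisibility is formal. The forms G(x, x')
    vanishing at x' = exp(tX) x make up an ideal stable under the derivation in x'. It contains
    every form that vanishes on the diagonal and that the derivation in x multiplies by a function
    of x. Eliminating one coordinate of x' between two of its members leaves a binary form in the
    ideal, and there is no nonzero one unless x_0 / x_1 is itself a first integral. On the analytic
    side, holomorphy means local power series and no Cauchy integral is used: Liouville comes from
    the maximum principle. It is applied on coordinate lines with one exponent for all of them, so
    interpolation on a finite grid yields a polynomial. *)

Module Algebra.
From mathcomp Require Import mpoly perm zify ring.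
Set Implicit Arguments.
Unset Strict Implicit.
Unset Printing Implicit Defensive.
Import GRing.Theory.
Local Open Scope ring_scope.

(** * Unique factorization in polynomial rings *)

Section Divisibility.
Variable R : idomainType.
Implicit Types (a b p : R) (s : seq R).

Definition rdiv a b := exists c, b = c * a.

Definition rprime p :=
  [/\ p != 0, p \isn't a GRing.unit &
      forall a b, rdiv p (a * b) -> rdiv p a \/ rdiv p b].

Definition rirr p :=
  [/\ p != 0, p \isn't a GRing.unit &
      forall a b, p = a * b -> a \is a GRing.unit \/ b \is a GRing.unit].

(* Prime rather than irreducible factors, which makes the factorization unique. *)
Definition factorable a := exists u s,
  [/\ u \is a GRing.unit, forall p, p \in s -> rprime p &
      a = u * \prod_(p <- s) p].

Lemma rdiv_mulr a b c : rdiv a b -> rdiv a (b * c).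
Proof. by move=> [x ->]; exists (x * c); rewrite mulrAC. Qed.

Lemma rdiv_mull a b c : rdiv a b -> rdiv a (c * b).
Proof. by move=> [x ->]; exists (c * x); rewrite mulrA. Qed.

Lemma rdivD a b c : rdiv a b -> rdiv a c -> rdiv a (b + c).
Proof. by move=> [x ->] [y ->]; exists (x + y); rewrite mulrDl. Qed.

Lemma rdivN a b : rdiv a b -> rdiv a (- b).
Proof. by move=> [x ->]; exists (- x); rewrite mulNr. Qed.

Lemma rdiv_trans b a c : rdiv a b -> rdiv b c -> rdiv a c.
Proof. by move=> [x ->] [y ->]; exists (y * x); rewrite mulrA. Qed.

Lemma rdiv_refl a : rdiv a a.
Proof. by exists 1; rewrite mul1r. Qed.

Lemma rdiv0 a : rdiv a 0.
Proof. by exists 0; rewrite mul0r. Qed.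

Lemma rdiv_unit a u : u \is a GRing.unit -> rdiv a u -> a \is a GRing.unit.
Proof. by move=> uu [c e]; move: uu; rewrite e unitrM => /andP[]. Qed.

Lemma rdiv_sum a (I : Type) (r : seq I) (P : pred I) (F : I -> R) :
  (forall i, P i -> rdiv a (F i)) -> rdiv a (\sum_(i <- r | P i) F i).
Proof.
by move=> h; apply: (big_ind (rdiv a)) => //; [exact: rdiv0 | exact: rdivD].
Qed.

Lemma rprime_irr p : rprime p -> rirr p.
Proof.
move=> [p0 pu pP]; split=> // a b e.
have [[c]|[c]] := pP a b (ex_intro _ 1 (etrans (esym e) (esym (mul1r p)))).
- move=> ea; right; apply/unitrP; exists c.
  suff h : c * b = 1 by rewrite (mulrC b) h.
  by apply: (mulfI p0); rewrite mulr1 mulrA (mulrC p) -ea -e.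
- move=> eb; left; apply/unitrP; exists c.
  suff h : c * a = 1 by rewrite (mulrC a) h.
  by apply: (mulfI p0); rewrite mulr1 mulrA (mulrC p) -eb mulrC -e.
Qed.

Lemma rirr_prod a p q : rirr a -> a = p * q -> p \isn't a GRing.unit ->
  q \is a GRing.unit.
Proof. by move=> [_ _ h] /h[->|]. Qed.

Lemma rprime_unitM u p : u \is a GRing.unit -> rprime p -> rprime (p * u).
Proof.
move=> uu [p0 pu pP]; split.
- by rewrite mulf_neq0 //; apply: contraTneq uu => ->; rewrite unitr0.
- by rewrite unitrM negb_and pu.
- have h c : rdiv (p * u) c <-> rdiv p c.
    split=> [[d ->]|[d ->]]; first by exists (d * u); rewrite mulrAC mulrA.
    by exists (d * u^-1); rewrite mulrACA mulVr // mulr1.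
  by move=> a b /h/pP[] ?; [left|right]; apply/h.
Qed.

Lemma rirr_prime p : factorable p -> rirr p -> rprime p.
Proof.
move=> [u [[|q s] [uu sP e]]] ip.
  by case: ip => _; rewrite e big_nil mulr1 uu.
move: e; rewrite big_cons mulrCA => e.
have qp : rprime q by apply: sP; rewrite mem_head.
rewrite e; apply: rprime_unitM => //; apply: (rirr_prod ip e).
by case: qp.
Qed.

Lemma prod_split s u g h :
  u \is a GRing.unit -> (forall p, p \in s -> rprime p) ->
  g * h = u * \prod_(p <- s) p ->
  exists u1 s1 u2 s2,
    [/\ u1 \is a GRing.unit, u2 \is a GRing.unit,
        (forall p, p \in s1 ++ s2 -> rprime p),
        (g = u1 * \prod_(p <- s1) p /\ h = u2 * \prod_(p <- s2) p) &
        (size s1 + size s2 = size s)%N].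
Proof.
move=> uu; elim: s g h => [|q s IH] g h sP.
  rewrite big_nil mulr1 => e.
  have /andP[ug uh] : (g \is a GRing.unit) && (h \is a GRing.unit).
    by rewrite -unitrM e.
  by exists g, [::], h, [::]; split => //; rewrite !big_nil !mulr1.
rewrite big_cons mulrCA => e.
have qp : rprime q by apply: sP; rewrite mem_head.
have [q0 qu qP] := qp.
have sP' p : p \in s -> rprime p by move=> ps; apply: sP; rewrite inE ps orbT.
have [|[c ec]|[c ec]] := qP g h.
- by exists (u * \prod_(p <- s) p); rewrite e mulrC.
- have [|u1 [s1 [u2 [s2 [h1 h2 h3 [h4 h5] h6]]]]] := IH c h sP'.
    by apply: (mulfI q0); rewrite -e ec mulrA (mulrC q).
  exists u1, (q :: s1), u2, s2; split => //=.
  + by move=> p; rewrite inE => /orP[/eqP->//|]; exact: h3.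
  + by rewrite big_cons mulrCA -h4 ec mulrC.
  + by rewrite addSn h6.
- have [|u1 [s1 [u2 [s2 [h1 h2 h3 [h4 h5] h6]]]]] := IH g c sP'.
    by apply: (mulfI q0); rewrite -e ec mulrCA (mulrC q).
  exists u1, s1, u2, (q :: s2); split => //=.
  + move=> p; rewrite mem_cat inE orbCA => /orP[/eqP->//|].
    by move=> hp; apply: h3; rewrite mem_cat.
  + by split=> //; rewrite big_cons mulrCA -h5 ec mulrC.
  + by rewrite addnS h6.
Qed.

End Divisibility.

Definition ufd (R : idomainType) := forall a : R, a != 0 -> factorable a.

Lemma unit_ufd (R : idomainType) :
  (forall a : R, a != 0 -> a \is a GRing.unit) -> ufd R.
Proof. by move=> h a /h ua; exists a, [::]; rewrite big_nil mulr1. Qed.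

Section PolyUfd.
Variable R : idomainType.
Hypothesis ufdR : ufd R.
Implicit Types (f g h : {poly R}).

Lemma rdiv_polyC (p : R) f : rdiv p%:P f <-> forall i, rdiv p f`_i.
Proof.
split=> [[c ->] i|h]; first by exists c`_i; rewrite coefMC.
pose c i := projT1 (boolp.cid (h i)).
have cP i : f`_i = c i * p := projT2 (boolp.cid (h i)).
exists (\poly_(i < size f) c i); apply/polyP => i.
rewrite coefMC coef_poly; case: ltnP => // hi.
by rewrite mul0r nth_default.
Qed.

(** Gauss's lemma: take the first coefficients f_i and g_j not divisible by [p]. In the coefficient
    of index i + j of f g all other terms are divisible by [p], hence so would be f_i g_j. *)
Lemma polyC_prime (p : R) : rprime p -> rprime p%:P.
Proof.
move=> [p0 pu pP]; split; first by rewrite polyC_eq0.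
  by rewrite poly_unitE coefC eqxx size_polyC p0 /=.
move=> f g fg.
have key (F : {poly R}) : ~ rdiv p%:P F ->
    exists i, ~ rdiv p F`_i /\ forall j, (j < i)%N -> rdiv p F`_j.
  move=> nF; have : exists i, ~~ boolp.asbool (rdiv p F`_i).
    apply: boolp.contrapT => h; apply: nF; apply/rdiv_polyC => i.
    by apply: boolp.contrapT => hi; apply: h; exists i; apply/boolp.asboolPn.
  move=> h; case: (ex_minnP h) => i /boolp.asboolPn hi im; exists i; split=> // j ji.
  apply: boolp.contrapT => hj; move: (im j); rewrite leqNgt ji => /(_ _)/negP.
  by apply=> //; apply/boolp.asboolPn.
apply: boolp.contrapT => /boolp.not_orP[/key[i [ni im]] /key[j [nj jm]]].
have /rdiv_polyC/(_ (i + j)%N) := fg.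
have hi : (i < (i + j).+1)%N by rewrite ltnS leq_addr.
rewrite coefM (bigD1 (Ordinal hi)) //= addKn => h.
have : rdiv p (f`_i * g`_j).
  rewrite -[X in rdiv p X](addrK (\sum_(k < (i + j).+1 | k != Ordinal hi) f`_k * g`_(i + j - k))).
  apply: rdivD => //; apply: rdivN; apply: rdiv_sum => k kn.
  have [ki|ik|e] := ltngtP k i.
  - by apply: rdiv_mulr; apply: im.
  - apply: rdiv_mull; apply: jm; have kl := ltn_ord k.
    by rewrite ltn_subLR // ltn_add2r.
  - by case/eqP: kn; apply: val_inj.
by case/pP.
Qed.

(** A factorization over the fraction field becomes one over [R]: the prime factors of [c] stay
    prime among polynomials and are removed one by one, each from [g] or from [h]. *)
Lemma polyC_cancel (c : R) f g h : c != 0 -> c *: f = g * h ->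
  exists c1 c2 g1 h1, [/\ c1 != 0, c2 != 0, f = g1 * h1, g = c1 *: g1 &
                          h = c2 *: h1].
Proof.
move=> c0; have [u [s [uu sP ec]]] := ufdR c0; rewrite {}ec in c0 *.
elim: s g h sP {c0} => [|q s IH] g h sP.
  rewrite big_nil mulr1 => e; exists u, 1, (u^-1 *: g), h; split => //.
  - by apply: contraTneq uu => ->; rewrite unitr0.
  - exact: oner_neq0.
  - by rewrite -scalerAl -e scalerA mulVr // scale1r.
  - by rewrite scalerA divrr // scale1r.
  - by rewrite scale1r.
rewrite big_cons mulrCA => e.
have qp : rprime q by apply: sP; rewrite mem_head.
have sP' p : p \in s -> rprime p by move=> ps; apply: sP; rewrite inE ps orbT.
have [q0 _ _] := qp; have [Q0 _ QP] := polyC_prime qp.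
have [|[g' eg]|[h' eh]] := QP g h.
- by rewrite -e -scalerA -mul_polyC; exists ((u * \prod_(j <- s) j) *: f); rewrite mulrC.
- have [|c1 [c2 [g1 [h1 [a1 a2 a3 a4 a5]]]]] := IH g' h sP'.
    by apply: (mulfI Q0); rewrite mul_polyC scalerA e eg mulrA (mulrC q%:P).
  exists (q * c1), c2, g1, h1; split => //; first by rewrite mulf_neq0.
  by rewrite eg a4 mulrC mul_polyC scalerA.
- have [|c1 [c2 [g1 [h1 [a1 a2 a3 a4 a5]]]]] := IH g h' sP'.
    by apply: (mulfI Q0); rewrite mul_polyC scalerA e eh mulrA mulrC.
  exists c1, (q * c2), g1, h1; split => //; first by rewrite mulf_neq0.
  by rewrite eh a5 mulrC mul_polyC scalerA.
Qed.

(** Divisibility over the fraction field descends to [R], because an irreducible polynomial of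
    positive degree is primitive: the constant split off [f] is a unit. *)
Lemma irr_scale_dvd (c : R) f g h :
  rirr f -> (1 < size f)%N -> c != 0 -> c *: g = h * f -> rdiv f g.
Proof.
move=> [f0 fu fP] sf c0 /(polyC_cancel c0)[c1 [c2 [h1 [f1 [a1 a2 a3 a4 a5]]]]].
have uc : c2 \is a GRing.unit.
  have [||] := fP c2%:P f1; first by rewrite mul_polyC.
  - by rewrite poly_unitE coefC => /andP[].
  - rewrite poly_unitE => /andP[/eqP s1 _].
    by move: sf; rewrite a5 size_scale // s1.
exists (c2^-1 *: h1).
by rewrite a3 a5 -scalerAl -scalerAr scalerA mulVr // scale1r.
Qed.

(** Substitute for the resultant. A gcd of positive degree would be [f] up to constants and force
    [f] to divide [g]; otherwise Bezout over the fraction field, cleared of denominators, gives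
    [r]. *)
Lemma irr_poly_bezout f g : rirr f -> (1 < size f)%N -> ~ rdiv f g ->
  exists u v (r : R), r != 0 /\ u * f + v * g = r%:P.
Proof.
move=> irf sf ndv; have [f0 fu fP] := irf.
have [s1|s1] := eqVneq (size (gcdp f g)) 1%N.
  have /Bezout_coprimepP[[u v] /= e] : coprimep f g by rewrite /coprimep s1.
  have : size (u * f + v * g) = 1%N by rewrite (eqp_size e) size_poly1.
  by move/eqP/size_poly1P => [r r0 er]; exists u, v, r.
have d0 : gcdp f g != 0 by rewrite gcdp_eq0 negb_and f0.
have s2 : (1 < size (gcdp f g))%N by rewrite ltn_neqAle eq_sym s1 lt0n size_poly_eq0.
have /Pdiv.Idomain.dvdpP[[c q] /= c0 e1] := dvdp_gcdl f g.
have /Pdiv.Idomain.dvdpP[[c' q'] /= c0' e2] := dvdp_gcdr f g.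
have [c1 [c2 [q1 [h1 [a1 a2 a3 a4 a5]]]]] := polyC_cancel c0 e1.
have hu : h1 \isn't a GRing.unit.
  rewrite poly_unitE -(size_scale h1 a2) -a5.
  by apply/negP => /andP[/eqP e]; rewrite e eqxx in s1.
have uq : q1 \is a GRing.unit.
  by rewrite mulrC in a3; apply: (rirr_prod irf a3).
case: ndv; apply: (irr_scale_dvd (h := (c2 *: q') * q1^-1) irf sf c0').
by rewrite a3 mulrA mulrVK // -scalerAl scalerAr -a5.
Qed.

Lemma irr_poly_prime f : rirr f -> (1 < size f)%N -> rprime f.
Proof.
move=> irf sf; have [f0 fu fP] := irf; split => // g h [w e].
case: (boolp.EM (rdiv f g)) => [|ng]; [by left|right].
have [u [v [r [r0 er]]]] := irr_poly_bezout irf sf ng.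
apply: (irr_scale_dvd (h := u * h + v * w) irf sf r0).
by rewrite -mul_polyC -er !mulrDl -[v * g * h]mulrA e -!mulrA [f * h]mulrC.
Qed.

(** Induction on the size of [f] plus the number of prime factors of its leading coefficient:
    splitting off a nonunit constant lowers the second term, splitting off a factor of positive
    degree the first. *)
Lemma ufd_poly : ufd {poly R}.
Proof.
move=> f f0; have lf0 : lead_coef f != 0 by rewrite lead_coef_eq0.
have [u [s [uu sP e]]] := ufdR lf0.
have [n] := ubnP (size f + size s)%N.
elim: n f s u f0 {lf0} uu sP e => // n IH f s u f0 uu sP e hn.
have [sf|sf] := leqP (size f) 1.
  exists u%:P, (map polyC s); split.
  - rewrite poly_unitE coefC eqxx size_polyC uu andbT.
    by have -> : u != 0 by apply: contraTneq uu => ->; rewrite unitr0.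
  - by move=> p /mapP[q qs ->]; apply: polyC_prime; exact: sP.
  - by rewrite (size1_polyC sf) big_map -rmorph_prod -polyCM -e lead_coefE; case: (size f) sf => [|[]].
case: (boolp.EM (rirr f)) => [irf|nirr].
  exists 1, [:: f]; rewrite unitr1 big_seq1 mul1r; split => // p.
  by rewrite inE => /eqP->; exact: irr_poly_prime.
have [g [h [ef gu hu]]] : exists g h, [/\ f = g * h,
    g \isn't a GRing.unit & h \isn't a GRing.unit].
  apply: boolp.contrapT => hN; apply: nirr; split => //.
    by rewrite poly_unitE; apply: contraTN sf => /andP[/eqP->].
  move=> g h ef; case: (boolP (g \is a GRing.unit)) => [|gu]; [by left|right].
  by apply: boolp.contrapT => /negP hu; apply: hN; exists g, h.
have [g0 h0] : g != 0 /\ h != 0.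
  by move: f0; rewrite ef mulf_eq0 negb_or => /andP[].
have := e; rewrite ef lead_coefM.
move/(prod_split uu sP) => [u1 [s1 [u2 [s2 [uu1 uu2 sP12 [eg eh] ss]]]]].
(* A nonunit weighs at least 2, and the weight of a product is the sum of the weights minus 1, so
   each factor weighs strictly less than [f]. *)
have gt1 (F : {poly R}) v t : F != 0 -> F \isn't a GRing.unit ->
    v \is a GRing.unit -> lead_coef F = v * \prod_(p <- t) p ->
    (1 < size F + size t)%N.
  move=> F0 Fu uv eF; rewrite ltnNge; apply: contra Fu => le1.
  have sF : size F = 1%N.
    by apply/eqP; rewrite eqn_leq lt0n size_poly_eq0 F0 andbT (leq_trans _ le1) // leq_addr.
  rewrite poly_unitE sF eqxx; move: le1; rewrite sF -{2}[1%N]addn0 leq_add2l leqn0.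
  by move=> /nilP t0; move: eF; rewrite lead_coefE sF t0 big_nil mulr1 => ->.
have sz : (size f + size s = (size g + size s1 + (size h + size s2)).-1)%N.
  rewrite ef size_mul // -ss addnACA.
  by case: (size g) (size_poly_eq0 g) g0 => [<-//|k] _ _; rewrite !addSn.
have G1 := gt1 _ _ _ g0 gu uu1 eg; have H1 := gt1 _ _ _ h0 hu uu2 eh.
have [| |v1 [t1 [w1 p1 ->]]] := IH g s1 u1 g0 uu1 _ eg.
- by move=> p hp; apply: sP12; rewrite mem_cat hp.
- move: hn; rewrite sz ltnS; move: G1 H1.
  case: (size h + size s2)%N => // [[|m]] // _ _; rewrite !addnS /=.
  by move=> hn; apply: leq_trans hn; rewrite ltnS leq_addr.
have [| |v2 [t2 [w2 p2 ->]]] := IH h s2 u2 h0 uu2 _ eh.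
- by move=> p hp; apply: sP12; rewrite mem_cat hp orbT.
- move: hn; rewrite sz ltnS; move: G1 H1.
  case: (size g + size s1)%N => // [[|m]] // _ _; rewrite !addSn /=.
  by move=> hn; apply: leq_trans hn; rewrite ltnS leq_addl.
exists (v1 * v2), (t1 ++ t2); split; first by rewrite unitrM w1.
- by move=> p; rewrite mem_cat => /orP[/p1|/p2].
- by rewrite big_cat mulrACA.
Qed.
End PolyUfd.

(** * The Nullstellensatz for a hypersurface *)

Section UfdIso.
Variables (A B : idomainType) (f : {rmorphism A -> B}) (g : {rmorphism B -> A}).
Hypotheses (fK : cancel f g) (gK : cancel g f).

Lemma rdiv_rmorph a b : rdiv a b -> rdiv (f a) (f b).
Proof. by move=> [c ->]; exists (f c); rewrite rmorphM. Qed.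

Lemma unit_iso a : (f a \is a GRing.unit) = (a \is a GRing.unit).
Proof.
apply/idP/idP => [h|]; last exact: rmorph_unit.
by rewrite -(fK a); exact: rmorph_unit.
Qed.

End UfdIso.

Section UfdIso2.
Variables (A B : idomainType) (f : {rmorphism A -> B}) (g : {rmorphism B -> A}).
Hypotheses (fK : cancel f g) (gK : cancel g f).

Lemma rdiv_iso a b : rdiv (f a) (f b) -> rdiv a b.
Proof. by move/(rdiv_rmorph g); rewrite !fK. Qed.

Lemma rprime_iso p : rprime p -> rprime (g p).
Proof.
move=> [p0 pu pP]; split.
- by rewrite -(rmorph0 g) (inj_eq (can_inj gK)).
- by rewrite (unit_iso gK).
- move=> a b /(rdiv_rmorph f); rewrite gK rmorphM.
  by case/pP => h; [left|right]; apply: rdiv_iso; rewrite gK.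
Qed.

Lemma rirr_iso p : rirr p -> rirr (f p).
Proof.
move=> [p0 pu pP]; split.
- by rewrite -(rmorph0 f) (inj_eq (can_inj fK)).
- by rewrite (unit_iso fK).
- move=> a b e; rewrite -(unit_iso gK a) -(unit_iso gK b).
  by apply: pP; rewrite -rmorphM -e fK.
Qed.

Lemma ufd_iso : ufd B -> ufd A.
Proof.
move=> ufdB a a0.
have [|u [s [uu sP e]]] := ufdB (f a).
  by rewrite -(rmorph0 f) (inj_eq (can_inj fK)).
exists (g u), (map g s); split; first by rewrite (unit_iso gK).
- by move=> p /mapP[q qs ->]; apply: rprime_iso; exact: sP.
- by rewrite big_map -rmorph_prod -rmorphM -e fK.
Qed.
End UfdIso2.

Lemma rmorph_mpoly_ext n (R : nzRingType) (S : nzRingType)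
    (f g : {rmorphism {mpoly R[n]} -> S}) :
  (forall c, f c%:MP = g c%:MP) -> (forall i, f 'X_i = g 'X_i) -> f =1 g.
Proof.
move=> fgC fgX; elim/mpolyind => [|c m p _ _ IH]; first by rewrite !rmorph0.
rewrite !rmorphD IH -mul_mpolyC !rmorphM fgC; congr (_ * _ + _).
rewrite mpolyXE_id !rmorph_prod; apply: eq_bigr => i _.
by rewrite !rmorphXn fgX.
Qed.

(** * Polynomials in n + 1 variables as univariate polynomials *)

Section Muni.
Variables (n : nat) (R : comNzRingType).
Local Notation widen := (widen_ord (leqnSn n)).

Lemma muniXw (i : 'I_n) : muni 'X_(widen i) = ('X_i)%:P :> {poly {mpoly R[n]}}.
Proof.
rewrite muniE msuppX big_seq1 mcoeffX eqxx scale1r mnm1E.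
have -> : (widen i == ord_max) = false.
  by apply/negbTE; rewrite -val_eqE /= neq_ltn ltn_ord.
rewrite expr0 alg_polyC; congr ('X_[_])%:P.
by apply/mnmP => j; rewrite mnmE !mnm1E -!val_eqE.
Qed.

Lemma muniXmax : muni 'X_ord_max = 'X :> {poly {mpoly R[n]}}.
Proof.
rewrite muniE msuppX big_seq1 mcoeffX eqxx scale1r mnm1E eqxx expr1.
rewrite (_ : [multinom _ | _ < n] = 0%MM) ?mpolyX0 ?scale1r //.
apply/mnmP => j; rewrite mnmE mnm1E mnm0E -val_eqE /=.
by rewrite gtn_eqF // ltn_ord.
Qed.

(** Inverse of [muni]: the polynomial variable becomes the last of the n + 1 variables. *)
Definition munii : {poly {mpoly R[n]}} -> {mpoly R[n.+1]} :=
  horner_eval ('X_ord_max) \o map_poly (@mwiden n R).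

HB.instance Definition _ := GRing.RMorphism.on munii.

Lemma muniiD (p q : {poly {mpoly R[n]}}) : munii (p + q) = munii p + munii q.
Proof. exact: rmorphD. Qed.

Lemma muniiM (p q : {poly {mpoly R[n]}}) : munii (p * q) = munii p * munii q.
Proof. exact: rmorphM. Qed.

Lemma muniiC (p : {mpoly R[n]}) : munii p%:P = mwiden p.
Proof. by rewrite /munii /= map_polyC /= horner_evalE hornerC. Qed.

Lemma muniiX : munii 'X = 'X_ord_max.
Proof. by rewrite /munii /= map_polyX horner_evalE hornerX. Qed.

Lemma muni_mwiden (p : {mpoly R[n]}) : muni (mwiden p) = p%:P.
Proof.
apply: (rmorph_mpoly_ext (f := @muni n R \o @mwiden n R) (g := polyC)) => [c|i] /=.
  by rewrite mwidenC muniC.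
by rewrite mwidenX mnmwiden1 muniXw.
Qed.

Lemma ord_widenP (i : 'I_n.+1) : (exists j, i = widen j) \/ i = ord_max.
Proof.
have [h|h] := ltnP i n.
  by left; exists (Ordinal h); apply: val_inj.
by right; apply/val_inj/eqP; rewrite eqn_leq -ltnS ltn_ord.
Qed.

Lemma muniK : cancel (@muni n R) munii.
Proof.
apply: (rmorph_mpoly_ext (f := munii \o @muni n R) (g := idfun)) => [c|i] /=.
  by rewrite muniC muniiC mwidenC.
have [[j ->]|->] := ord_widenP i.
  by rewrite muniXw muniiC mwidenX mnmwiden1.
by rewrite muniXmax muniiX.
Qed.

Lemma munii_bezout (u v : {poly {mpoly R[n]}}) (f g : {mpoly R[n.+1]}) r :
  u * muni f + v * muni g = r%:P -> munii u * f + munii v * g = mwiden r.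
Proof.
move=> e; rewrite -muniiC -e.
rewrite [RHS]muniiD; congr (_ + _).
  by rewrite [RHS]muniiM; congr (_ * _); exact/esym/muniK.
by rewrite [RHS]muniiM; congr (_ * _); exact/esym/muniK.
Qed.

Lemma muniiK : cancel munii (@muni n R).
Proof.
elim/poly_ind => [|p c IH]; first by rewrite !rmorph0.
by rewrite !rmorphD !rmorphM /= IH muniiX muniXmax muniiC muni_mwiden.
Qed.

(** The point with first coordinates [v] and last coordinate [t]. *)
Definition vext (v : 'I_n -> R) (t : R) (i : 'I_n.+1) : R :=
  if insub (i : nat) : option 'I_n is Some j then v j else t.

Lemma vext_widen v t j : vext v t (widen j) = v j.
Proof. by rewrite /vext /= valK. Qed.

Lemma vext_max v t : vext v t ord_max = t.
Proof. by rewrite /vext insubN //= ltnn. Qed.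

Lemma muni_eval v t (p : {mpoly R[n.+1]}) :
  p.@[vext v t] = (map_poly (meval v) (muni p)).[t].
Proof.
pose g := horner_eval t \o (map_poly (meval v) \o @muni n R).
apply: (rmorph_mpoly_ext (f := meval (vext v t)) (g := g)) => [c|i] /=.
  by rewrite mevalC muniC map_polyC /= mevalC horner_evalE hornerC.
have [[j ->]|->] := ord_widenP i.
  by rewrite mevalXU vext_widen muniXw map_polyC /= mevalXU horner_evalE hornerC.
by rewrite mevalXU vext_max muniXmax map_polyX horner_evalE hornerX.
Qed.
End Muni.

Lemma ufd_mpoly n (R : idomainType) : ufd R -> ufd {mpoly R[n]}.
Proof.
move=> ufdR; elim: n => [|n IH].
  exact: (@ufd_iso {mpoly R[0]} R (@mcoeff 0 R 0%MM) (@mpolyC 0 R)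
    (@mpolyKC R) (@mpolyCK 0 R) ufdR).
exact: (@ufd_iso {mpoly R[n.+1]} {poly {mpoly R[n]}} (@muni n R) (@munii n R)
  (@muniK n R) (@muniiK n R) (ufd_poly IH)).
Qed.

Lemma rdiv_muni n (R : idomainType) (f g : {mpoly R[n.+1]}) :
  rdiv (muni f) (muni g) -> rdiv f g.
Proof.
exact: (@rdiv_iso {mpoly R[n.+1]} {poly {mpoly R[n]}} (@muni n R) (@munii n R)
  (@muniK n R)).
Qed.

Lemma rirr_muni n (R : idomainType) (f : {mpoly R[n.+1]}) :
  rirr f -> rirr (muni f).
Proof.
exact: (@rirr_iso {mpoly R[n.+1]} {poly {mpoly R[n]}} (@muni n R) (@munii n R)
  (@muniK n R) (@muniiK n R)).
Qed.

Lemma mpolyC_unit n (R : idomainType) (c : R) :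
  c \is a GRing.unit -> c%:MP_[n] \is a GRing.unit.
Proof. exact: rmorph_unit. Qed.

Section Nullstellensatz.
Variable F : idomainType.
Hypothesis unitF : forall x : F, x != 0 -> x \is a GRing.unit.
Hypothesis nonrootF : forall p : {poly F}, p != 0 -> exists x, p.[x] != 0.
Hypothesis rootF : forall p : {poly F}, size p != 1%N -> exists x, p.[x] = 0.

Lemma mpoly_nonroot n (p : {mpoly F[n]}) : p != 0 -> exists v, p.@[v] != 0.
Proof.
elim: n p => [|n IH] p p0.
  exists (fun=> 0); apply: contraNneq p0.
  by rewrite (nvar0_mpolyC p) mevalC => ->; rewrite mpolyC0.
have q0 : muni p != 0 by rewrite -(rmorph0 (@muni n F)) (inj_eq (can_inj (@muniK _ _))).
have [|v hv] := IH (lead_coef (muni p)); first by rewrite lead_coef_eq0.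
have /nonrootF[t ht] : map_poly (meval v) (muni p) != 0.
  apply: contraNneq hv => /(congr1 (fun r : {poly F} => r`_(size (muni p)).-1)).
  by rewrite coef_map coef0 => ->.
by exists (vext v t); rewrite muni_eval.
Qed.

Lemma mpoly_eq0_eval n (p : {mpoly F[n]}) : (forall v, p.@[v] = 0) -> p = 0.
Proof.
move=> h; apply/eqP; apply: contraT => /mpoly_nonroot[v].
by rewrite h eqxx.
Qed.

(** Induction on the number of variables. If [f] involves the last one and does not divide [g],
    Bezout puts a nonzero [r] free of it in the ideal of [f] and [g]. Over a point where [r] and the
    leading coefficient of [f] are nonzero, [f] still has a root, which is then a root of [g] and
    hence of [r]. The hypotheses on [F] say that it is an algebraically closed field. *)
Theorem irr_nullstellensatz n (f g : {mpoly F[n]}) :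
  rirr f -> (forall v, f.@[v] = 0 -> g.@[v] = 0) -> rdiv f g.
Proof.
have ufdM m : ufd {mpoly F[m]} := ufd_mpoly (unit_ufd unitF).
elim: n f g => [|n IH] f g irf fg.
  have [f0 + _] := irf; rewrite (nvar0_mpolyC f) => /negP[].
  apply/mpolyC_unit/unitF.
  by apply: contraNneq f0 => e; rewrite (nvar0_mpolyC f) e mpolyC0.
apply: rdiv_muni.
have irF := rirr_muni irf.
have FG v t : (map_poly (meval v) (muni f)).[t] = 0 ->
    (map_poly (meval v) (muni g)).[t] = 0.
  by have := fg (vext v t); rewrite (muni_eval v t f) (muni_eval v t g).
move: (muni f) (muni g) irF FG => {irf fg f g} f g irf fg.
(* When [f] does not involve the last variable, it has to divide each coefficient of [g], which is
   the induction hypothesis. *)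
have [sf|sf] := leqP (size f) 1.
  have := size1_polyC sf; move: f`_0 => c ef; subst f.
  have irf0 : rirr c.
    case: irf => [f0 fu fP]; split.
    - by rewrite polyC_eq0 in f0.
    - by apply: contra fu; exact: rmorph_unit.
    - move=> a b e; have [||] := fP a%:P b%:P; first by rewrite e polyCM.
      + by rewrite poly_unitE coefC => /andP[_ ->]; left.
      + by rewrite poly_unitE coefC => /andP[_ ->]; right.
  apply/rdiv_polyC => i; apply: IH => // v hv.
  have /polyP/(_ i) : map_poly (meval v) g = 0.
    apply/eqP; apply: contraT => /nonrootF[t /negP[]].
    by rewrite fg // map_polyC /= hornerC hv.
  by rewrite coef_map coef0.
apply: boolp.contrapT => ndv.
have [u [w [r [r0 e]]]] := irr_poly_bezout (ufdM n) irf sf ndv.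
have [f0 _ _] := irf.
have [|v] := mpoly_nonroot (p := r * lead_coef f).
  by rewrite mulf_neq0 // lead_coef_eq0.
rewrite mevalM mulf_eq0 negb_or => /andP[rv lv].
have /rootF[t ht] : size (map_poly (meval v) f) != 1%N.
  by rewrite size_map_poly_id0 // neq_ltn sf orbT.
have /(congr1 (fun p => (map_poly (meval v) p).[t])) := e.
rewrite rmorphD !rmorphM map_polyC /= hornerD !hornerM hornerC.
by rewrite ht fg // !mulr0 addr0 => /esym/eqP; rewrite (negbTE rv).
Qed.

End Nullstellensatz.

(** * Homogeneous components and factors of homogeneous polynomials *)

Section HomogFactor.
Variables (n : nat) (R : idomainType).
Implicit Types f g : {mpoly R[n]}.

(** Substitution of X_i T for X_i, which turns the homogeneous components into the coefficients of
    the powers of T. *)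
Definition mgrade : {mpoly R[n]} -> {poly {mpoly R[n]}} :=
  mmap (polyC \o @mpolyC n R) (fun i => ('X_i)%:P * 'X).
Lemma mgradeM f g : mgrade (f * g) = mgrade f * mgrade g.
Proof. exact: rmorphM. Qed.

Lemma mgradeD f g : mgrade (f + g) = mgrade f + mgrade g.
Proof. exact: mmapD. Qed.

Lemma mgradeZX c m : mgrade (c *: 'X_[m]) = (c *: 'X_[m])%:P * 'X^(mdeg m).
Proof.
rewrite /mgrade mmapZ mmapX.
have -> : mmap1 (fun i => ('X_i)%:P * 'X) m = ('X_[m])%:P * 'X^(mdeg m) :> {poly {mpoly R[n]}}.
  rewrite /mmap1 mdegE -prodrXr mpolyXE_id rmorph_prod -big_split /=.
  by apply: eq_bigr => j _; rewrite rmorphXn exprMn.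
by rewrite /= mulrA -polyCM mul_mpolyC.
Qed.

Lemma coef_mgrade f i : (mgrade f)`_i = pihomog mdeg i f.
Proof.
elim/mpolyind: f => [|c m p _ _ IH]; first by rewrite /mgrade mmap0 pihomog0 coef0.
rewrite mgradeD.
rewrite coefD.
rewrite mgradeZX.
rewrite coefCM coefXn [RHS]pihomogD.
congr (_ + _); last exact: IH.
rewrite [RHS]linearZ /=.
rewrite pihomogX eq_sym.
by case: eqP; rewrite ?mulr1 ?mulr0 ?scaler0.
Qed.

Lemma dhomog_pihomog d f :
  f \is d.-homog <-> (forall i, i != d -> pihomog mdeg i f = 0).
Proof.
split=> [fd i id|h]; first by apply: pihomog_ne0 fd; rewrite eq_sym.
have -> : f = pihomog mdeg d f; last exact: pihomogP.
rewrite {1}(pihomog_partitionE (k := maxn (msize f) d.+1) (leq_maxl _ _)).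
have hd : (d < maxn (msize f) d.+1)%N by rewrite leq_maxr.
rewrite (bigD1 (Ordinal hd)) //= big1 ?addr0 // => i /eqP ni; apply: h.
by apply/eqP => e; apply: ni; apply: val_inj.
Qed.

(** The lowest terms of [f] and [g] multiply to a nonzero term, and so do the highest ones; if these
    coincide in the product, each factor has only one term. *)
Lemma monomial_factor (D : idomainType) (f g : {poly D}) (c : D) d : c != 0 ->
  f * g = c *: 'X^d -> exists e, forall i, i != e -> f`_i = 0.
Proof.
move=> c0 e; have fg0 : f * g != 0 by rewrite e scale_poly_eq0 negb_or c0 monic_neq0 ?monicXn.
have [f0 g0] : f != 0 /\ g != 0 by move: fg0; rewrite mulf_eq0 negb_or => /andP[].
have low (p : {poly D}) : p != 0 -> exists i, p`_i != 0 /\ forall j, (j < i)%N -> p`_j = 0.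
  move=> p0; have h : exists i, p`_i != 0 by exists (size p).-1; rewrite -lead_coefE lead_coef_eq0.
  case: (ex_minnP h) => i hi im; exists i; split => // j ji; apply/eqP.
  by apply: contraTT ji => /im; rewrite leqNgt.
have [a [fa la]] := low f f0; have [b [gb lb]] := low g g0.
have : (f * g)`_(a + b) != 0.
  have ha : (a < (a + b).+1)%N by rewrite ltnS leq_addr.
  rewrite coefM (bigD1 (Ordinal ha)) //= addKn big1 ?addr0 ?mulf_neq0 // => k kn.
  have [ki|ik|ek] := ltngtP k a.
  - by rewrite la // mul0r.
  - by rewrite lb ?mulr0 //; have := ltn_ord k; move: ik; lia.
  - by case/eqP: kn; apply: val_inj.
rewrite e coefZ coefXn; have [ab _|] := eqVneq (a + b)%N d; last by rewrite mulr0 eqxx.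
have := congr1 (fun p : {poly D} => size p) e.
rewrite /= size_mul // size_scale // size_polyXn -ab => sz.
have ga : (b < size g)%N by apply: contraNltn gb => h; rewrite nth_default.
have fa' : (a < size f)%N by apply: contraNltn fa => h; rewrite nth_default.
exists a => i; rewrite neq_ltn => /orP[/la//|ai]; apply: nth_default.
have arith (x y : nat) : ((x + y).-1 = (a + b).+1 -> b < y -> a < x ->
  a < i -> x <= i)%N by lia.
exact: arith sz ga fa' ai.
Qed.

Lemma homog_factor d f g : f * g != 0 -> f * g \is d.-homog ->
  exists e, f \is e.-homog.
Proof.
move=> fg0 fgd.
have e : mgrade f * mgrade g = (f * g) *: 'X^d.
  apply/polyP => i; rewrite -mgradeM coef_mgrade coefZ coefXn.
  have [->|id] := eqVneq i d; first by rewrite mulr1 pihomog_dE.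
  by rewrite mulr0; move/dhomog_pihomog: fgd; apply.
have [a ha] := monomial_factor fg0 e.
by exists a; apply/dhomog_pihomog => i /ha; rewrite coef_mgrade.
Qed.

Lemma rdiv_homog d f g : g != 0 -> rdiv f g -> g \is d.-homog ->
  exists e, f \is e.-homog.
Proof. by move=> g0 [c e] gd; apply: (@homog_factor d f c); rewrite mulrC -e. Qed.

End HomogFactor.

Lemma mpoly_ring_ind (n : nat) (F : comNzRingType) (P : {mpoly F[n]} -> Prop) :
  (forall c, P c%:MP) -> (forall i, P 'X_i) ->
  (forall p q, P p -> P q -> P (p + q)) -> (forall p q, P p -> P q -> P (p * q)) ->
  forall p, P p.
Proof.
move=> PC PX PD PM; elim/mpolyind => [|c m p _ _ Pp]; first by rewrite -mpolyC0.
apply: (PD) Pp; rewrite -mul_mpolyC; apply: (PM) => //.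
rewrite mpolyXE_id; elim/big_ind: _ => [||i _]; first by rewrite -mpolyC1.
  exact: PM.
elim: (m _) => [|e IH]; first by rewrite expr0 -mpolyC1.
by rewrite exprS; exact: PM.
Qed.

Lemma mderivXU (n : nat) (F : comNzRingType) (i j : 'I_n) :
  ('X_i : {mpoly F[n]})^`M(j) = (i == j)%:R.
Proof.
rewrite mderivX mnm1E; case: eqP => [->|_]; last by rewrite scale0r.
by rewrite scale1r -{1}[U_(j)%MM]add0m addmK mpolyX0.
Qed.

Lemma homog_meval (n : nat) (F : comNzRingType) e (p : {mpoly F[n]}) c v : p \is e.-homog ->
  p.@[fun i => c * v i] = c ^+ e * p.@[v].
Proof.
move=> /dhomogP ph; rewrite !mevalE mulr_sumr; apply: eq_big_seq => m mp.
rewrite mulrCA; congr (_ * _); have -> : e = mdeg m by rewrite -(ph m mp).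
rewrite mdegE -prodrXr -big_split /=.
by apply: eq_bigr => i _; rewrite exprMn.
Qed.

(** * Wronskians and derivations *)

Section Wronskian.
Variables (S : idomainType) (D : {additive S -> S}).
Hypothesis derivM : forall a b, D (a * b) = D a * b + a * D b.
Variable f : nat -> S.

Definition wronskian_mx n : 'M[S]_n := \matrix_(i < n, j < n) iter j D (f i).

(** Go down from n to the m where the Wronskian of the first m functions is nonzero and that of the
    first m + 1 is zero. The cofactors of the last column then satisfy relations with all
    derivatives of order at most m, and the last cofactor is the nonzero Wronskian. Differentiating
    the relations of order less than m shows that [D] kills the ratios of the cofactors to the last
    one. *)
Lemma wronskian_relation n : \det (wronskian_mx n) = 0 ->
  exists2 m, (m < n)%N & let a i := cofactor (wronskian_mx m.+1) i ord_max in
    [/\ a ord_max != 0, \sum_i a i * f i = 0 &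
        forall i, a ord_max * D (a i) = a i * D (a ord_max)].
Proof.
elim: n => [|n IH]; first by rewrite det_mx00 => /eqP; rewrite oner_eq0.
have [/IH[m mn hm]|w0] := eqVneq (\det (wronskian_mx n)) 0.
  by exists m => //; exact: ltnW.
move=> det0; exists n => // a.
have aM (j : 'I_n.+1) : \sum_i a i * iter j D (f i) = 0.
  have /matrixP/(_ ord_max j) := mul_adj_mx (wronskian_mx n.+1).
  rewrite det0 !mxE mul0rn => e; rewrite -[RHS]e.
  by apply: eq_bigr => i _; rewrite !mxE.
have amax : a ord_max != 0.
  rewrite /a /cofactor exprD -expr2 sqrr_sign mul1r; apply: contraNneq w0 => <-.
  apply/eqP; congr (\det _); apply/matrixP => i j.
  by rewrite !mxE !lift_max.
move: a aM amax => a aM amax.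
split=> // [|i]; first exact: (aM ord0).
have daM (j : 'I_n) : \sum_i D (a i) * iter j D (f i) = 0.
  have hj : (j < n.+1)%N by rewrite ltnS ltnW.
  have hj' : (j.+1 < n.+1)%N by rewrite ltnS.
  have := congr1 D (aM (Ordinal hj)); rewrite raddf0 raddf_sum /=.
  under eq_bigr do rewrite derivM.
  by rewrite big_split /= (aM (Ordinal hj')) addr0.
(* Up to the square of [a ord_max], [b i] is the derivative of a_i / a_max. Its last entry vanishes,
   and the others form a row killed by a matrix of nonzero determinant. *)
pose b i := a ord_max * D (a i) - a i * D (a ord_max).
suff bE : forall l : 'I_n, b (lift ord_max l) = 0.
  case: (unliftP ord_max i) => [l ->|->]; last by rewrite mulrC.
  by apply/eqP; rewrite -subr_eq0; apply/eqP/bE.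
move=> l; have bM (j : 'I_n) : \sum_(l < n) b (lift ord_max l) * iter j D (f l) = 0.
  have hj : (j < n.+1)%N by rewrite ltnS ltnW.
  transitivity (\sum_i b i * iter j D (f i)).
    rewrite big_ord_recr /= {3}/b mulrC subrr mulr0 addr0.
    apply: eq_bigr => q _; congr (b _ * _).
    by apply: val_inj; rewrite /= /bump leqNgt ltn_ord.
  under eq_bigr => q _ do rewrite /b mulrBl [a q * _]mulrC -!mulrA.
  have /= e := aM (Ordinal hj).
  by rewrite sumrB -!mulr_sumr daM e !mulr0 subrr.
pose bv : 'rV[S]_n := \row_l b (lift ord_max l).
have : bv *m wronskian_mx n = 0.
  apply/rowP => j; rewrite !mxE -[RHS](bM j).
  by apply: eq_bigr => q _; rewrite !mxE.
move/(congr1 (mulmxr (\adj (wronskian_mx n)))) => /=.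
rewrite -mulmxA mul_mx_adj mul0mx mul_mx_scalar => /rowP/(_ l).
by rewrite !mxE => /eqP; rewrite mulf_eq0 (negbTE w0) => /eqP.
Qed.

(** The row of the [c i] times the Wronskian matrix has the iterated derivatives of [g] as entries,
    all divisible by [g]; the adjugate then isolates c_i times the determinant. *)
Lemma rdiv_wronskian n (c : 'I_n -> S) (g : S) i :
  (forall i, D (c i) = 0) -> g = \sum_i c i * f i -> rdiv g (D g) ->
  rdiv g (c i * \det (wronskian_mx n)).
Proof.
move=> Dc ge gDg.
have itg j : iter j D g = \sum_i c i * iter j D (f i).
  elim: j => [//|j IH] /=; rewrite IH raddf_sum; apply: eq_bigr => l _.
  by rewrite derivM Dc mul0r add0r.
have gitg j : rdiv g (iter j D g).
  elim: j => [|j [u IH]] /=; first exact: rdiv_refl.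
  by rewrite IH derivM; apply: rdivD; apply: rdiv_mull => //; exact: rdiv_refl.
pose cv : 'rV[S]_n := \row_i c i.
have /rowP/(_ i) : cv *m wronskian_mx n *m \adj (wronskian_mx n) =
   \det (wronskian_mx n) *: cv by rewrite -mulmxA mul_mx_adj mul_mx_scalar.
rewrite !mxE mulrC => <-; apply: rdiv_sum => j _; apply: rdiv_mulr.
rewrite !mxE; have := gitg j; rewrite itg; congr rdiv.
by apply: eq_bigr => l _; rewrite !mxE.
Qed.

End Wronskian.

(** * Homogeneous polynomials and derivations along polynomial fields *)

Section Homog.
Variables (n : nat) (R : comNzRingType).
Implicit Types f g : {mpoly R[n]}.

Lemma dhomog_prodr (I : Type) (r : seq I) (e : I -> nat) (F : I -> {mpoly R[n]}) :
  (forall i, F i \is (e i).-homog) ->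
  \prod_(i <- r) F i \is (\sum_(i <- r) e i).-homog.
Proof.
move=> h; elim: r => [|i r IH]; first by rewrite !big_nil dhomog1.
by rewrite !big_cons dhomogM.
Qed.

Lemma dhomog_det p (A : 'M[{mpoly R[n]}]_p) (e : 'I_p -> nat) :
  (forall i j, A i j \is (e j).-homog) -> \det A \is (\sum_j e j).-homog.
Proof.
move=> h; apply: rpred_sum => s _; rewrite -signr_odd mulr_sign.
suff hp : \prod_i A i (s i) \is (\sum_j e j).-homog.
  by case: ifP; rewrite ?rpredN.
rewrite [(\sum_j e j)%N](reindex_inj (@perm_inj _ s)) /=.
by apply: dhomog_prodr => i; exact: h.
Qed.

Lemma dhomog_mderiv k f i : f \is k.-homog -> f^`M(i) \is (k.-1).-homog.
Proof.
move=> /dhomogP fk; apply/dhomogP => m; rewrite mcoeff_msupp mcoeff_deriv => h.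
have /fk : (m + U_(i))%MM \in msupp f.
  by rewrite mcoeff_msupp; apply: contraNneq h => ->; rewrite mul0rn.
by rewrite /= mdegD mdeg1 addn1 => <-.
Qed.

Lemma euler_homog k f : f \is k.-homog -> \sum_i 'X_i * f^`M(i) = f *+ k.
Proof.
move=> /dhomogP fk; rewrite {1 2}[f]mpolyE.
under eq_bigr do rewrite raddf_sum mulr_sumr.
rewrite exchange_big /= -sumrMnl !big_seq; apply: eq_bigr => m mf.
rewrite -(fk m mf) /= mdegE -sumrMnr; apply: eq_bigr => i _.
rewrite mderivZ mderivX -!scalerAr -mpolyXD addmC.
have [m0|m0] := posnP (m i); first by rewrite m0 scale0r scaler0 mulr0n.
rewrite submK ?lep1mP -?lt0n //.
by rewrite scaler_nat scalerMnr.
Qed.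

Variable X : 'I_n -> {mpoly R[n]}.

Definition vder f := \sum_i X i * f^`M(i).

Lemma vder_is_additive : zmod_morphism vder.
Proof.
by move=> f g; rewrite /vder -sumrB; apply: eq_bigr => i _; rewrite mderivB mulrBr.
Qed.
HB.instance Definition _ := GRing.isZmodMorphism.Build _ _ vder vder_is_additive.

Lemma vderD f g : vder (f + g) = vder f + vder g. Proof. exact: raddfD. Qed.
Lemma vder0 : vder 0 = 0. Proof. exact: raddf0. Qed.

Lemma vderM f g : vder (f * g) = vder f * g + f * vder g.
Proof.
rewrite /vder mulr_suml mulr_sumr -big_split; apply: eq_bigr => i _ /=.
by rewrite mderivM mulrDr (mulrCA f) (mulrA (X i) _ g).
Qed.

Lemma vderC c : vder c%:MP = 0.
Proof. by rewrite /vder big1 // => i _; rewrite mderivC mulr0. Qed.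

Lemma vderX i : vder 'X_i = X i.
Proof.
rewrite /vder (bigD1 i) //= big1 => [|j ji]; rewrite mderivX mnm1E.
  by rewrite eqxx addr0 scale1r -{1}[U_(i)%MM]add0m addmK mpolyX0 mulr1.
by rewrite eq_sym (negbTE ji) scale0r mulr0.
Qed.

Lemma vderZ c f : vder (c *: f) = c *: vder f.
Proof. by rewrite -!mul_mpolyC vderM vderC mul0r add0r. Qed.

Variable d : nat.
Hypothesis Xd : forall i, X i \is d.-homog.

Lemma dhomog_vder k f : (0 < k)%N -> (0 < d)%N -> f \is k.-homog ->
  vder f \is (k + d.-1).-homog.
Proof.
move=> k0 d0 fk; apply: rpred_sum => i _.
have -> : (k + d.-1 = d + k.-1)%N by lia.
by apply: dhomogM => //; exact: dhomog_mderiv.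
Qed.

Lemma dhomog_iter_vder k f j : (0 < k)%N -> (0 < d)%N -> f \is k.-homog ->
  iter j vder f \is (k + j * d.-1).-homog.
Proof.
move=> k0 d0 fk; elim: j => [|j IH]; first by rewrite mul0n addn0.
by rewrite iterS mulSnr addnA; apply: dhomog_vder => //; rewrite addn_gt0 k0.
Qed.

End Homog.

(** * Eliminating a variable *)

Section UfdGcd.
Variable R : idomainType.
Hypothesis ufdR : ufd R.

Definition rcoprime (a b : R) := forall h, rdiv h a -> rdiv h b -> h \is a GRing.unit.

Lemma ufd_prime_factor (h : R) : h != 0 -> h \isn't a GRing.unit ->
  exists2 p, rprime p & rdiv p h.
Proof.
move=> /ufdR[u [[|p s] [uu sP ->]]].
  by rewrite big_nil mulr1 uu.
move=> _; exists p; first by apply: sP; rewrite mem_head.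
by rewrite big_cons mulrCA; exists (u * \prod_(q <- s) q); rewrite mulrC.
Qed.

Lemma ufd_gcd (a b : R) : b != 0 ->
  exists e a' b', [/\ a = e * a', b = e * b' & rcoprime a' b'].
Proof.
move=> b0; have [u [s [uu sP eb]]] := ufdR b0.
elim: {s}(size s) {-2}s (leqnn (size s)) u uu sP a b b0 eb => [|n IH] s sn u uu sP a b b0 eb.
  exists 1, a, b; rewrite !mul1r; split => // h _ /rdiv_unit; apply.
  by rewrite eb (nilP (_ : nilp s)) ?big_nil ?mulr1 // /nilp -leqn0.
case: (boolp.EM (exists2 p, rprime p & rdiv p a /\ rdiv p b)) => [[p pp [[a1 ea] [b1 eb1]]]|nop].
  have [p0 pu pP] := pp.
  have ep : p * b1 = u * \prod_(q <- s) q by rewrite -eb eb1 mulrC.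
  have [u1 [s1 [u2 [s2 [uu1 uu2 sP12 [h1 h2] ss]]]]] := prod_split uu sP ep.
  have s1n : (0 < size s1)%N.
    by case: s1 h1 {sP12 ss} => // h1; move: pu; rewrite h1 big_nil mulr1 uu1.
  have b10 : b1 != 0 by apply: contraNneq b0 => b10; rewrite eb1 b10 mul0r.
  have [|q hq|e [a' [b' [e1 e2 cop]]]] := IH s2 _ u2 uu2 _ a1 b1 b10 h2.
  - by rewrite -ltnS; apply: leq_trans sn; rewrite -ss -[X in (X < _)%N]add0n ltn_add2r.
  - by apply: sP12; rewrite mem_cat hq orbT.
  - by exists (p * e), a', b'; rewrite ea eb1 e1 e2 -!(mulrC p) !mulrA; split.
exists 1, a, b; rewrite !mul1r; split => // h ha hb; apply: boolp.contrapT => /negP hu.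
have h0 : h != 0 by apply: contraNneq b0 => h0; case: hb => c ->; rewrite h0 mulr0.
have [p pp ph] := ufd_prime_factor h0 hu.
by apply: nop; exists p => //; split; [apply: rdiv_trans ha | apply: rdiv_trans hb].
Qed.

Lemma rcoprime_rdiv (a b c : R) : a != 0 -> rcoprime a b -> rdiv a (c * b) -> rdiv a c.
Proof.
move=> a0; have [u [s [uu sP ea]]] := ufdR a0.
elim: s u uu sP a c a0 ea => [|p s IH] u uu sP a c a0 ea cop.
  by move=> _; exists (c * u^-1); rewrite ea big_nil mulr1 divrK.
move=> [x e]; have pp : rprime p by apply: sP; rewrite mem_head.
have [p0 pu pP] := pp.
have pa : a = u * \prod_(q <- s) q * p by rewrite ea big_cons mulrCA mulrC.
have [|[c1 ec]|pb] := pP c b.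
- by rewrite e pa mulrA; exists (x * (u * \prod_(q <- s) q)).
- have [||||x' ex] := IH u uu _ (u * \prod_(q <- s) q) c1 _ erefl.
  + by move=> q qs; apply: sP; rewrite inE qs orbT.
  + by apply: contraNneq a0 => z; rewrite pa z mul0r.
  + by move=> h ha; apply: cop; rewrite pa; apply: rdiv_mulr.
  + exists x; apply: (mulIf p0).
    by rewrite -[RHS]mulrA -pa -e ec mulrAC.
  + by exists x'; rewrite ec ex pa !mulrA.
- by case/negP: pu; apply: cop => //; rewrite pa; apply: rdiv_mull; exact: rdiv_refl.
Qed.

End UfdGcd.

Lemma mcoeff_pihomog n (R : nzRingType) d (p : {mpoly R[n]}) m :
  (pihomog mdeg d p)@_m = if mdeg m == d then p@_m else 0.
Proof.
elim/mpolyind: p => [|c k p _ _ IH]; first by rewrite pihomog0 mcoeff0 if_same.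
rewrite pihomogD !mcoeffD IH linearZ /= pihomogX !mcoeffZ mcoeffX.
have [<-|km] := eqVneq k m; first by case: eqP => _; rewrite ?mcoeffX ?mcoeff0 ?eqxx // mulr0 addr0.
by case: (mdeg k == d); rewrite ?mcoeffX ?mcoeff0 ?(negbTE km) mulr0 !add0r.
Qed.

Section Eliminate.
Variables (n : nat) (R : idomainType).

Lemma pihomogM_homog e N (a g : {mpoly R[n]}) : g \is e.-homog ->
  pihomog mdeg N (a * g) = if (N < e)%N then 0 else pihomog mdeg (N - e) a * g.
Proof.
move=> ge; rewrite -coef_mgrade mgradeM.
have -> : mgrade g = g%:P * 'X^e.
  apply/polyP => i; rewrite coef_mgrade coefCM coefXn.
  have [->|ie] := eqVneq i e; first by rewrite mulr1 pihomog_dE.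
  by rewrite mulr0; move/dhomog_pihomog: ge; apply.
by rewrite mulrA coefMXn coefMC coef_mgrade.
Qed.

Lemma mderiv_mwiden (p : {mpoly R[n]}) : (mwiden p)^`M(ord_max) = 0.
Proof.
elim/mpolyind: p => [|c m p _ _ IH]; first by rewrite mwiden0 mderiv0.
by rewrite mwidenD mderivD IH mwidenZ mwidenX mderivZ mderivX mnmwiden_ordmax scale0r scaler0 addr0.
Qed.

(** A zero derivative in the last variable expresses that this variable has been eliminated; the
    combination is the Bezout relation over the polynomials in the other variables. *)
Lemma irr_eliminate (f g : {mpoly R[n.+1]}) : ufd R -> rirr f -> ~ rdiv f g ->
  exists a b, a * f + b * g != 0 /\ (a * f + b * g)^`M(ord_max) = 0.
Proof.
move=> ufdR irf ndv; have irF := rirr_muni irf; have [f0 _ _] := irf.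
have [sf|sf] := leqP (size (muni f)) 1.
  have [c ec] : exists c, f = mwiden c.
    by exists (muni f)`_0; rewrite -muniiC -(size1_polyC sf) muniK.
  exists 1, 0; rewrite mul1r mul0r addr0; split => //.
  by rewrite ec mderiv_mwiden.
have ndv' : ~ rdiv (muni f) (muni g) by move/rdiv_muni.
have [u [v [r [r0 e]]]] := irr_poly_bezout (ufd_mpoly ufdR) irF sf ndv'.
exists (munii u), (munii v).
have -> : munii u * f + munii v * g = mwiden r.
  exact: munii_bezout e.
by rewrite mderiv_mwiden -(mwiden0 n R) (inj_eq (@inj_mwiden n R)).
Qed.

End Eliminate.

(** * Polynomials in two points of the plane *)

(* {mpoly {mpoly F[n]}[n]} is the ring of polynomials in two points x (in the
   coefficients) and x' (the variables): [c%:MP] is c(x), [up f] is f(x'), [dg]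
   restricts to x' = x, [swap] exchanges the two points, and [der1], [der2] are
   the derivations along the vector field [X] in x and in x'. These definitions
   are locked because unification would otherwise evaluate them. *)
HB.lock Definition up n (F : idomainType) (f : {mpoly F[n]}) :
  {mpoly {mpoly F[n]}[n]} := map_mpoly (@mpolyC n F) f.
HB.lock Definition dg n (F : idomainType) (G : {mpoly {mpoly F[n]}[n]}) :
  {mpoly F[n]} := meval (fun i => 'X_i) G.
HB.lock Definition swap n (F : idomainType) (G : {mpoly {mpoly F[n]}[n]}) :
  {mpoly {mpoly F[n]}[n]} :=
  mmap (map_mpoly (@mpolyC n F)) (fun i => ('X_i)%:MP) G.
HB.lock Definition der1 n (F : idomainType) (X : 'I_n -> {mpoly F[n]})
  (G : {mpoly {mpoly F[n]}[n]}) : {mpoly {mpoly F[n]}[n]} :=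
  map_mpoly (vder X) G.
HB.lock Definition der2 n (F : idomainType) (X : 'I_n -> {mpoly F[n]})
  (G : {mpoly {mpoly F[n]}[n]}) : {mpoly {mpoly F[n]}[n]} :=
  vder (fun i => up (X i)) G.
Arguments der1 {n F} X G.
Arguments der2 {n F} X G.
Arguments up {n F} f.
Arguments dg {n F} G.
Arguments swap {n F} G.

Section TwoPoints.
Variables (n : nat) (F : idomainType).
Local Notation S := {mpoly F[n]}.
Local Notation U := {mpoly S[n]}.
Implicit Types (f g c : S) (G H : U).

Lemma mcoeff_up f m : (up f)@_m = (f@_m)%:MP.
Proof. by rewrite ?up.unlock ?dg.unlock ?swap.unlock mcoeff_map_mpoly. Qed.

Lemma dgM G H : dg (G * H) = dg G * dg H. Proof. rewrite ?up.unlock ?dg.unlock ?swap.unlock; exact: rmorphM. Qed.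
Lemma dgD G H : dg (G + H) = dg G + dg H. Proof. rewrite ?up.unlock ?dg.unlock ?swap.unlock; exact: rmorphD. Qed.
Lemma dgN G : dg (- G) = - dg G. Proof. rewrite ?up.unlock ?dg.unlock ?swap.unlock; exact: rmorphN. Qed.
Lemma dg0 : dg (0 : U) = 0 :> S. Proof. rewrite ?up.unlock ?dg.unlock ?swap.unlock; exact: rmorph0. Qed.
Lemma dg1 : dg (1 : U) = 1 :> S. Proof. rewrite ?up.unlock ?dg.unlock ?swap.unlock; exact: rmorph1. Qed.
Lemma dgX i : dg ('X_i : U) = 'X_i :> S. Proof. by rewrite ?up.unlock ?dg.unlock ?swap.unlock mevalXU. Qed.
Lemma dgC c : dg (c%:MP : U) = c. Proof. by rewrite ?up.unlock ?dg.unlock ?swap.unlock mevalC. Qed.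
Lemma dg_unit G : G \is a GRing.unit -> dg G \is a GRing.unit.
Proof. rewrite ?up.unlock ?dg.unlock ?swap.unlock; exact: rmorph_unit. Qed.

Lemma dg_up f : dg (up f) = f.
Proof.
rewrite ?up.unlock ?dg.unlock ?swap.unlock.
apply: (rmorph_mpoly_ext (f := meval (fun i => 'X_i) \o map_mpoly (@mpolyC n F))
  (g := idfun)) => [c|i] /=.
  by rewrite map_mpolyC mevalC.
by rewrite map_mpolyX mevalXU.
Qed.

Lemma swapM G H : swap (G * H) = swap G * swap H.
Proof. rewrite ?up.unlock ?dg.unlock ?swap.unlock; exact: rmorphM. Qed.

Lemma swap0 : swap (0 : U) = 0 :> U. Proof. rewrite ?up.unlock ?dg.unlock ?swap.unlock; exact: mmap0. Qed.
Lemma swapD G H : swap (G + H) = swap G + swap H. Proof. rewrite ?up.unlock ?dg.unlock ?swap.unlock; exact: mmapD. Qed.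
Lemma swapZX c m : swap (c *: 'X_[m] : U) = ('X_[m])%:MP * up c.
Proof.
rewrite ?up.unlock ?dg.unlock ?swap.unlock mmapZ mmapX mulrC; congr (_ * _).
rewrite /mmap1 [in RHS]mpolyXE_id rmorph_prod.
by apply: eq_bigr => i _; rewrite rmorphXn.
Qed.


Lemma mcoeff2D G H m m' : (G + H)@_m@_m' = G@_m@_m' + H@_m@_m'.
Proof. by rewrite (mcoeffD m G H) (mcoeffD m' G@_m). Qed.

Lemma mcoeff_swap G m m' : (swap G)@_m@_m' = G@_m'@_m.
Proof.
elim/mpolyind: G => [|c k p _ _ IH]; first by rewrite swap0 !mcoeff0.
rewrite swapD [LHS]mcoeff2D [RHS]mcoeff2D; congr (_ + _); last exact: IH.
rewrite swapZX (mcoeffCM 'X_[k]) mcoeff_up (mulrC 'X_[k]) (mcoeffCM (c@_m)) mcoeffX.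
rewrite (mcoeffZ c) mcoeffX mulr_natr mulr_natr.
by rewrite mcoeffMn.
Qed.

Lemma swapK : involutive (@swap n F).
Proof.
by move=> G; apply/mpolyP => m; apply/mpolyP => m'; rewrite !mcoeff_swap.
Qed.

Lemma swapC c : swap (c%:MP : U) = up c.
Proof.
apply/mpolyP => m; apply/mpolyP => m'.
rewrite mcoeff_swap.
rewrite mcoeff_up.
rewrite (mcoeffC c m').
rewrite (mcoeffC c@_m m').
by rewrite mulr_natr mulr_natr mcoeffMn.
Qed.

Lemma rdiv_swap G H : rdiv G H -> rdiv (swap G) (swap H).
Proof. by move=> [c ->]; exists (swap c); rewrite swapM. Qed.

(** Plain homogeneity refers to the variables x'. Homogeneity in x is expressed through [swap], so
    that the same lemmas on factors and degrees serve both points. *)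
Lemma swap_homog d G : swap G \is d.-homog <-> forall m, G@_m \is d.-homog.
Proof.
split=> [/dhomogP h m|h].
  apply/dhomogP => m' hm'; apply: h.
  rewrite mcoeff_msupp; apply: contraTneq hm' => e.
  by rewrite mcoeff_msupp -mcoeff_swap e mcoeff0 eqxx.
apply/dhomogP => m'; rewrite mcoeff_msupp => hm'.
have [m hm] : exists m, (swap G)@_m'@_m != 0.
  apply: boolp.contrapT => nex; case/eqP: hm'; apply/mpolyP => m; rewrite mcoeff0.
  by apply/eqP; apply: contraT => hm; case: nex; exists m.
move: hm; rewrite mcoeff_swap => hm.
by move/dhomogP: (h m); apply; rewrite mcoeff_msupp.
Qed.

Lemma up_homog d f : f \is d.-homog -> up f \is d.-homog.
Proof.
move=> /dhomogP h; apply/dhomogP => m; rewrite mcoeff_msupp mcoeff_up => hm.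
by apply: h; rewrite mcoeff_msupp; apply: contraNneq hm => ->; rewrite mpolyC0.
Qed.

End TwoPoints.

Section TwoPointDerivations.
Variables (n : nat) (F : idomainType) (X : 'I_n -> {mpoly F[n]}).
Local Notation S := {mpoly F[n]}.
Local Notation U := {mpoly S[n]}.
Implicit Types (f g c : S) (G H : U).
Local Notation der := (vder X).

Local Notation der1 := (der1 X).
Local Notation der2 := (der2 X).

Lemma der1_is_additive : zmod_morphism der1.
Proof. rewrite der1.unlock; exact: raddfB. Qed.
HB.instance Definition _ := GRing.isZmodMorphism.Build _ _ der1 der1_is_additive.
Lemma der2_is_additive : zmod_morphism der2.
Proof. rewrite der2.unlock; exact: raddfB. Qed.
HB.instance Definition _ := GRing.isZmodMorphism.Build _ _ der2 der2_is_additive.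

Lemma mcoeff_der1 G m : (der1 G)@_m = der G@_m.
Proof. rewrite der1.unlock; exact: mcoeff_map_mpoly. Qed.

Lemma der1D G H : der1 (G + H) = der1 G + der1 H. Proof. exact: raddfD. Qed.
Lemma der2D G H : der2 (G + H) = der2 G + der2 H. Proof. exact: raddfD. Qed.
Lemma der10 : der1 0 = 0. Proof. exact: raddf0. Qed.
Lemma der20 : der2 0 = 0. Proof. exact: raddf0. Qed.

Lemma der1M G H : der1 (G * H) = der1 G * H + G * der1 H.
Proof.
apply/mpolyP => m; rewrite mcoeff_der1 (mcoeffD m (der1 G * H)) (mcoeffM G H).
rewrite (mcoeffM (der1 G) H) (mcoeffM G (der1 H)) raddf_sum -big_split /=.
by apply: eq_bigr => k _; rewrite vderM !mcoeff_der1.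
Qed.

Lemma der2M G H : der2 (G * H) = der2 G * H + G * der2 H.
Proof. rewrite der2.unlock; exact: vderM. Qed.

Lemma der1C c : der1 c%:MP = (der c)%:MP.
Proof. rewrite der1.unlock; exact: map_mpolyC. Qed.

Lemma der2C c : der2 c%:MP = 0.
Proof. rewrite der2.unlock; exact: vderC. Qed.

Lemma der2CM c G : der2 (c%:MP * G) = c%:MP * der2 G.
Proof. by rewrite der2M der2C mul0r add0r. Qed.

Lemma der1_up f : der1 (up f) = 0.
Proof.
by apply/mpolyP => m; rewrite mcoeff_der1 mcoeff_up vderC mcoeff0.
Qed.

Lemma der1_comm G : der1 (der2 G) = der2 (der1 G).
Proof.
rewrite der2.unlock /vder raddf_sum; apply: eq_bigr => i _ /=.
rewrite der1M der1_up mul0r add0r; congr (_ * _).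
apply/mpolyP => m; rewrite mcoeff_der1 (mcoeff_deriv i m G) (mcoeff_deriv i m (der1 G)) mcoeff_der1.
by rewrite raddfMn.
Qed.

(** Chain rule on the diagonal. Both sides obey the Leibniz rule along [dg], so it is enough to
    check it on constants and variables. *)
Lemma der_dg G : der (dg G) = dg (der1 G) + dg (der2 G).
Proof.
pose E H := der (dg H) = dg (der1 H) + dg (der2 H).
have EM A B : E A -> E B -> E (A * B).
  rewrite /E => eA eB; rewrite dgM vderM eA eB der1M der2M !dgD !dgM.
  by rewrite !mulrDl !mulrDr addrACA.
have EC c : E c%:MP by rewrite /E dgC der1C der2C dg0 addr0 dgC.
have EX i : E 'X_i.
  rewrite /E dgX vderX der2.unlock vderX dg_up.
  suff -> : der1 'X_i = 0 by rewrite dg0 add0r.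
  apply/mpolyP => m; rewrite mcoeff_der1 mcoeffX mcoeff0 -mpolyC_nat.
  exact: vderC.
rewrite -/(E G); elim/mpolyind: G => [|c k p _ _ IH].
  by rewrite /E der10 der20 dg0 vder0 addr0.
have ED A B : E A -> E B -> E (A + B).
  by rewrite /E => eA eB; rewrite dgD vderD eA eB der1D der2D !dgD addrACA.
apply: (ED (c *: 'X_[k]) p) IH.
rewrite -mul_mpolyC; apply: (EM c%:MP) => //; rewrite mpolyXE_id.
elim/big_ind: _ => // [|i _]; first by rewrite -mpolyC1.
elim: (k i) => [|j IHj]; first by rewrite expr0 -mpolyC1.
by rewrite exprS; exact: (EM 'X_i).
Qed.

(* The functions on the trajectory of the generic point: [G] such that
   G(x, exp(tX) x) = 0 for a formal parameter t. *)
Definition trajectory_zero G := forall j, dg (iter j der2 G) = 0.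

Lemma trajectoryD G H : trajectory_zero G -> trajectory_zero H ->
  trajectory_zero (G + H).
Proof.
move=> hG hH j; suff -> : iter j der2 (G + H) = iter j der2 G + iter j der2 H.
  by rewrite dgD hG hH addr0.
by elim: j => [//|j IH] /=; rewrite IH raddfD.
Qed.

Lemma trajectory_der2 G : trajectory_zero G -> trajectory_zero (der2 G).
Proof. by move=> h j; rewrite -iterSr; exact: h. Qed.

Lemma trajectory_mul G H : trajectory_zero G -> trajectory_zero (H * G).
Proof.
move=> hG j; elim: j G H hG => [|j IH] G H hG; first by rewrite dgM (hG 0%N) mulr0.
rewrite iterSr der2M.
have -> : forall A B, iter j der2 (A + B) = iter j der2 A + iter j der2 B.
  by move=> A B; elim: j {IH} => [//|j IH] /=; rewrite IH raddfD.
by rewrite dgD !IH ?addr0 //; exact: trajectory_der2.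
Qed.

(** Leibniz: every term but one carries a derivative of [G] of order less than [j], which vanishes
    on the diagonal. *)
Lemma dg_iter_der2M j W G : (forall i, (i < j)%N -> dg (iter i der2 G) = 0) ->
  dg (iter j der2 (W * G)) = dg W * dg (iter j der2 G).
Proof.
elim: j W G => [|j IH] W G h; first by rewrite dgM.
rewrite iterSr der2M.
have -> : forall A B, iter j der2 (A + B) = iter j der2 A + iter j der2 B.
  by move=> A B; elim: j {IH h} => [//|j IH] /=; rewrite IH raddfD.
rewrite dgD IH => [|i ij]; last by apply: h; exact: ltnW.
rewrite h // mulr0 add0r IH => [|i ij]; first by rewrite -iterSr.
by rewrite -iterSr; apply: h.
Qed.

(** By strong induction on the order: once the lower derivatives of [G] vanish on the diagonal, the
    next derivative of W G restricts to [dg W] times that of [G]. *)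
Lemma trajectory_cancel W G : dg W != 0 -> trajectory_zero (W * G) ->
  trajectory_zero G.
Proof.
move=> W0 h j; elim/ltn_ind: j => j IH; apply: (mulfI W0).
by rewrite mulr0 -dg_iter_der2M.
Qed.

(** On the diagonal the derivation along [X] is the sum of [der1] and [der2]. Here [der1] multiplies
    every [der2]-iterate of [G] by the same [c], because the two derivations commute and [der2]
    kills [c]; so the vanishing of one iterate on the diagonal passes to the next. *)
Lemma trajectory_der1 c G : der1 G = c%:MP * G -> dg G = 0 -> trajectory_zero G.
Proof.
move=> e dG0 j; elim: j => [//|j IH].
have ej : der1 (iter j der2 G) = c%:MP * iter j der2 G.
  elim: j {IH} => [//|j IH] /=; by rewrite der1_comm IH der2CM.
have := der_dg (iter j der2 G).
by rewrite ej dgM IH mulr0 raddf0 add0r => <-.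
Qed.

Lemma trajectory_pihomog e N (A G : U) : G \is e.-homog -> trajectory_zero G ->
  trajectory_zero (pihomog mdeg N (A * G)).
Proof.
move=> Ge hG; rewrite (pihomogM_homog _ _ Ge); case: ifP => _.
  by rewrite -[0](mul0r G); exact: trajectory_mul.
exact: trajectory_mul.
Qed.

End TwoPointDerivations.

(** * Divisibility among forms vanishing on the trajectories *)

Lemma sum_ord3 (V : nmodType) (f : 'I_3 -> V) :
  \sum_i f i = f ord0 + f (lift ord0 ord0) + f ord_max.
Proof.
rewrite !big_ord_recl big_ord0 addr0 addrA.
by congr (_ + _ + f _); apply: val_inj.
Qed.

(** Cramer's rule for the linear forms x0 a + x1 b and u0 a + u1 b, to be used with [a] and [b] the
    partial derivatives of a binary form. *)
Lemma cramer_two (A : comNzRingType) (x0 x1 u0 u1 a b : A) :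
  (x0 * u1 - x1 * u0) * b = x0 * (u0 * a + u1 * b) + - u0 * (x0 * a + x1 * b) /\
  (x0 * u1 - x1 * u0) * a = - x1 * (u0 * a + u1 * b) + u1 * (x0 * a + x1 * b).
Proof. by split; ring. Qed.

Section Elimination.
Variables (F : idomainType) (X : 'I_3 -> {mpoly F[3]}).
Hypothesis ufdF : ufd F.
Hypothesis char0 : forall k, k.+1%:R != 0 :> F.
Local Notation S := {mpoly F[3]}.
Local Notation U := {mpoly S[3]}.
Implicit Types (G H r : U).
Local Notation der2 := (der2 X).
Local Notation tzero := (trajectory_zero X).
Local Notation i0 := (ord0 : 'I_3).
Local Notation i1 := (lift ord0 ord0 : 'I_3).

Lemma natU_neq0 k : (k.+1%:R)%:MP != 0 :> U.
Proof. by rewrite mpolyC_eq0 -mpolyC_nat mpolyC_eq0. Qed.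

Lemma euler_two N r : r \is N.-homog -> r^`M(ord_max) = 0 ->
  'X_i0 * r^`M(i0) + 'X_i1 * r^`M(i1) = (N%:R)%:MP * r.
Proof.
move=> /euler_homog e r2.
have -> : (N%:R)%:MP * r = r *+ N by rewrite mpolyC_nat mulr_natl.
by rewrite -e sum_ord3 r2 mulr0 addr0.
Qed.

Lemma der2_two r : r^`M(ord_max) = 0 ->
  der2 r = up (X i0) * r^`M(i0) + up (X i1) * r^`M(i1).
Proof.
by move=> r2; rewrite der2.unlock /vder sum_ord3 r2 mulr0 addr0.
Qed.

(** Euler's identity and the formula for [der2 r] are two linear equations in the partial
    derivatives of [r], with determinant [W]. If [W] is nonzero on the diagonal, the partial
    derivatives also vanish on the trajectories, hence are zero by induction on the degree, and
    Euler gives r = 0. So [W] vanishes on the diagonal: [X] is tangent to the lines through a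
    point. *)
Lemma trajectory_two_variables N r : r != 0 -> r \is N.-homog ->
  r^`M(ord_max) = 0 -> tzero r -> 'X_i0 * X i1 = 'X_i1 * X i0.
Proof.
move=> r0 rN r2 rt; apply/eqP; rewrite -subr_eq0; apply: contraT => w0.
pose W : U := 'X_i0 * up (X i1) - 'X_i1 * up (X i0).
have dgW : dg W != 0 by rewrite /W dgD dgN (dgM 'X_i0) (dgM 'X_i1) !dgX !dg_up.
case/negP: r0; apply/eqP.
elim: N r rN r2 rt => [|N IH] r rN r2 rt.
  (* In degree 0, [r] depends on x only and coincides with its restriction to the diagonal. *)
  have := rt 0%N; rewrite /= => e.
  have er : r = (r@_0%MM)%:MP.
    apply/mpolyP => m; rewrite mcoeffC.
    have [->|m0] := eqVneq m 0%MM; first by rewrite mulr1.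
    by rewrite mulr0 (dhomog_nemf_coeff rN) //= mdeg_eq0.
  by move: e; rewrite {1}er dgC => e; rewrite er e mpolyC0.
have eE := euler_two rN r2; have eD := der2_two r2.
have d2 i : (r^`M(i))^`M(ord_max) = 0 by rewrite mderiv_comm r2 mderiv0.
have dN i : r^`M(i) \is N.-homog by apply: (dhomog_mderiv i rN).
have [e1 e0] := cramer_two 'X_i0 'X_i1 (up (X i0)) (up (X i1)) r^`M(i0) r^`M(i1).
have t1 : tzero (W * r^`M(i1)).
  rewrite /W e1 -eD eE [X in _ + X]mulrA.
  by apply: trajectoryD; apply: trajectory_mul => //; exact: trajectory_der2.
have t0 : tzero (W * r^`M(i0)).
  rewrite /W e0 -eD eE [X in _ + X]mulrA.
  by apply: trajectoryD; apply: trajectory_mul => //; exact: trajectory_der2.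
have z0 := IH _ (dN i0) (d2 i0) (trajectory_cancel dgW t0).
have z1 := IH _ (dN i1) (d2 i1) (trajectory_cancel dgW t1).
move: eE; rewrite z0 z1 !mulr0 addr0 => /esym/eqP.
by rewrite mulf_eq0 => /orP[|/eqP//]; rewrite (negbTE (natU_neq0 N)).
Qed.

(** If [G] does not divide [H], eliminating the last coordinate of x' gives a nonzero combination of
    them. One of its homogeneous components is a nonzero binary form vanishing on the
    trajectories. *)
Lemma trajectory_rdiv e m G H : rirr G -> G \is e.-homog -> H \is m.-homog ->
  tzero G -> tzero H -> rdiv G H \/ 'X_i0 * X i1 = 'X_i1 * X i0.
Proof.
move=> irG Ge Hm tG tH; case: (boolp.EM (rdiv G H)) => [|ndv]; [by left|right].
have [a [b]] := irr_eliminate (ufd_mpoly ufdF) irG ndv.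
set r := a * G + b * H => -[r0 r2].
have [N rN] : exists N, pihomog mdeg N r != 0.
  apply: boolp.contrapT => nex; case/eqP: r0.
  rewrite (pihomog_partitionE (k := msize r) (leqnn _)) big1 // => i _.
  by apply/eqP; apply: contraT => hi; case: nex; exists i.
apply: (trajectory_two_variables rN (pihomogP _ _ _)).
  apply/mpolyP => k; rewrite mcoeff_deriv mcoeff_pihomog mcoeff0.
  have := congr1 (mcoeff k) r2; rewrite mcoeff_deriv mcoeff0.
  by case: ifP => // _ _; rewrite mul0rn.
rewrite /r pihomogD; apply: trajectoryD.
  exact: (trajectory_pihomog _ _ Ge tG).
exact: (trajectory_pihomog _ _ Hm tH).
Qed.

End Elimination.

(** * Factors and coefficients of a form invariant up to a multiplier *)

Lemma mpoly_multiplicity n (R : idomainType) (p g : {mpoly R[n]}) :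
  (1 < msize p)%N -> g != 0 -> exists r v, g = p ^+ r * v /\ ~ rdiv p v.
Proof.
move=> sp g0; have [k] := ubnP (msize g); elim: k g g0 => // k IH g g0 gk.
case: (boolp.EM (rdiv p g)) => [[w e]|ndv]; last first.
  by exists 0%N, g; rewrite expr0 mul1r.
have [w0 p0] : w != 0 /\ p != 0 by move: g0; rewrite e mulf_eq0 negb_or => /andP[].
have [|r [v [ew ndv]]] := IH w w0.
  have arith (x y : nat) : ((x + y).-1 < k.+1 -> 1 < y -> 0 < x -> x < k)%N by lia.
  apply: (arith _ (msize p)) => //; first by rewrite -msizeM // -e.
  by rewrite lt0n mmeasure_poly_eq0.
by exists r.+1, v; split => //; rewrite e ew exprSr mulrAC.
Qed.

(** With k = r + 1, and [d] and [v'] the derivatives of [g] and [v], the hypothesis is about the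
    derivative of g^(r+1) v; the power g^r is cancelled from it. *)
Lemma deriv_cancel (A : idomainType) (c b k g d v v' : A) r : g != 0 ->
  c * (k * g ^+ r * d * v + g * g ^+ r * v') = b * (g * g ^+ r * v) ->
  c * k * d * v = (b * v - c * v') * g.
Proof.
move=> g0 e; apply: (mulfI (expf_neq0 r g0)); apply/eqP; rewrite -subr_eq0.
apply/eqP; transitivity (c * (k * g ^+ r * d * v + g * g ^+ r * v') - b * (g * g ^+ r * v)).
  ring.
by rewrite e subrr.
Qed.

Section InvariantFactor.
Variables (n : nat) (F : idomainType) (X : 'I_n -> {mpoly F[n]}).
Hypothesis char0 : forall k, k.+1%:R != 0 :> F.
Local Notation S := {mpoly F[n]}.
Local Notation U := {mpoly S[n]}.
Implicit Types (G H : U).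
Local Notation der1 := (der1 X).

Lemma msize_der1 G : (msize (der1 G) <= msize G)%N.
Proof.
rewrite msizeE; apply/bigmax_leqP_seq => m + _; rewrite mcoeff_msupp mcoeff_der1 => h.
apply: msize_mdeg_lt; rewrite mcoeff_msupp; apply: contraNneq h => ->.
by rewrite vder0.
Qed.

Lemma der1_exp G r : der1 (G ^+ r.+1) = (r.+1%:R)%:MP * G ^+ r * der1 G.
Proof.
elim: r => [|r IH]; first by rewrite mpolyC1 mul1r expr0 mul1r expr1.
rewrite exprS (der1M X G) IH (exprS G r).
rewrite -[r.+2%:R]natr1 mpolyCD mpolyC1.
have aux (A : comNzRingType) (a c g K : A) :
  a * (g * c) + g * (K * c * a) = (K + 1) * (g * c) * a by ring.
exact: aux.
Qed.

Lemma rprime_nconst G c : (1 < msize G)%N -> c != 0 -> ~ rdiv G c%:MP.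
Proof.
move=> sG c0 [w e]; have C0 : c%:MP != 0 :> U by rewrite mpolyC_eq0.
have [w0 G0] : w != 0 /\ G != 0 by move: C0; rewrite e mulf_eq0 negb_or => /andP[].
have := msizeC n c; rewrite c0 e msizeM //.
have sw : (0 < msize w)%N by rewrite lt0n mmeasure_poly_eq0.
have arith (x y : nat) : (1 < y -> 0 < x -> (x + y).-1 = 1 -> False)%N by lia.
exact: arith.
Qed.

(** Write H = G^(r+1) V with [V] not divisible by [G]. Then [G] divides (r + 1) c V times [der1 G],
    hence divides [der1 G] in characteristic 0. As [der1] acts on coefficients, it does not raise
    the degree in x', so the quotient is a function of x. *)
Lemma der1_factor G H (b c : S) : rprime G -> (1 < msize G)%N -> H != 0 ->
  rdiv G H -> c != 0 -> c%:MP * der1 H = b%:MP * H ->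
  exists l, der1 G = l%:MP * G.
Proof.
move=> pG sG H0 GH c0 e; have [G0 _ GP] := pG.
have [[|r] [V [eH ndv]]] := mpoly_multiplicity sG H0.
  by case: ndv; rewrite -[V]mul1r -(expr0 G) -eH.
have dH : der1 H = (r.+1%:R)%:MP * G ^+ r * der1 G * V + G * G ^+ r * der1 V.
  by rewrite eH (der1M X (G ^+ r.+1) V) der1_exp exprS.
have e' : c%:MP * (r.+1%:R)%:MP * der1 G * V = (b%:MP * V - c%:MP * der1 V) * G.
  apply: (deriv_cancel (r := r) G0); transitivity (c%:MP * der1 H).
    by congr (_ * _); rewrite dH.
  by rewrite e; congr (_ * _); rewrite eH exprS.
have : rdiv G (c%:MP * (r.+1%:R)%:MP * der1 G * V) by eexists; exact: e'.
case/GP => // /GP[].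
  rewrite -mpolyCM => /(rprime_nconst sG) []; rewrite mulf_neq0 //.
  by rewrite -mpolyC_nat mpolyC_eq0.
move=> [L eL].
have [L0|L0] := eqVneq L 0; first by exists 0; rewrite eL L0 mpolyC0.
suff sL : (msize L <= 1)%N by exists L@_0%MM; rewrite -msize1_polyC.
have := msize_der1 G; rewrite eL msizeM //.
have arith (x y : nat) : (1 < y -> (x + y).-1 <= y -> x <= 1)%N by lia.
exact: arith.
Qed.

Lemma dgXm m : dg ('X_[m] : U) = 'X_[m].
Proof.
rewrite mpolyXE_id [in RHS]mpolyXE_id.
elim/big_rec2: _ => [|i x y _ <-]; first by rewrite dg1.
rewrite (dgM ('X_i ^+ m i)); congr (_ * _).
by elim: (m i) => [|j IHj]; rewrite ?expr0 ?dg1 // !exprS (dgM 'X_i) dgX IHj.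
Qed.

(** If all coefficients were constant multiples of one of them, [G] would be a function of x times a
    function of x', and such a nonzero product does not vanish on the diagonal. *)
Lemma coef_not_proportional G m0 : dg G = 0 -> G@_m0 != 0 ->
  exists m, forall a : F, G@_m <> a *: G@_m0.
Proof.
move=> dG0 g0; apply: boolp.contrapT => nex.
have ex m : exists a, G@_m = a *: G@_m0.
  apply: boolp.contrapT => h; apply: nex; exists m => a ea.
  by apply: h; exists a.
pose a m := projT1 (boolp.cid (ex m)).
have aP m : G@_m = a m *: G@_m0 := projT2 (boolp.cid (ex m)).
pose phi : S := \sum_(m <- msupp G) a m *: 'X_[m].
have phi0 : phi = 0.
  apply: (mulfI g0); rewrite mulr0 -[RHS]dG0 {2}[G]mpolyE mulr_sumr.
  elim: (msupp G) => [|m s IH]; first by rewrite !big_nil dg0.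
  rewrite !big_cons dgD IH; congr (_ + _).
  transitivity (G@_m * 'X_[m]).
    by rewrite [G@_m]aP -scalerAl -scalerAr.
  by rewrite -[G@_m *: _]mul_mpolyC (dgM (G@_m)%:MP) dgC dgXm.
have : a m0 = 0.
  have := congr1 (mcoeff m0) phi0; rewrite mcoeff0 raddf_sum.
  rewrite (bigD1_seq m0) ?msupp_uniq ?mcoeff_msupp //= big1 ?addr0.
    by rewrite mcoeffZ mcoeffX eqxx mulr1.
  by move=> m mm0; rewrite mcoeffZ mcoeffX (negbTE mm0) mulr0.
by move=> a0; case/eqP: g0; rewrite aP a0 scale0r.
Qed.

End InvariantFactor.

(** * A dependency among monomials along the trajectories gives a first integral *)

Lemma dhomog_rdivE n (R : idomainType) i j (c f g : {mpoly R[n]}) :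
  f != 0 -> f = c * g -> f \is i.-homog -> g \is j.-homog ->
  (j <= i)%N /\ c \is (i - j).-homog.
Proof.
move=> f0 e fa gb; rewrite e in f0 fa.
have [e' ce'] := homog_factor f0 fa.
have := dhomog_uniq f0 fa (dhomogM ce' gb) => /= ->.
by rewrite leq_addl addnK.
Qed.

Lemma homog0_const n (R : nzRingType) (f : {mpoly R[n]}) : f \is 0.-homog ->
  f = (f@_0%MM)%:MP.
Proof.
move=> f0; apply/mpolyP => m; rewrite mcoeffC.
have [->|m0] := eqVneq m 0%MM; first by rewrite mulr1.
by rewrite mulr0 (dhomog_nemf_coeff f0) //= mdeg_eq0.
Qed.

Lemma rdiv_minor (A : idomainType) (v p q a b c d : A) :
  rdiv v (b * p - a * q) -> rdiv v (d * p - c * q) ->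
  rdiv v ((c * b - a * d) * p) /\ rdiv v ((c * b - a * d) * q).
Proof.
move=> h1 h2.
have -> : (c * b - a * d) * p = c * (b * p - a * q) - a * (d * p - c * q) by ring.
have -> : (c * b - a * d) * q = d * (b * p - a * q) - b * (d * p - c * q) by ring.
by split; apply: rdivD; [|apply: rdivN| |apply: rdivN]; apply: rdiv_mull.
Qed.

Section Pencil.
Variables (n : nat) (F : idomainType).
Hypothesis unitF : forall x : F, x != 0 -> x \is a GRing.unit.
Local Notation S := {mpoly F[n]}.
Local Notation U := {mpoly S[n]}.
Implicit Types (P Q : S).

(** The form Q(x) P(x') - P(x) Q(x'), which vanishes when x and x' lie on one member of the
    pencil. *)
Definition pencil P Q : U := Q%:MP * up P - P%:MP * up Q.

Lemma dg_pencil P Q : dg (pencil P Q) = 0.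
Proof. by rewrite /pencil dgD dgN (dgM Q%:MP) (dgM P%:MP) !dgC !dg_up mulrC subrr. Qed.

Lemma pencil_homog m P Q : P \is m.-homog -> Q \is m.-homog ->
  pencil P Q \is m.-homog.
Proof.
move=> Pm Qm; apply: rpredB; rewrite mul_mpolyC; apply: dhomogZ; exact: up_homog.
Qed.

Lemma mcoeff_pencil P Q k : (pencil P Q)@_k = P@_k *: Q - Q@_k *: P.
Proof.
rewrite /pencil mcoeffB (mcoeffCM Q) (mcoeffCM P) !mcoeff_up.
by rewrite [Q * _]mulrC [P * _]mulrC !mul_mpolyC.
Qed.

Lemma swap_pencil P Q : swap (pencil P Q) = - pencil P Q.
Proof.
apply/mpolyP => k; apply/mpolyP => l.
rewrite mcoeff_swap mcoeff_pencil mcoeffN mcoeff_pencil mcoeffN.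
rewrite !mcoeffB !mcoeffZ opprB.
by rewrite (mulrC P@_l) (mulrC Q@_l).
Qed.

Lemma nonproportional_minor P Q : Q != 0 -> (forall c, P <> c *: Q) ->
  exists k l, P@_l * Q@_k - P@_k * Q@_l != 0.
Proof.
move=> Q0 np; have ql := Q0; rewrite -mleadc_eq0 in ql.
set l := mlead Q in ql.
apply: boolp.contrapT => nex; apply: (np (P@_l / Q@_l)); apply/mpolyP => k.
rewrite mcoeffZ; apply: (mulIf ql).
rewrite mulrAC divrK ?unitF //; apply/esym/eqP; rewrite -subr_eq0.
by apply: contraT => h; case: nex; exists k, l.
Qed.

(** Two suitable coefficients of the pencil form are constant combinations of P and Q with nonzero
    determinant, so P and Q are recovered from them. *)
Lemma pencil_content P Q v : Q != 0 -> (forall c, P <> c *: Q) ->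
  (forall k, rdiv v (pencil P Q)@_k) -> rdiv v P /\ rdiv v Q.
Proof.
move=> Q0 np vH; have [k [l d0]] := nonproportional_minor Q0 np.
set dt := _ - _ in d0.
have vk : rdiv v ((Q@_k)%:MP * P - (P@_k)%:MP * Q).
  by rewrite !mul_mpolyC -opprB -mcoeff_pencil; apply: rdivN.
have vl : rdiv v ((Q@_l)%:MP * P - (P@_l)%:MP * Q).
  by rewrite !mul_mpolyC -opprB -mcoeff_pencil; apply: rdivN.
have [vP vQ] := rdiv_minor vk vl.
have key A : rdiv v (((P@_l)%:MP * (Q@_k)%:MP - (P@_k)%:MP * (Q@_l)%:MP) * A) -> rdiv v A.
  rewrite -!mpolyCM -mpolyCB -/dt => -[w ew]; exists ((dt^-1)%:MP * w).
  by rewrite -mulrA -ew mulrA -mpolyCM mulVr ?unitF // mpolyC1 mul1r.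
by split; apply: key.
Qed.

End Pencil.

Section Luroth.
Variables (F : idomainType) (X : 'I_3 -> {mpoly F[3]}).
Hypothesis unitF : forall x : F, x != 0 -> x \is a GRing.unit.
Hypothesis char0 : forall k, k.+1%:R != 0 :> F.
Local Notation S := {mpoly F[3]}.
Local Notation U := {mpoly S[3]}.
Implicit Types (G H : U).

(** The last condition is X (P / Q) = 0, cleared of denominators. *)
Definition pencil_integral m (P Q : S) :=
  [/\ P \is m.-homog, Q \is m.-homog, rcoprime P Q,
      (Q != 0 /\ forall c, P <> c *: Q) & vder X P * Q = P * vder X Q].

(** Being prime to [Q], [P] divides [vder X P]; the same quotient then serves for [Q]. *)
Lemma pencil_integral_cofactor m P Q : pencil_integral m P Q ->
  exists L, vder X P = L * P /\ vder X Q = L * Q.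
Proof.
move=> [_ _ cop [Q0 np] e].
have P0 : P != 0 by apply/eqP => P0; apply: (np 0); rewrite scale0r.
have [L eL] : rdiv P (vder X P).
  apply: (rcoprime_rdiv (ufd_mpoly (unit_ufd unitF)) P0 cop).
  by exists (vder X Q); rewrite e mulrC.
exists L; split => //; apply: (mulfI P0).
by rewrite -e eL mulrA (mulrC L).
Qed.

Lemma der1_pencil P Q L : vder X P = L * P -> vder X Q = L * Q ->
  der1 X (pencil P Q) = L%:MP * pencil P Q.
Proof.
move=> eP eQ; apply/mpolyP => k.
rewrite mcoeff_der1 mcoeffCM !mcoeff_pencil.
rewrite -scaleNr vderD !vderZ eP eQ mulrDr scaleNr.
by rewrite scaleNr mulrN !scalerAr.
Qed.

(** The exceptional case of [trajectory_rdiv]: the ratio of the first two coordinates is a first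
    integral. *)
Lemma coordinate_integral : 'X_ord0 * X (lift ord0 ord0) = 'X_(lift ord0 ord0) * X ord0 ->
  pencil_integral 1 'X_ord0 'X_(lift ord0 ord0).
Proof.
move=> e; have X1 i : ('X_i : S) \is 1.-homog by rewrite dhomogX /= mdeg1.
have Xn0 i : ('X_i : S) != 0 by rewrite -msize_poly_eq0 msizeX mdeg1.
have U01 : (U_(ord0) != U_(lift ord0 ord0) :> 'X_{1..3})%MM by rewrite eq_mnm1.
split => //.
- move=> h h0 h1.
  have [a ha] := rdiv_homog (Xn0 _) h0 (X1 _).
  have [b hb] := rdiv_homog (Xn0 _) h1 (X1 _).
  case: h0 => u eu; case: h1 => v ev.
  have hn0 : h != 0 by apply: contraNneq (Xn0 ord0) => z; rewrite eu z mulr0.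
  have [a1 ua] := dhomog_rdivE (Xn0 _) eu (X1 _) ha.
  have [b1 vb] := dhomog_rdivE (Xn0 _) ev (X1 _) ha.
  case: a ha a1 ua vb {b1} => [|[|//]] ha _ ua vb.
    rewrite (homog0_const ha); apply/mpolyC_unit/unitF.
    by apply: contraNneq hn0 => z; rewrite (homog0_const ha) z mpolyC0.
  exfalso; rewrite subnn in ua vb.
  have eu' : 'X_ord0 = u@_0%MM *: h by rewrite -mul_mpolyC -homog0_const.
  have ev' : 'X_(lift ord0 ord0) = v@_0%MM *: h by rewrite -mul_mpolyC -homog0_const.
  have u0 : u@_0%MM != 0.
    by apply: contraNneq (Xn0 ord0) => z; rewrite eu' z scale0r.
  have : 'X_(lift ord0 ord0) = (v@_0%MM / u@_0%MM) *: 'X_ord0 :> S.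
    by rewrite eu' scalerA divrK ?unitF.
  move/(congr1 (mcoeff U_(lift ord0 ord0)%MM)).
  rewrite mcoeffZ !mcoeffX eqxx (negbTE U01) mulr0 => /eqP.
  by rewrite oner_eq0.
- split => // c /(congr1 (mcoeff U_(ord0)%MM)).
  rewrite mcoeffZ !mcoeffX eqxx eq_sym (negbTE U01) mulr0 => /eqP.
  by rewrite oner_eq0.
- by rewrite !vderX mulrC.
Qed.

(* If the coefficients of [G] are constant along [X] up to a common factor and
   [G] vanishes on the diagonal, some pencil of degree at most the x'-degree of
   [G] is invariant. *)
Theorem luroth_pencil k N G (b c : S) : (0 < k)%N -> G != 0 -> G \is k.-homog ->
  (forall m, G@_m \is N.-homog) -> dg G = 0 ->
  c != 0 -> c%:MP * der1 X G = b%:MP * G ->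
  exists m P Q, (m <= k)%N /\ pencil_integral m P Q.
Proof.
move=> k0 G0 Gk GN dG c0 eG.
have ufdF := unit_ufd unitF; have ufdS : ufd S := ufd_mpoly ufdF.
have ufdU : ufd U := ufd_mpoly ufdS.
have [p [pp pG dp]] : exists p, [/\ rprime p, rdiv p G & dg p = 0].
  have [u [s [uu sP e]]] := ufdU G G0.
  have : dg G == 0 by rewrite dG.
  rewrite e dgM mulf_eq0 => /orP[/eqP z|].
    by have := dg_unit uu; rewrite z unitr0.
  have -> : dg (\prod_(p <- s) p) = \prod_(p <- s) dg p.
    by elim: (s) => [|q t IH]; rewrite ?big_nil ?dg1 // !big_cons dgM IH.
  rewrite prodf_seq_eq0 => /hasP[p ps /= /eqP dp]; exists p; split => //.
    exact: sP.
  apply: rdiv_mull; rewrite (big_rem p ps) /=; apply: rdiv_mulr; exact: rdiv_refl.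
have irp := rprime_irr pp; have [p0 pu _] := pp.
have [w eGw] := pG.
have [e pe] := rdiv_homog G0 pG Gk.
have [ek _] := dhomog_rdivE G0 eGw Gk pe.
(* A factor depending on x alone would equal its restriction to the diagonal, hence be zero. *)
have sp : (1 < msize p)%N.
  rewrite ltnNge; apply: contraNN p0 => /msize1_polyC ep.
  by rewrite ep -[p@_0%MM]dgC -ep dp mpolyC0.
have [l el] := der1_factor char0 pp sp G0 pG c0 eG.
have sG0 : swap G != 0 by apply: contraNneq G0 => z; rewrite -[G]swapK z swap0.
have sp0 : swap p != 0 by apply: contraNneq p0 => z; rewrite -[p]swapK z swap0.
have sGN : swap G \is N.-homog by apply/swap_homog.
have [N' pN'] := rdiv_homog sG0 (rdiv_swap pG) sGN.
have pcN' := (swap_homog _ _).1 pN'.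
have tp : trajectory_zero X p := trajectory_der1 el dp.
have [m0 pm0] : exists m0, p@_m0 != 0.
  by exists (mlead p); rewrite mleadc_eq0.
have [m1 pm1] := coef_not_proportional dp pm0.
(* P / Q is a nonconstant ratio of two coefficients of [p] in lowest terms. Both get the degree m =
   N' - a, where [N'] is the degree of [p] in x and [a] that of the gcd. *)
have [g [P [Q [eP eQ cop]]]] := ufd_gcd ufdS p@_m1 pm0.
have p10 : p@_m1 != 0 by apply/eqP => z; apply: (pm1 0); rewrite z scale0r.
have [P0 gP0] : P != 0 /\ g != 0 by move: p10; rewrite eP mulf_eq0 negb_or => /andP[].
have Q0 : Q != 0 by move: pm0; rewrite eQ mulf_eq0 negb_or => /andP[].
have gP : rdiv g p@_m1 by exists P; rewrite eP mulrC.
have [a ga] := rdiv_homog p10 gP (pcN' m1).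
have [aN' Pm] := dhomog_rdivE p10 (etrans eP (mulrC _ _)) (pcN' m1) ga.
have [_ Qm] := dhomog_rdivE pm0 (etrans eQ (mulrC _ _)) (pcN' m0) ga.
set m := (N' - a)%N in Pm Qm.
have np h : P <> h *: Q by move=> z; apply: (pm1 h); rewrite eP eQ z scalerAr.
have dpc q : vder X p@_q = l * p@_q by rewrite -mcoeff_der1 el mcoeffCM.
have ePQ : vder X P * Q = P * vder X Q.
  have g20 : g * g != 0 by rewrite mulf_neq0.
  apply: (mulfI g20); apply/eqP; rewrite -subr_eq0; apply/eqP.
  have d1 := dpc m1; have d0 := dpc m0; rewrite eP eQ !vderM in d1 d0.
  move: (vder X P) (vder X Q) (vder X g) d1 d0 => P' Q' g' d1 d0.
  transitivity ((g' * P + g * P') * (g * Q) - (g * P) * (g' * Q + g * Q')); first by ring.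
  by rewrite d1 d0; ring.
have intPQ : pencil_integral m P Q by split.
have [L [LP LQ]] := pencil_integral_cofactor intPQ.
have Hm := pencil_homog Pm Qm.
have tH := trajectory_der1 (der1_pencil LP LQ) (dg_pencil P Q).
have [[w' eH]|triv] := trajectory_rdiv ufdF char0 irp pe Hm tp tH; last first.
  by exists 1%N, 'X_ord0, 'X_(lift ord0 ord0); split => //; exact: coordinate_integral.
exists m, P, Q; split => //; apply: leq_trans ek.
have H0 : pencil P Q != 0.
  have [q [q' d0]] := nonproportional_minor unitF Q0 np.
  apply: contraNneq d0 => z; have := mcoeff_pencil P Q q.
  rewrite z mcoeff0 => /(congr1 (mcoeff q')).
  rewrite mcoeffB !mcoeffZ mcoeff0 => ez.
  by rewrite -opprB [P@_q' * _]mulrC -ez oppr0.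
have sH0 : swap (pencil P Q) != 0.
  by apply: contraNneq H0 => z; rewrite -[pencil P Q]swapK z swap0.
have sHm : swap (pencil P Q) \is m.-homog.
  apply/swap_homog => q; rewrite mcoeff_pencil.
  by apply: rpredB; apply: dhomogZ.
have seH : swap (pencil P Q) = swap w' * swap p by rewrite eH swapM.
(* Degrees in x: [p] divides the pencil form, so N' is at most m = N' - a, and the cofactor has
   degree 0 in x. *)
have [N'm sw'] := dhomog_rdivE sH0 seH sHm pN'.
have ea : (m - N' = 0)%N by rewrite /m subnAC subnn.
rewrite ea in sw'; set v := (swap w')@_0%MM.
have ev : swap w' = v%:MP by exact: homog0_const.
have ew' : w' = up v by rewrite -[w']swapK ev swapC.
(* The cofactor is v(x'). As the pencil form is antisymmetric, [v] divides its coefficients in x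
   too, hence both P and Q. *)
have vu : v \is a GRing.unit.
  have [|vP vQ] := pencil_content (v := v) unitF Q0 np; last exact: cop.
  move=> q; rewrite -[pencil P Q]opprK -swap_pencil seH ev mcoeffN mcoeffCM.
  by apply/rdivN/rdiv_mulr/rdiv_refl.
have [em we] := dhomog_rdivE H0 eH Hm pe.
have v0 : v \is 0.-homog.
  have v1 : 1 = v^-1 * v by rewrite mulVr.
  have one0 : (1 : S) \is 0.-homog by exact: dhomog1.
  have [j vj] := rdiv_homog (oner_neq0 S) (ex_intro _ _ v1) one0.
  have [j0 _] := dhomog_rdivE (oner_neq0 S) v1 one0 vj.
  by move: j0 vj; rewrite leqn0 => /eqP->.
have w0 : w' != 0 by apply: contraNneq H0 => z; rewrite eH z mul0r.
(* The cofactor has degree 0 in x' as well, so m is at most the degree [e] of [p] in x'. *)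
have := dhomog_uniq w0 we (_ : w' \is 0.-homog) => /=.
rewrite ew' => /(_ (up_homog v0)) /eqP.
by rewrite subn_eq0.
Qed.

End Luroth.

(** * The extactic curve *)

Lemma rprime_prod_rdiv (R : idomainType) (s : seq R) (a : R) : uniq s ->
  (forall p, p \in s -> rprime p /\ rdiv p a) ->
  (forall p q, p \in s -> q \in s -> p != q -> ~ rdiv p q) ->
  rdiv (\prod_(p <- s) p) a.
Proof.
elim: s a => [|p s IH] a /=; first by move=> _ _ _; exists a; rewrite big_nil mulr1.
move=> /andP[ps us] h dis; rewrite big_cons.
have [_ [b eb]] := h p (mem_head _ _).
suff [c ec] : rdiv (\prod_(q <- s) q) b by exists c; rewrite eb ec -mulrA (mulrC p).
apply: IH => // [q qs|q r qs rs]; last by apply: dis; rewrite inE ?qs ?rs orbT.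
have qs' : q \in p :: s by rewrite inE qs orbT.
have [pq qa] := h q qs'; split => //.
have [_ _ qP] := pq; rewrite eb in qa; have [//|qp] := qP _ _ qa.
case: (dis q p qs' (mem_head _ _) _ qp).
by apply: contraNneq ps => <-.
Qed.

Section Count.
Variables (F : idomainType) (X : 'I_3 -> {mpoly F[3]}) (d k : nat).
Hypothesis unitF : forall x : F, x != 0 -> x \is a GRing.unit.
Hypothesis char0 : forall j, j.+1%:R != 0 :> F.
Hypothesis Xd : forall i, X i \is d.-homog.
Hypotheses (d_gt0 : (0 < d)%N) (k_gt0 : (0 < k)%N).
Local Notation S := {mpoly F[3]}.
Local Notation U := {mpoly S[3]}.

Definition kmonomials : seq 'X_{1..3} :=
  [seq s2m t | t : k.-tuple 'I_3 <- enum (basis 3 k)].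
Definition kmonomial i : S := 'X_[nth 0%MM kmonomials i].
Local Notation n := (size kmonomials).

Lemma size_kmonomials : n = 'C(k + 2, k).
Proof. exact: size_basis. Qed.

Lemma nth_kmonomials i : (i < n)%N -> mdeg (nth 0%MM kmonomials i) = k.
Proof. by move=> h; apply/eqP; rewrite basis_cover mem_nth. Qed.

Lemma uniq_kmonomials : uniq kmonomials. Proof. exact: uniq_basis. Qed.

Definition extactic : S := \det (wronskian_mx (vder X) kmonomial n).

Definition extactic_degree := (\sum_(j < n) (k + j * d.-1))%N.

Lemma wronskian_homog m (i j : 'I_m) : (m <= n)%N ->
  wronskian_mx (vder X) kmonomial m i j \is (k + j * d.-1).-homog.
Proof.
move=> mn; rewrite mxE; apply: dhomog_iter_vder => //.
by rewrite dhomogX /= nth_kmonomials // (leq_trans (ltn_ord i)).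
Qed.

Lemma extactic_homog : extactic \is extactic_degree.-homog.
Proof. by apply: dhomog_det => i j; exact: wronskian_homog. Qed.

Lemma extactic_eq0 : extactic = 0 ->
  exists m P Q, (m <= k)%N /\ pencil_integral X m P Q.
Proof.
move=> /(wronskian_relation (vderM X))[m mn]; set a := fun i : 'I_m.+1 => _.
move=> /= [amax arel aX].
(* Degrees in the Wronskian matrix depend on the column only, and all these cofactors omit the last
   column; so they share one degree. *)
pose N := (\sum_(j < m) (k + lift ord_max j * d.-1))%N.
have aN i : a i \is N.-homog.
  rewrite /a /cofactor -signr_odd mulr_sign.
  have h : \det (row' i (col' ord_max (wronskian_mx (vder X) kmonomial m.+1))) \is N.-homog.
    apply: dhomog_det => i' j'; rewrite [row' _ _ _ _]mxE [col' _ _ _ _]mxE.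
    exact: wronskian_homog.
  by case: ifP; rewrite ?rpredN.
have mnI (i : 'I_m.+1) : (i < n)%N by exact: leq_trans (ltn_ord i) mn.
pose mon (i : 'I_m.+1) := nth 0%MM kmonomials i.
have mon_inj (i j : 'I_m.+1) : (mon i == mon j) = (i == j).
  by rewrite /mon nth_uniq // uniq_kmonomials.
pose G : U := \sum_(i < m.+1) a i *: 'X_[mon i].
have Gq q : G@_q = \sum_(i < m.+1) a i *+ (mon i == q).
  rewrite /G raddf_sum; apply: eq_bigr => i _.
  by rewrite /= mcoeffZ mcoeffX mulr_natr.
have Gi i : G@_(mon i) = a i.
  rewrite Gq (bigD1 i) //= eqxx mulr1n big1 ?addr0 // => j ji.
  by rewrite mon_inj (negbTE ji) mulr0n.
apply: (@luroth_pencil F X unitF char0 k N G (vder X (a ord_max)) (a ord_max)) => //.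
- by apply: contraNneq amax => z; rewrite -Gi z mcoeff0.
- apply: rpred_sum => i _; apply: dhomogZ; rewrite dhomogX /=.
  exact/eqP/nth_kmonomials/mnI.
- by move=> q; rewrite Gq; apply: rpred_sum => i _; apply/rpredMn/aN.
- rewrite -[RHS]arel /G.
  elim/big_rec2: _ => [|i x y _ <-]; first by rewrite dg0.
  rewrite dgD; congr (_ + _).
  by rewrite -mul_mpolyC (dgM (a i)%:MP) dgC dgXm.
- apply/mpolyP => q; rewrite (mcoeffCM (a ord_max)) (mcoeffCM (vder X _)) mcoeff_der1 Gq.
  rewrite raddf_sum !mulr_sumr; apply: eq_bigr => i _.
  by rewrite raddfMn !mulrnAr; congr (_ *+ _); rewrite aX mulrC.
Qed.

Hypothesis no_pencil : forall m P Q, (m <= k)%N -> ~ pencil_integral X m P Q.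

Lemma extactic_neq0 : extactic != 0.
Proof.
by apply/eqP => /extactic_eq0[m [P [Q [mk]]]]; exact: no_pencil.
Qed.

(** [f] is a combination of the monomials with constant coefficients, one of which is nonzero, hence
    a unit that can be removed from the conclusion of [rdiv_wronskian]. *)
Lemma rdiv_extactic f : f != 0 -> f \is k.-homog -> rdiv f (vder X f) ->
  rdiv f extactic.
Proof.
move=> f0 fk fX.
pose c (i : 'I_n) : S := (f@_(nth 0%MM kmonomials i))%:MP.
have cX i : vder X (c i) = 0 by exact: vderC.
have ef : f = \sum_i c i * kmonomial i.
  apply/mpolyP => q; rewrite raddf_sum /=.
  have [qk|qk] := boolP (q \in kmonomials); last first.
    rewrite (dhomog_nemf_coeff fk) /=; last by rewrite basis_cover.
    rewrite big1 // => i _; rewrite mcoeffCM mcoeffX.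
    by case: eqP qk => [<-|_ _]; rewrite ?mulr0 // mem_nth.
  have hq : (index q kmonomials < n)%N by rewrite index_mem.
  rewrite (bigD1 (Ordinal hq)) //= big1 => [|i iq].
    by rewrite addr0 mcoeffCM mcoeffX /= nth_index // eqxx mulr1.
  rewrite mcoeffCM mcoeffX -[X in _ == X](nth_index 0%MM qk).
  rewrite nth_uniq ?uniq_kmonomials //.
  by rewrite (_ : (i == index q kmonomials :> nat) = false) ?mulr0 //; apply/negbTE.
have [i ci] : exists i, c i != 0.
  apply: boolp.contrapT => nex; case/eqP: f0; rewrite ef big1 // => i _.
  by have [->|h] := eqVneq (c i) 0; [rewrite mul0r|case: nex; exists i].
have [w ew] := rdiv_wronskian (vderM X) i cX ef fX.
have cu : c i \is a GRing.unit.
  by apply/mpolyC_unit/unitF; rewrite /c mpolyC_eq0 in ci.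
by exists ((c i)^-1 * w); rewrite -mulrA -ew mulKr.
Qed.

Theorem invariant_count (s : seq S) : uniq s ->
  (forall f, f \in s -> [/\ rirr f, f \is k.-homog & rdiv f (vder X f)]) ->
  (forall f g, f \in s -> g \in s -> f != g -> ~ rdiv f g) ->
  (size s * k <= extactic_degree)%N.
Proof.
move=> us sP dis.
have [c ec] : rdiv (\prod_(p <- s) p) extactic.
  apply: rprime_prod_rdiv => // f /sP[fi fk fX].
  have [f0 _ _] := fi; split; last exact: rdiv_extactic.
  exact: rirr_prime (ufd_mpoly (unit_ufd unitF) f0) fi.
have hs : \prod_(p <- s) p \is (size s * k).-homog.
  elim: s sP {us dis ec} => [|f s IH] sP; first by rewrite big_nil mul0n dhomog1.
  rewrite big_cons mulSn; apply: dhomogM; first by case: (sP f (mem_head _ _)).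
  by apply: IH => g gs; apply: sP; rewrite inE gs orbT.
by have [] := dhomog_rdivE extactic_neq0 ec extactic_homog hs.
Qed.

End Count.

(** * Polynomials in each variable separately *)

Section Interpolation.
Variables (K : fieldType) (D : nat).
Hypothesis char0 : forall j, j.+1%:R != 0 :> K.

(** The nodes are nonzero as well as distinct, because the functions to be interpolated are known
    only at nonzero arguments. *)
Definition node (j : nat) : K := j.+1%:R.

Lemma node_inj : injective node.
Proof.
have key i j : (i < j)%N -> node i <> node j.
  move=> ij /eqP; rewrite /node eq_sym -subr_eq0 -natrB ?ltnS 1?ltnW //.
  by rewrite subSS -(subnSK ij) (negbTE (char0 _)).
by move=> i j e; case: (ltngtP i j) => // h; [case: (key _ _ h)|case: (key _ _ h)].
Qed.

Definition lagr (j : nat) : {poly K} :=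
  \prod_(i < D.+1 | (i : nat) != j) ((node j - node i)^-1 *: ('X - (node i)%:P)).

Lemma lagr_node (i j : 'I_D.+1) : (lagr j).[node i] = (i == j)%:R.
Proof.
rewrite /lagr horner_prod; have [->|ij] := eqVneq i j.
  rewrite big1 // => l lj; rewrite hornerZ hornerXsubC mulVf // subr_eq0.
  by apply: contraNneq lj => /node_inj->.
by rewrite (bigD1 i) //= hornerZ hornerXsubC subrr mulr0 mul0r.
Qed.

Lemma size_lagr (j : 'I_D.+1) : (size (lagr j) <= D.+1)%N.
Proof.
apply: leq_trans (size_prod_leq _ _) _ => /=.
rewrite (eq_bigr (fun=> 2%N)) => [|i ij]; last first.
  rewrite size_scale ?size_XsubC // invr_eq0 subr_eq0.
  by apply: contraNneq ij => /node_inj->.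
rewrite sum_nat_const; have -> : #|[pred i : 'I_D.+1 | (i : nat) != j]| = D.
  by rewrite -[RHS](_ : #|predC1 j| = D) ?cardC1 ?card_ord //; apply: eq_card => i.
by rewrite muln2 -addnn -addSn addnK.
Qed.

Lemma lagrange_interpolation (q : {poly K}) t : (size q <= D.+1)%N ->
  q.[t] = \sum_(j < D.+1) q.[node j] * (lagr j).[t].
Proof.
move=> sq; pose p := q - \sum_(j < D.+1) q.[node j] *: lagr j.
have sp : (size p <= D.+1)%N.
  apply: leq_trans (size_polyD _ _) _; rewrite geq_max sq size_polyN.
  apply: leq_trans (size_sum _ _ _) _; apply/bigmax_leqP => j _.
  by apply: leq_trans (size_scale_leq _ _) _; exact: size_lagr.
have p0 : p = 0.
  apply/eqP; apply: contraTT sp => p0; rewrite -ltnNge.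
  have := max_poly_roots (rs := map (fun j : 'I_D.+1 => node j) (enum 'I_D.+1)) p0.
  rewrite size_map size_enum_ord; apply.
    apply/allP => _ /mapP[i _ ->]; rewrite /root /p hornerD hornerN horner_sum.
    rewrite (bigD1 i) //= big1 => [|j ji]; rewrite hornerZ lagr_node.
      by rewrite eqxx mulr1 addr0 subrr.
    by rewrite eq_sym (negbTE ji) mulr0.
  by rewrite map_inj_uniq ?enum_uniq // => i j /node_inj/val_inj.
have /eqP := congr1 (horner^~ t) p0.
rewrite hornerD hornerN horner0 subr_eq0 horner_sum => /eqP->.
by apply: eq_bigr => j _; rewrite hornerZ.
Qed.

Definition varpoly (i : 'I_3) (p : {poly K}) : {mpoly K[3]} :=
  \sum_(j < size p) p`_j *: 'X_i ^+ j.

Lemma varpoly_eval i p v : (varpoly i p).@[v] = p.[v i].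
Proof.
rewrite /varpoly raddf_sum horner_coef; apply: eq_bigr => j _ /=.
by rewrite mevalZ rmorphXn /= mevalXU.
Qed.

Local Notation i0 := (ord0 : 'I_3).
Local Notation i1 := (lift ord0 ord0 : 'I_3).
Local Notation i2 := (ord_max : 'I_3).

Lemma varpoly3_eval p q r v :
  (varpoly i0 p * varpoly i1 q * varpoly i2 r).@[v] = p.[v i0] * q.[v i1] * r.[v i2].
Proof.
rewrite -(varpoly_eval i0 p) -(varpoly_eval i1 q) -(varpoly_eval i2 r).
by move: (varpoly i0 p) (varpoly i1 q) (varpoly i2 r) => P Q W; rewrite !mevalM.
Qed.

(** Interpolate in one variable after the other. The bound [D] is common to all lines, so the values
    on one finite grid determine the polynomial. *)
Lemma separately_polynomial (phi : K -> K -> K -> K) :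
  (forall y z, y != 0 -> z != 0 -> exists2 p : {poly K}, (size p <= D.+1)%N &
     forall x, x != 0 -> phi x y z = p.[x]) ->
  (forall x z, x != 0 -> z != 0 -> exists2 p : {poly K}, (size p <= D.+1)%N &
     forall y, y != 0 -> phi x y z = p.[y]) ->
  (forall x y, x != 0 -> y != 0 -> exists2 p : {poly K}, (size p <= D.+1)%N &
     forall z, z != 0 -> phi x y z = p.[z]) ->
  exists W : {mpoly K[3]}, forall v : 'I_3 -> K, (forall i, v i != 0) ->
    phi (v i0) (v i1) (v i2) = W.@[v].
Proof.
move=> h0 h1 h2.
exists (\sum_(a < D.+1) \sum_(b < D.+1) \sum_(c < D.+1)
  phi (node a) (node b) (node c) *:
  (varpoly i0 (lagr a) * varpoly i1 (lagr b) * varpoly i2 (lagr c))) => v v0.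
have [p sp ep] := h0 _ _ (v0 i1) (v0 i2).
rewrite ep // (lagrange_interpolation _ sp) raddf_sum; apply: eq_bigr => a _ /=.
rewrite -ep; last exact: char0.
have [q sq eq] := h1 _ _ (char0 a) (v0 i2).
rewrite [phi _ _ _]eq // (lagrange_interpolation _ sq) mulr_suml raddf_sum.
apply: eq_bigr => b _ /=; rewrite -eq; last exact: char0.
have [r sr er] := h2 _ _ (char0 a) (char0 b).
rewrite [phi _ _ _]er // (lagrange_interpolation _ sr) mulr_suml mulr_suml raddf_sum.
apply: eq_bigr => c _ /=; rewrite -er; last exact: char0.
by rewrite mevalZ varpoly3_eval /node; ring.
Qed.

Lemma poly_zero_nonzero (p : {poly K}) : (forall t, t != 0 -> p.[t] = 0) -> p = 0.
Proof.
move=> h; apply/eqP; apply: contraT => p0.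
have := max_poly_roots (rs := map (fun j : 'I_(size p) => node j) (enum 'I_(size p))) p0.
rewrite size_map size_enum_ord ltnn; apply.
  by apply/allP => _ /mapP[i _ ->]; apply/eqP/h/char0.
by rewrite map_inj_uniq ?enum_uniq // => i j /node_inj/val_inj.
Qed.

Lemma mgrade_eval (W : {mpoly K[3]}) (v : 'I_3 -> K) t :
  (map_poly (meval v) (mgrade W)).[t] = W.@[fun i => t * v i].
Proof.
elim/mpolyind: W => [|c m p _ _ IH]; first by rewrite /mgrade mmap0 map_poly0 horner0 meval0.
rewrite mgradeD (rmorphD (map_poly (meval v))) hornerD.
rewrite [RHS](mevalD _ (c *: 'X_[m]) p); congr (_ + _); last exact: IH.
rewrite mgradeZX.
transitivity (((c *: 'X_[m]).@[v])%:P * 'X^(mdeg m)).[t].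
  by congr (_.[t]); rewrite rmorphM /= map_polyC map_polyXn.
rewrite hornerM hornerC hornerXn !mevalZ !mevalX -mulrA; congr (_ * _).
rewrite mulrC mdegE -prodrXr -big_split /=.
by apply: eq_bigr => i _; rewrite exprMn.
Qed.

(** W(t v) is a polynomial in t whose coefficient of t^e is the value at v of the component of
    degree e. *)
Lemma homogeneous_values e (W : {mpoly K[3]}) :
  (forall t v, t != 0 -> (forall i, v i != 0) -> W.@[fun i => t * v i] = t ^+ e * W.@[v]) ->
  forall v, (forall i, v i != 0) -> W.@[v] = (pihomog mdeg e W).@[v].
Proof.
move=> h v v0.
have /polyP/(_ e) : map_poly (meval v) (mgrade W) - W.@[v] *: 'X^e = 0.
  apply: poly_zero_nonzero => t t0.
  by rewrite hornerD hornerN mgrade_eval hornerZ hornerXn h // mulrC subrr.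
rewrite coefB coef_map coef_mgrade coefZ coefXn eqxx mulr1 coef0 => /eqP.
by rewrite subr_eq0 => /eqP ->.
Qed.

End Interpolation.

(** * The Koszul argument for an antisymmetric matrix of forms *)

Section Koszul.
Variables (K : fieldType) (e : nat) (Om : 'I_3 -> 'I_3 -> {mpoly K[3]}).
Hypothesis char0 : forall j, j.+1%:R != 0 :> K.
Hypothesis Om_homog : forall a b, Om a b \is e.-homog.
Hypothesis Om_anti : forall a b, Om a b = - Om b a.
Hypothesis Om_cyclic : forall a b c, 'X_c * Om a b + 'X_a * Om b c + 'X_b * Om c a = 0.

Definition koszul_field (a : 'I_3) : {mpoly K[3]} :=
  (e.+1%:R)^-1 *: \sum_b (Om a b)^`M(b).

Lemma koszul_field_homog a : koszul_field a \is e.-1.-homog.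
Proof. by apply: dhomogZ; apply: rpred_sum => b _; apply: dhomog_mderiv. Qed.

(** Take the divergence of the cyclic identity. The normalizing constant is e + 1 = 3 + e - 2:
    Euler's identity contributes 3 + e, and the derivatives of x_a and x_b contribute - 1 each by
    antisymmetry. *)
Lemma koszul_field_minor a b : 'X_b * koszul_field a - 'X_a * koszul_field b = Om a b.
Proof.
pose V := \sum_c ('X_c * Om a b + 'X_a * Om b c + 'X_b * Om c a)^`M(c).
have V0 : V = 0 by rewrite /V big1 // => c _; rewrite Om_cyclic mderiv0.
have e1 : \sum_c ('X_c * Om a b)^`M(c) = Om a b *+ 3 + Om a b *+ e.
  rewrite -(euler_homog (Om_homog a b)).
  under eq_bigr => c _ do rewrite mderivM mderivXU eqxx mul1r.
  by rewrite big_split /= sumr_const card_ord.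
have shift (x : 'I_3) (f : 'I_3 -> {mpoly K[3]}) :
    \sum_c ('X_x * f c)^`M(c) = f x + 'X_x * \sum_c (f c)^`M(c).
  under eq_bigr => c _ do rewrite mderivM mderivXU.
  rewrite big_split /= -mulr_sumr; congr (_ + _).
  rewrite (bigD1 x) //= eqxx mul1r big1 ?addr0 // => c /negbTE cx.
  by rewrite eq_sym cx mul0r.
have eV : V = (Om a b *+ 3 + Om a b *+ e) + (Om b a + 'X_a * \sum_c (Om b c)^`M(c))
     + (Om b a + 'X_b * \sum_c (Om c a)^`M(c)).
  rewrite -e1 -(shift a (Om b)) -(shift b (fun c => Om c a)) -!big_split /=.
  by apply: eq_bigr => c _; rewrite !mderivD.
have eK x : \sum_c (Om x c)^`M(c) = (e.+1%:R)%:MP * koszul_field x.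
  by rewrite mul_mpolyC /koszul_field scalerA divff ?char0 // scale1r.
have eK' x : \sum_c (Om c x)^`M(c) = - ((e.+1%:R)%:MP * koszul_field x).
  by rewrite -eK -sumrN; apply: eq_bigr => c _; rewrite Om_anti mderivN.
have n0 : (e.+1%:R)%:MP != 0 :> {mpoly K[3]} by rewrite mpolyC_eq0.
apply: (mulfI n0); apply/eqP; rewrite -subr_eq0; apply/eqP.
rewrite -[RHS]oppr0 -V0 eV eK eK' (Om_anti b a) mpolyC_nat.
by rewrite -[Om a b *+ e]mulr_natl -[Om a b *+ 3]mulr_natl -natr1; ring.
Qed.

End Koszul.

End Algebra.

Module PowerSeries.
From mathcomp Require Import zify ring lra.
Set Implicit Arguments.
Unset Strict Implicit.
Unset Printing Implicit Defensive.
Import Order.TTheory GRing.Theory Num.Theory.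
Local Open Scope ring_scope.

(** * Convergent double power series *)

Section Sums.
Variable V : nmodType.

Definition sum2 N (F : nat -> nat -> V) : V := \sum_(m < N) \sum_(n < N) F m n.

Lemma eq_sum2 N F G : (forall m n, F m n = G m n) -> sum2 N F = sum2 N G.
Proof. by move=> h; apply: eq_bigr => m _; apply: eq_bigr => n _. Qed.

Lemma sum2D N F G : sum2 N (fun m n => F m n + G m n) = sum2 N F + sum2 N G.
Proof. by rewrite /sum2 -big_split; apply: eq_bigr => m _; rewrite big_split. Qed.

(** The triangle is written as a square with zeros outside, so that a Cauchy product can be compared
    term by term with the product of two square partial sums. *)
Lemma sum_triangle N (G : nat -> nat -> V) :
  \sum_(m < N) \sum_(i < m.+1) G i (m - i)%N =
  \sum_(i < N) \sum_(k < N) (if (i + k < N)%N then G i k else 0).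
Proof.
transitivity (\sum_(m < N) \sum_(i < N) (if (i <= m)%N then G i (m - i)%N else 0)).
  apply: eq_bigr => m _.
  rewrite (big_ord_widen N (fun i => G i (m - i)%N)) // big_mkcond /=.
  by apply: eq_bigr => i _; rewrite ltnS.
rewrite exchange_big; apply: eq_bigr => i _ /=.
rewrite -(big_mkord xpredT (fun m => if (i <= m)%N then G i (m - i)%N else 0)).
rewrite -(big_mkord xpredT (fun k => if (i + k < N)%N then G i k else 0)).
have iN : (i <= N)%N by exact: ltnW.
rewrite (big_cat_nat (n := i)) //= big_nat_cond big1 ?add0r; last first.
  by move=> m /andP[/andP[_ mi] _]; rewrite leqNgt mi.
rewrite [RHS](big_cat_nat (n := N - i)) ?leq_subr //=.
rewrite [X in _ = _ + X]big_nat_cond [X in _ = _ + X]big1 ?addr0; last first.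
  by move=> k /andP[/andP[ki _] _]; rewrite -ltn_subRL ltnNge ki.
rewrite -{1}[i : nat]add0n big_addn !big_nat; apply: eq_bigr => k /andP[_ kN].
by rewrite leq_addl addnK -ltn_subRL kN.
Qed.

Definition conv (mul : V -> V -> V) (a b : nat -> nat -> V) m n :=
  \sum_(i < m.+1) \sum_(j < n.+1) mul (a i j) (b (m - i)%N (n - j)%N).

Lemma sum2_triangle N (H : nat -> nat -> nat -> nat -> V) :
  sum2 N (fun m n => \sum_(i < m.+1) \sum_(j < n.+1) H i (m - i)%N j (n - j)%N) =
  \sum_(i < N) \sum_(k < N) \sum_(j < N) \sum_(l < N)
    (if (i + k < N)%N && (j + l < N)%N then H i k j l else 0).
Proof.
transitivity (\sum_(m < N) \sum_(i < m.+1) \sum_(n < N) \sum_(j < n.+1)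
    H i (m - i)%N j (n - j)%N).
  by apply: eq_bigr => m _; rewrite exchange_big.
rewrite (sum_triangle N (fun i k => \sum_(n < N) \sum_(j < n.+1) H i k j (n - j)%N)).
apply: eq_bigr => i _; apply: eq_bigr => k _; case: ifP => _ /=.
  exact: (sum_triangle N (H i k)).
by rewrite big1 // => j _; rewrite big1.
Qed.

End Sums.

Section AbsoluteValue.
Variables (R : realFieldType) (K : fieldType) (nm : K -> R).
Hypothesis nm_ge0 : forall x, 0 <= nm x.
Hypothesis nm0P : forall x, nm x = 0 -> x = 0.
Hypothesis nm0 : nm 0 = 0.
Hypothesis nmN : forall x, nm (- x) = nm x.
Hypothesis nmD : forall x y, nm (x + y) <= nm x + nm y.
Hypothesis nmM : forall x y, nm (x * y) = nm x * nm y.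

Lemma nm1 : nm 1 = 1.
Proof.
have h : nm 1 * nm 1 = nm 1 by rewrite -nmM mulr1.
have n0 : nm 1 != 0 by apply/eqP => /nm0P/eqP; rewrite oner_eq0.
by apply: (mulfI n0); rewrite h mulr1.
Qed.

Lemma nmX x n : nm (x ^+ n) = nm x ^+ n.
Proof. by elim: n => [|n IH]; rewrite ?expr0 ?nm1 // !exprS nmM IH. Qed.

Lemma nm_sum I (r : seq I) (P : pred I) (F : I -> K) :
  nm (\sum_(i <- r | P i) F i) <= \sum_(i <- r | P i) nm (F i).
Proof.
elim/big_rec2: _ => [|i y x _ h]; first by rewrite nm0.
by apply: le_trans (nmD _ _) _; rewrite lerD2l.
Qed.

Lemma nm_sum2 N F : nm (sum2 N F) <= sum2 N (fun m n => nm (F m n)).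
Proof.
apply: le_trans (nm_sum _ _ _) _; apply: ler_sum => m _; exact: nm_sum.
Qed.

Lemma nm_sub x y : nm x - nm y <= nm (x - y).
Proof. by rewrite lerBlDr -{1}(subrK y x); exact: nmD. Qed.

Lemma nm_inv x : nm x^-1 = (nm x)^-1.
Proof.
have [->|x0] := eqVneq x 0; first by rewrite invr0 nm0 invr0.
have n0 : nm x != 0 by apply/eqP => /nm0P/eqP; apply/negP.
by apply: (mulfI n0); rewrite -nmM !divff // nm1.
Qed.

Lemma nm_gt0 x : x != 0 -> 0 < nm x.
Proof.
by move=> x0; rewrite lt_neqAle nm_ge0 andbT eq_sym; apply: contraNneq x0 => /nm0P->.
Qed.

Definition term2 (c : nat -> nat -> K) (x y : K) m n := c m n * x ^+ m * y ^+ n.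
Definition abs2 (c : nat -> nat -> K) (r : R) N := sum2 N (fun m n => nm (c m n) * r ^+ (m + n)).

(* [c] is the Taylor series of [f] at (a, b), with absolutely bounded sums on the
   polydisc of radius [r] and a geometric bound for the remainders. *)
Definition taylor2 (f : K -> K -> K) (a b : K) c (r M : R) :=
  [/\ 0 < r, forall N, abs2 c r N <= M &
   forall x y q, 0 <= q <= 1 -> nm (x - a) <= q * r -> nm (y - b) <= q * r ->
   forall N, nm (f x y - sum2 N (term2 c (x - a) (y - b))) <= M * q ^+ N].

Definition hol2 f a b := exists c r M, taylor2 f a b c r M.

Lemma taylor2_ge0 f a b c r M : taylor2 f a b c r M -> 0 <= M.
Proof. by case=> _ /(_ 0%N) + _; rewrite /abs2 /sum2 big_ord0. Qed.

Lemma taylor2_shrink f a b c r M t : taylor2 f a b c r M -> 0 < t <= 1 ->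
  taylor2 f a b c (t * r) M.
Proof.
move=> T; have M0 := taylor2_ge0 T; case: T => r0 cM fM /andP[t0 t1]; split.
- exact: mulr_gt0.
- move=> N; apply: le_trans (cM N); apply: ler_sum => m _; apply: ler_sum => n _.
  apply: ler_wpM2l => //; apply: lerXn2r.
  - by rewrite nnegrE mulr_ge0 // ltW.
  - by rewrite nnegrE ltW.
  - by rewrite ger_pMl.
- move=> x y q /andP[q0 q1] hx hy N.
  apply: le_trans (fM x y (q * t) _ _ _ N) _; rewrite -?mulrA //.
  + by rewrite mulr_ge0 ?(ltW t0) //= mulr_ile1 // ltW.
  + apply: ler_wpM2l => //; apply: lerXn2r.
    * by rewrite nnegrE mulr_ge0 // ltW.
    * by rewrite nnegrE.
    * by rewrite ler_piMr.
Qed.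

(* The part of the product of two truncated series outside the truncation. *)
Lemma conv_sum2 N (a b : nat -> nat -> K) (r q : R) x y : 0 <= r -> 0 <= q <= 1 ->
  nm x <= q * r -> nm y <= q * r ->
  nm (sum2 N (term2 a x y) * sum2 N (term2 b x y)
      - sum2 N (term2 (conv *%R a b) x y)) <= abs2 a r N * abs2 b r N * q ^+ N.
Proof.
move=> r0 /andP[q0 q1] hx hy.
pose H i k j l : K := term2 a x y i j * term2 b x y k l.
have -> : sum2 N (term2 a x y) * sum2 N (term2 b x y) =
    \sum_(i < N) \sum_(k < N) \sum_(j < N) \sum_(l < N) H i k j l.
  rewrite /sum2 mulr_suml; apply: eq_bigr => i _.
  rewrite mulr_sumr; apply: eq_bigr => k _.
  rewrite mulr_suml; apply: eq_bigr => j _.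
  by rewrite mulr_sumr.
have -> : sum2 N (term2 (conv *%R a b) x y) =
    \sum_(i < N) \sum_(k < N) \sum_(j < N) \sum_(l < N)
      (if (i + k < N)%N && (j + l < N)%N then H i k j l else 0).
  rewrite -(sum2_triangle N H); apply: eq_sum2 => m n.
  rewrite /term2 /conv -mulrA mulr_suml; apply: eq_bigr => i _.
  rewrite mulr_suml; apply: eq_bigr => j _.
  rewrite /H /term2 -[in x ^+ m](subnKC (ltn_ord i : (i <= m)%N)) exprD.
  rewrite -[in y ^+ n](subnKC (ltn_ord j : (j <= n)%N)) exprD; ring.
have -> : abs2 a r N * abs2 b r N * q ^+ N = \sum_(i < N) \sum_(k < N) \sum_(j < N) \sum_(l < N)
    (nm (a i j) * r ^+ (i + j)) * (nm (b k l) * r ^+ (k + l)) * q ^+ N.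
  rewrite /abs2 /sum2 -mulrA mulr_suml; apply: eq_bigr => i _.
  rewrite mulrA mulr_sumr mulr_suml; apply: eq_bigr => k _.
  rewrite mulr_suml mulr_suml; apply: eq_bigr => j _.
  by rewrite mulr_sumr mulr_suml.
rewrite -sumrB; apply: le_trans (nm_sum _ _ _) _; apply: ler_sum => i _.
rewrite -sumrB; apply: le_trans (nm_sum _ _ _) _; apply: ler_sum => k _.
rewrite -sumrB; apply: le_trans (nm_sum _ _ _) _; apply: ler_sum => j _.
rewrite -sumrB; apply: le_trans (nm_sum _ _ _) _; apply: ler_sum => l _.
have rhs0 (e : nat) : 0 <= nm (a i j) * r ^+ (i + j) * (nm (b k l) * r ^+ (k + l)) * q ^+ e.
  by rewrite !mulr_ge0 ?exprn_ge0.
case: ifP => [_|/negbT]; first by rewrite subrr nm0.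
rewrite negb_and -!leqNgt => hN; rewrite subr0 /H /term2.
have {}hN : (N <= (i + j) + (k + l))%N by move: hN => /orP[]; lia.
apply: (@le_trans _ _ (nm (a i j) * r ^+ (i + j) * (nm (b k l) * r ^+ (k + l)) * q ^+ (i + j + (k + l)))); last first.
  apply: ler_wpM2l; first by rewrite !mulr_ge0 ?exprn_ge0.
  exact: ler_wiXn2l.
have e : nm (a i j) * r ^+ (i + j) * (nm (b k l) * r ^+ (k + l)) * q ^+ (i + j + (k + l))
   = nm (a i j) * ((q * r) ^+ i * (q * r) ^+ j) * (nm (b k l) * ((q * r) ^+ k * (q * r) ^+ l)).
  by rewrite !exprMn !exprD; ring.
have hp z t (s : R) : nm z <= q * r -> nm (z ^+ t) <= (q * r) ^+ t.
  by move=> hz; rewrite nmX; apply: lerXn2r; rewrite ?nnegrE // mulr_ge0.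
rewrite e !nmM -!mulrA; do ! (apply: ler_pM => //; rewrite ?mulr_ge0 //); exact: hp.
Qed.

Lemma abs2_ge0 c r N : 0 <= r -> 0 <= abs2 c r N.
Proof. by move=> r0; do 2 (apply: sumr_ge0 => ? _); rewrite mulr_ge0 ?exprn_ge0. Qed.

Lemma abs2_conv N a b r : 0 <= r ->
  abs2 (conv *%R a b) r N <= abs2 a r N * abs2 b r N.
Proof.
move=> r0.
pose H i k j l : R := nm (a i j) * r ^+ (i + j) * (nm (b k l) * r ^+ (k + l)).
have H0 i k j l : 0 <= H i k j l by rewrite !mulr_ge0 ?exprn_ge0.
apply: (@le_trans _ _ (sum2 N (fun m n => \sum_(i < m.+1) \sum_(j < n.+1) H i (m - i)%N j (n - j)%N))).
  apply: ler_sum => m _; apply: ler_sum => n _.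
  apply: (@le_trans _ _ ((\sum_(i < m.+1) \sum_(j < n.+1) nm (a i j * b (m - i)%N (n - j)%N)) * r ^+ (m + n))).
    apply: ler_wpM2r; first exact: exprn_ge0.
    by apply: le_trans (nm_sum _ _ _) _; apply: ler_sum => i _; exact: nm_sum.
  rewrite mulr_suml; apply: ler_sum => i _; rewrite mulr_suml; apply: ler_sum => j _.
  have im : (i <= m)%N by rewrite -ltnS.
  have jn : (j <= n)%N by rewrite -ltnS.
  have -> : (m + n = (i + j) + ((m - i) + (n - j)))%N by lia.
  by rewrite nmM /H exprD mulrACA.
rewrite sum2_triangle.
have -> : abs2 a r N * abs2 b r N = \sum_(i < N) \sum_(k < N) \sum_(j < N) \sum_(l < N) H i k j l.
  rewrite /abs2 /sum2 mulr_suml; apply: eq_bigr => i _.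
  rewrite mulr_sumr; apply: eq_bigr => k _.
  rewrite mulr_suml; apply: eq_bigr => j _.
  by rewrite mulr_sumr.
do 4 (apply: ler_sum => ? _); by case: ifP.
Qed.


Lemma nm_term2 N c x y r q : 0 <= r -> 0 <= q <= 1 -> nm x <= q * r -> nm y <= q * r ->
  nm (sum2 N (term2 c x y)) <= abs2 c r N.
Proof.
move=> r0 /andP[q0 q1] hx hy; apply: le_trans (nm_sum2 _ _) _.
have hr z t : nm z <= q * r -> nm z ^+ t <= r ^+ t.
  move=> hz; apply: lerXn2r; rewrite ?nnegrE //; apply: le_trans hz _.
  exact: ler_piMl.
apply: ler_sum => m _; apply: ler_sum => n _; rewrite /term2 !nmM !nmX exprD -mulrA.
by do ! (apply: ler_pM; rewrite ?mulr_ge0 ?exprn_ge0 ?hr //).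
Qed.

Lemma sum2_tail N N' c x y r q : (N <= N')%N -> 0 <= r -> 0 <= q <= 1 ->
  nm x <= q * r -> nm y <= q * r ->
  nm (sum2 N' (term2 c x y) - sum2 N (term2 c x y)) <= abs2 c r N' * q ^+ N.
Proof.
move=> NN r0 /andP[q0 q1] hx hy.
have -> : sum2 N (term2 c x y) =
    sum2 N' (fun m n => if (m < N)%N && (n < N)%N then term2 c x y m n else 0).
  rewrite /sum2 (big_ord_widen N' (fun m => \sum_(n < N) term2 c x y m n)) // big_mkcond /=.
  apply: eq_bigr => m _; case: ifP => _ /=; last by rewrite big1.
  by rewrite (big_ord_widen N' (fun n => term2 c x y m n)) // big_mkcond.
rewrite /sum2 -sumrB; apply: le_trans (nm_sum _ _ _) _.
rewrite /abs2 /sum2 mulr_suml; apply: ler_sum => m _.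
rewrite -sumrB; apply: le_trans (nm_sum _ _ _) _; rewrite mulr_suml; apply: ler_sum => n _.
case: ifP => [_|/negbT]; first by rewrite subrr nm0 !mulr_ge0 ?exprn_ge0.
rewrite negb_and -!leqNgt => hN; rewrite subr0 /term2 !nmM !nmX.
have {}hN : (N <= m + n)%N by move: hN => /orP[]; lia.
apply: (@le_trans _ _ (nm (c m n) * r ^+ (m + n) * q ^+ (m + n))); last first.
  by apply: ler_wpM2l; rewrite ?mulr_ge0 ?exprn_ge0 //; exact: ler_wiXn2l.
have -> : nm (c m n) * r ^+ (m + n) * q ^+ (m + n) = nm (c m n) * (q * r) ^+ m * (q * r) ^+ n.
  by rewrite !exprMn !exprD; ring.
have hp z t : nm z <= q * r -> nm z ^+ t <= (q * r) ^+ t.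
  by move=> hz; apply: lerXn2r; rewrite ?nnegrE // mulr_ge0.
by apply: ler_pM; rewrite ?mulr_ge0 ?exprn_ge0 ?hp //; apply: ler_wpM2l; rewrite ?hp.
Qed.

Lemma taylor2_radius f a b c r M s : taylor2 f a b c r M -> 0 < s <= r ->
  taylor2 f a b c s M.
Proof.
move=> T /andP[s0 sr]; have r0 : 0 < r by case: T.
have -> : s = s / r * r by rewrite divrK // unitfE gt_eqF.
by apply: taylor2_shrink T _; rewrite divr_gt0 //= ler_pdivrMr // mul1r.
Qed.

Lemma taylor2_bound f a b c r M x y : taylor2 f a b c r M ->
  nm (x - a) <= r -> nm (y - b) <= r -> nm (f x y) <= M.
Proof.
move=> [_ _ h] hx hy; have := h x y 1; rewrite !mul1r ler01 lexx => /(_ isT hx hy 0%N).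
by rewrite /sum2 big_ord0 subr0 expr0 mulr1.
Qed.

Lemma hol2_ext f g a b r : 0 < r ->
  (forall x y, nm (x - a) <= r -> nm (y - b) <= r -> f x y = g x y) ->
  hol2 f a b -> hol2 g a b.
Proof.
move=> r0 fg [c [s [M T]]]; exists c, (Num.min r s), M.
have s0 : 0 < s by case: T.
have m0 : 0 < Num.min r s by rewrite lt_min r0.
have [_ h1 h2] : taylor2 f a b c (Num.min r s) M.
  by apply: taylor2_radius T _; rewrite m0 ge_min lexx orbT.
split=> // x y q /andP[q0 q1] hx hy N; rewrite -fg; first by apply: h2; rewrite ?q0.
- apply: le_trans hx _; apply: le_trans (ler_piMl (ltW m0) q1) _.
  by rewrite ge_min lexx.
- apply: le_trans hy _; apply: le_trans (ler_piMl (ltW m0) q1) _.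
  by rewrite ge_min lexx.
Qed.

Lemma hol2_bounded f a b : hol2 f a b -> exists r M, 0 < r /\
  forall x y, nm (x - a) <= r -> nm (y - b) <= r -> nm (f x y) <= M.
Proof.
move=> [c [r [M T]]]; exists r, M; split; first by case: T.
by move=> x y; exact: taylor2_bound T.
Qed.

Lemma hol2_add f g a b : hol2 f a b -> hol2 g a b -> hol2 (fun x y => f x y + g x y) a b.
Proof.
move=> [c1 [r1 [M1 T1]]] [c2 [r2 [M2 T2]]].
have r10 : 0 < r1 by case: T1.
have r20 : 0 < r2 by case: T2.
set r := Num.min r1 r2; have r0 : 0 < r by rewrite lt_min r10.
have {T1} [_ h1 k1] : taylor2 f a b c1 r M1.
  by apply: taylor2_radius T1 _; rewrite r0 ge_min lexx.
have {T2} [_ h2 k2] : taylor2 g a b c2 r M2.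
  by apply: taylor2_radius T2 _; rewrite r0 ge_min lexx orbT.
exists (fun m n => c1 m n + c2 m n), r, (M1 + M2); split => // [N|x y q hq hx hy N].
  apply: le_trans (lerD (h1 N) (h2 N)); rewrite /abs2 -sum2D.
  apply: ler_sum => m _; apply: ler_sum => n _; rewrite -mulrDl.
  by apply: ler_wpM2r; [rewrite exprn_ge0 // ltW | exact: nmD].
have -> : sum2 N (term2 (fun m n => c1 m n + c2 m n) (x - a) (y - b)) =
    sum2 N (term2 c1 (x - a) (y - b)) + sum2 N (term2 c2 (x - a) (y - b)).
  by rewrite -sum2D; apply: eq_sum2 => m n; rewrite /term2 !mulrDl.
rewrite opprD addrACA mulrDl; apply: le_trans (nmD _ _) _.
by apply: lerD; [apply: k1 | apply: k2].
Qed.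

Lemma hol2_mul f g a b : hol2 f a b -> hol2 g a b -> hol2 (fun x y => f x y * g x y) a b.
Proof.
move=> [c1 [r1 [M1 T1]]] [c2 [r2 [M2 T2]]].
have r10 : 0 < r1 by case: T1.
have r20 : 0 < r2 by case: T2.
set r := Num.min r1 r2; have r0 : 0 < r by rewrite lt_min r10.
have {}T1 : taylor2 f a b c1 r M1.
  by apply: taylor2_radius T1 _; rewrite r0 ge_min lexx.
have {}T2 : taylor2 g a b c2 r M2.
  by apply: taylor2_radius T2 _; rewrite r0 ge_min lexx orbT.
have M10 := taylor2_ge0 T1; have M20 := taylor2_ge0 T2.
have rr := ltW r0; have [_ h1 k1] := T1; have [_ h2 k2] := T2.
have abs0 c N := @abs2_ge0 c r N rr.
exists (conv *%R c1 c2), r, (M1 * M2 + (M1 * M2 + M1 * M2)).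
split => // [N|x y q hq hx hy N].
  apply: le_trans (abs2_conv _ _ _ rr) _.
  apply: (@le_trans _ _ (M1 * M2)); first exact: ler_pM.
  by rewrite lerDl addr_ge0 // mulr_ge0.
have [q0 q1] := andP hq; have qN0 : 0 <= q ^+ N by exact: exprn_ge0.
have hx' : nm (x - a) <= r by apply: le_trans hx _; exact: ler_piMl.
have hy' : nm (y - b) <= r by apply: le_trans hy _; exact: ler_piMl.
pose A := sum2 N (term2 c1 (x - a) (y - b)).
pose B := sum2 N (term2 c2 (x - a) (y - b)).
set E := sum2 N _.
have -> : f x y * g x y - E =
  (A * B - E) + ((f x y - sum2 N (term2 c1 (x - a) (y - b))) * g x y +
  A * (g x y - sum2 N (term2 c2 (x - a) (y - b)))) by rewrite -/A -/B; ring.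
rewrite [X in _ <= X]mulrDl [X in _ <= _ + X]mulrDl.
apply: le_trans (nmD _ _) _; apply: lerD.
  apply: le_trans (conv_sum2 _ _ _ rr hq hx hy) _.
  by apply: ler_wpM2r => //; apply: ler_pM.
apply: le_trans (nmD _ _) _; apply: lerD.
  rewrite nmM mulrAC; apply: ler_pM => //; first exact: k1.
  exact: taylor2_bound T2 hx' hy'.
rewrite nmM -mulrA; apply: ler_pM => //; last exact: k2.
exact: le_trans (nm_term2 _ _ rr hq hx hy) (h1 N).
Qed.

Lemma sum2_00 (V : nmodType) N (F : nat -> nat -> V) :
  (forall m n, (m, n) != (0, 0)%N -> F m n = 0) -> sum2 N.+1 F = F 0%N 0%N.
Proof.
move=> h; rewrite /sum2 big_ord_recl big_ord_recl /= big1 => [|n _]; last exact: h.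
rewrite addr0 big1 ?addr0 // => m _; apply: big1 => n _; exact: h.
Qed.

Lemma hol2_cst k a b : hol2 (fun _ _ => k) a b.
Proof.
exists (fun m n => if (m == 0%N) && (n == 0%N) then k else 0), 1, (nm k).
have z m n : (m, n) != (0, 0)%N -> (m == 0%N) && (n == 0%N) = false.
  by move=> h; apply/negbTE.
split=> // [[|N]|x y q /andP[q0 q1] _ _ [|N]].
- by rewrite /abs2 /sum2 big_ord0.
- by rewrite /abs2 sum2_00 => [|m n /z ->]; rewrite ?nm0 ?mul0r // addn0 expr0 mulr1.
- by rewrite /sum2 big_ord0 subr0 expr0 mulr1.
- rewrite sum2_00 => [|m n /z h]; last by rewrite /term2 h !mul0r.
  by rewrite /term2 /= !expr0 !mulr1 subrr nm0 mulr_ge0 ?exprn_ge0.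
Qed.

Lemma hol2_swap f a b : hol2 f a b -> hol2 (fun x y => f y x) b a.
Proof.
move=> [c [r [M [r0 h k]]]]; exists (fun m n => c n m), r, M; split=> // [N|x y q hq hx hy N].
  rewrite (_ : abs2 _ _ _ = abs2 c r N) //.
  rewrite /abs2 /sum2 exchange_big; apply: eq_bigr => m _; apply: eq_bigr => n _.
  by rewrite addnC.
rewrite (_ : sum2 N _ = sum2 N (term2 c (y - a) (x - b))); first exact: k.
rewrite /sum2 exchange_big; apply: eq_bigr => m _; apply: eq_bigr => n _.
by rewrite /term2 mulrAC.
Qed.

(** A function of one variable is treated as one of two variables that is constant in the second, so
    sums and products come from the two-variable case. *)
Definition hol1 (g : K -> K) a := hol2 (fun x _ => g x) a 0.

Definition taylor1 (g : K -> K) a (c : nat -> K) (r M : R) :=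
  [/\ 0 < r, forall N, \sum_(m < N) nm (c m) * r ^+ m <= M &
   forall x q, 0 <= q <= 1 -> nm (x - a) <= q * r ->
   forall N, nm (g x - \sum_(m < N) c m * (x - a) ^+ m) <= M * q ^+ N].

Lemma sum2_col (V : nmodType) N (F : nat -> nat -> V) :
  (forall m n, F m n.+1 = 0) -> sum2 N F = \sum_(m < N) F m 0%N.
Proof.
move=> h; case: N => [|N]; first by rewrite /sum2 !big_ord0.
by apply: eq_bigr => m _; rewrite big_ord_recl big1 ?addr0 // => n _; exact: h.
Qed.

Lemma taylor1P g a : hol1 g a <-> exists c r M, taylor1 g a c r M.
Proof.
split=> [[c [r [M [r0 h k]]]]|[c [r [M [r0 h k]]]]].
  exists (c^~ 0%N), r, M; split=> // [N|x q hq hx N].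
    apply: le_trans (h N); apply: ler_sum => m _.
    case: N m => [[//]|N] m; rewrite big_ord_recl addn0 lerDl.
    by apply: sumr_ge0 => n _; rewrite mulr_ge0 ?exprn_ge0 // ltW.
  have := k x 0 q hq hx _ N; rewrite subrr nm0 => /(_ _).
  rewrite sum2_col => [|m n]; last by rewrite /term2 expr0n mulr0.
  rewrite (eq_bigr (fun m : 'I_N => c m 0%N * (x - a) ^+ m)); last first.
    by move=> m _; rewrite /term2 expr0 mulr1.
  by apply; apply: mulr_ge0; [case/andP: hq | exact: ltW].
exists (fun m n => if n is 0%N then c m else 0), r, M.
split=> // [N|x y q hq hx hy N].
  rewrite /abs2 sum2_col => [|m n]; last by rewrite nm0 mul0r.
  by apply: le_trans (h N); apply: ler_sum => m _; rewrite addn0.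
rewrite sum2_col => [|m n]; last by rewrite /term2 !mul0r.
rewrite (eq_bigr (fun m : 'I_N => c m * (x - a) ^+ m)); last first.
  by move=> m _; rewrite /term2 expr0 mulr1.
exact: k.
Qed.

Lemma hol2_line f a b : hol2 f a b -> hol1 (fun x => f x b) a.
Proof.
move=> [c [r [M [r0 h k]]]]; apply/taylor1P; exists (c^~ 0%N), r, M; split=> // [N|x q hq hx N].
  apply: le_trans (h N); apply: ler_sum => m _.
  case: N m => [[//]|N] m; rewrite big_ord_recl addn0 lerDl.
  by apply: sumr_ge0 => n _; rewrite mulr_ge0 ?exprn_ge0 // ltW.
have := k x b q hq hx _ N; rewrite subrr nm0 => /(_ _).
rewrite sum2_col => [|m n]; last by rewrite /term2 expr0n mulr0.
rewrite (eq_bigr (fun m : 'I_N => c m 0%N * (x - a) ^+ m)); last first.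
  by move=> m _; rewrite /term2 expr0 mulr1.
by apply; apply: mulr_ge0; [case/andP: hq | exact: ltW].
Qed.

Lemma hol1_id a : hol1 id a.
Proof.
apply/taylor1P; exists (fun m => if m is 0%N then a else if m is 1%N then 1 else 0), 1, (nm a + 1).
split=> // [[|[|N]]|x q /andP[q0 q1] hx [|[|N]]].
- by rewrite big_ord0 addr_ge0.
- by rewrite big_ord_recl big_ord0 expr0 mulr1 lerD2l.
- rewrite !big_ord_recl big1 => [|i _]; last by rewrite nm0 mul0r.
  by rewrite !expr1n !mulr1 nm1 addr0.
- rewrite big_ord0 subr0 expr0 mulr1 -{1}(subrK a x) addrC.
  by apply: le_trans (nmD _ _) _; rewrite lerD2l (le_trans hx) // mulr1.
- rewrite big_ord_recl big_ord0 expr0 mulr1 addr0 expr1; apply: le_trans hx _.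
  by rewrite mulr1 mulrDl mul1r lerDr mulr_ge0.
- rewrite !big_ord_recl big1 => [|i _]; last by rewrite mul0r.
  rewrite expr0 mulr1 expr1 mul1r addr0 (addrC a) subrK subrr nm0.
  by rewrite mulr_ge0 ?exprn_ge0 ?addr_ge0.
Qed.

Lemma hol2_fst a b : hol2 (fun x _ => x) a b.
Proof.
have [c [r [M [r0 h k]]]] := hol1_id a; exists c, r, M; split=> // x y q hq hx hy N.
by have := k x (y - b) q hq hx; rewrite subr0; apply.
Qed.

Lemma hol2_snd a b : hol2 (fun _ y => y) a b.
Proof. exact: hol2_swap (hol2_fst b a). Qed.

End AbsoluteValue.

(** * Inverses of convergent power series *)

Section Inverse.
Variables (R : realFieldType) (K : fieldType) (nm : K -> R).
Hypothesis nm_ge0 : forall x, 0 <= nm x.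
Hypothesis nm0P : forall x, nm x = 0 -> x = 0.
Hypothesis nm0 : nm 0 = 0.
Hypothesis nmN : forall x, nm (- x) = nm x.
Hypothesis nmD : forall x y, nm (x + y) <= nm x + nm y.
Hypothesis nmM : forall x y, nm (x * y) = nm x * nm y.

Section Coefficients.
Variable c : nat -> nat -> K.

Definition cpunct m n := if (m == 0%N) && (n == 0%N) then 0 else c m n.

(* The recursion is on the fuel [t], which is irrelevant once it exceeds m + n. *)
Fixpoint invc_rec t m n : K :=
  if t is t'.+1 then
    ((if (m == 0%N) && (n == 0%N) then 1 else 0) -
     \sum_(i < m.+1) \sum_(j < n.+1) cpunct i j * invc_rec t' (m - i)%N (n - j)%N)
      / c 0%N 0%N
  else 0.

Lemma invc_rec_fuel t t' m n : (m + n < t)%N -> (m + n < t')%N ->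
  invc_rec t m n = invc_rec t' m n.
Proof.
elim: t t' m n => [//|t IH] [//|t'] m n h h' /=; congr ((_ - _) / _).
apply: eq_bigr => i _; apply: eq_bigr => j _.
rewrite /cpunct; case: ifP => [_|/negbT ij]; first by rewrite !mul0r.
congr (_ * _); move: ij h h' (ltn_ord i) (ltn_ord j) => ij h h' hi hj.
by apply: IH; move: ij; rewrite negb_and; lia.
Qed.

Definition invc m n := invc_rec (m + n).+1 m n.

Lemma invc_eq m n : c 0%N 0%N != 0 ->
  c 0%N 0%N * invc m n = (if (m == 0%N) && (n == 0%N) then 1 else 0) -
     conv *%R cpunct invc m n.
Proof.
move=> c0; rewrite /invc /= mulrC divrK ?unitfE //; congr (_ - _).
apply: eq_bigr => i _; apply: eq_bigr => j _.
rewrite /cpunct; case: ifP => [_|/negbT ij]; first by rewrite !mul0r.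
congr (_ * _); apply: (@invc_rec_fuel _ ((m - i) + (n - j)).+1) => //.
by move: ij (ltn_ord i) (ltn_ord j); rewrite negb_and; lia.
Qed.

Lemma conv_invc m n : c 0%N 0%N != 0 ->
  conv *%R c invc m n = if (m == 0%N) && (n == 0%N) then 1 else 0.
Proof.
move=> c0; apply/eqP; rewrite -subr_eq0 -(subr_eq0 _ 0) subr0; apply/eqP.
have -> : conv *%R c invc m n = c 0%N 0%N * invc m n + conv *%R cpunct invc m n.
  rewrite /conv [in LHS]big_ord_recl [in LHS]big_ord_recl /= !subn0 -!addrA; congr (_ + _).
  rewrite [in RHS]big_ord_recl [in RHS]big_ord_recl /= !subn0 {1}/cpunct mul0r add0r.
  by [].
by rewrite invc_eq // subrK subrr.
Qed.

End Coefficients.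

(** The formal inverse is used on a smaller polydisc, where the nonconstant part of the series has
    absolute sum at most k / 2, with k = |f(a, b)|. Summing the recursion gives k S <= 1 + (k / 2) S
    for the absolute sums S of the inverse, so S <= 2 / k. *)
Lemma hol2_inv f a b : f a b != 0 -> hol2 nm f a b -> hol2 nm (fun x y => (f x y)^-1) a b.
Proof.
move=> fab [c [r1 [M1 T1]]].
have c00 : c 0%N 0%N = f a b.
  have [r10 _ /(_ a b 0)] := T1; rewrite !subrr nm0 mul0r lexx ler01.
  move=> /(_ isT isT isT 1%N); rewrite expr1 mulr0 => h.
  apply/esym/eqP; rewrite -subr_eq0; apply/eqP/nm0P/le_anti; rewrite nm_ge0 andbT.
  by move: h; rewrite /sum2 !big_ord_recl !big_ord0 /term2 !expr0 !mulr1 !addr0.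
set k := nm (f a b); have k0 : 0 < k by exact: nm_gt0.
have M10 := taylor2_ge0 T1; have r10 : 0 < r1 by case: T1.
(* Shrinking the radius by t multiplies the nonconstant terms by at most t; this value ensures t M1
   <= k / 2 and t <= 1. *)
pose t := k / (2 * (M1 + k)).
have Mk0 : 0 < M1 + k by exact: ltr_wpDl.
have t0 : 0 < t by rewrite /t divr_gt0 // mulr_gt0.
have tM : t * M1 <= k / 2.
  have -> : t * M1 = k / 2 * (M1 / (M1 + k)) by rewrite /t; field; rewrite gt_eqF.
  rewrite ler_piMr ?divr_ge0 // ?(ltW k0) //.
  by rewrite ler_pdivrMr // mul1r lerDl ltW.
have t1 : t <= 1.
  by rewrite /t ler_pdivrMr ?mulr_gt0 // mul1r; move: (ltW k0) M10; lra.
pose r := t * r1; have r0 : 0 < r by exact: mulr_gt0.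
have rr := ltW r0.
have T : taylor2 nm f a b c r M1 by apply: taylor2_shrink T1 _; rewrite ?t0.
have [_ h1 k1] := T.
pose b' := invc c.
have c0 : c 0%N 0%N != 0 by rewrite c00.
have cp N : abs2 nm (cpunct c) r N <= k / 2.
  apply: le_trans tM; apply: (@le_trans _ _ (t * abs2 nm c r1 N)); last first.
    by apply: ler_wpM2l; [exact: ltW|case: T1].
  rewrite /abs2 /sum2 mulr_sumr; apply: ler_sum => m _.
  rewrite mulr_sumr; apply: ler_sum => n _.
  rewrite /cpunct; case: ifP => [_|/negbT mn].
    by rewrite nm0 mul0r mulr_ge0 ?(ltW t0) // mulr_ge0 // exprn_ge0 // ltW.
  rewrite mulrCA; apply: ler_wpM2l => //; rewrite exprMn.
  apply: ler_wpM2r; first by rewrite exprn_ge0 // ltW.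
  have [s ->] : exists s, (m + n = s.+1)%N.
    by exists (m + n).-1; move: mn; rewrite negb_and; lia.
  by rewrite exprS ler_piMr ?(ltW t0) // exprn_ile1 // ltW.
have absb N : abs2 nm b' r N <= 2 / k.
  have s0 : 0 <= abs2 nm b' r N by exact: abs2_ge0.
  have : k * abs2 nm b' r N <= 1 + k / 2 * abs2 nm b' r N.
    apply: (@le_trans _ _ (1 + abs2 nm (cpunct c) r N * abs2 nm b' r N)); last first.
      by rewrite lerD2l; apply: ler_wpM2r.
    apply: (@le_trans _ _ (1 + abs2 nm (conv *%R (cpunct c) b') r N)); last first.
      by rewrite lerD2l; apply: abs2_conv.
    apply: (@le_trans _ _ (sum2 N (fun m n => (if (m == 0%N) && (n == 0%N) then 1 else 0) +
        nm (conv *%R (cpunct c) b' m n) * r ^+ (m + n)))).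
      rewrite /abs2 /sum2 mulr_sumr; apply: ler_sum => m _.
      rewrite mulr_sumr; apply: ler_sum => n _.
      rewrite mulrA -[k]/(nm (f a b)) -c00 -nmM /b' invc_eq //.
      case: ifP => [/andP[/eqP -> /eqP ->]|_].
        rewrite addn0 expr0 !mulr1; apply: le_trans (nmD _ _) _.
        by rewrite nmN nm1.
      by rewrite !add0r nmN.
    rewrite sum2D lerD2r; case: N {s0} => [|N]; first by rewrite /sum2 big_ord0.
    by rewrite sum2_00 //= => m n h; rewrite (_ : _ && _ = false) //; apply/negbTE.
  move=> h; rewrite ler_pdivlMr // mulrC; move: h; rewrite mulrAC; lra.
(* The remainder bound of [T1] with one term and q = t keeps f within k / 2 of its value at the
   center. *)
have flow x y : nm (x - a) <= r -> nm (y - b) <= r -> k / 2 <= nm (f x y).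
  move=> hx hy; have [_ _ /(_ x y t)] := T1; rewrite (ltW t0) t1 => /(_ isT hx hy 1%N).
  rewrite expr1 mulrC => hf.
  have hf2 : nm (f x y - f a b) <= k / 2.
    apply: le_trans tM; move: hf.
    by rewrite /sum2 !big_ord_recl !big_ord0 /term2 !expr0 !mulr1 !addr0 c00.
  have := nm_sub nmD (f a b) (f x y); rewrite -(opprB (f x y)) nmN -/k => h.
  by move: hf2 h; set u := nm (f x y); set v := nm _; lra.
have b0 : 0 <= 2 / k by rewrite divr_ge0 // ltW.
exists b', r, (2 / k * (M1 * (2 / k) + M1 * (2 / k)) + 2 / k).
have pos : 0 <= M1 * (2 / k) by exact: mulr_ge0.
split=> // [N|x y q hq hx hy N].
  by apply: le_trans (absb N) _; rewrite lerDr mulr_ge0 // addr_ge0.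
have [q0 q1] := andP hq.
have hx' : nm (x - a) <= r by apply: le_trans hx _; exact: ler_piMl.
have hy' : nm (y - b) <= r by apply: le_trans hy _; exact: ler_piMl.
have fl := flow x y hx' hy'.
have f0 : f x y != 0.
  by apply/eqP => z; move: fl; rewrite z nm0; apply/negP; rewrite -ltNge divr_gt0.
have finv : nm (f x y)^-1 <= 2 / k.
  rewrite (nm_inv nm0P nm0 nmM) -[2 / k]invrK lef_pV2 ?posrE ?invr_gt0 ?divr_gt0 ?(nm_gt0 nm_ge0 nm0P) //.
  by rewrite invfM invrK mulrC.
case: N => [|N].
  have -> : sum2 0 (term2 b' (x - a) (y - b)) = 0 by rewrite /sum2 big_ord0.
  rewrite subr0 expr0 mulr1; apply: le_trans finv _.
  by rewrite lerDr mulr_ge0 // addr_ge0.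
set A := sum2 N.+1 (term2 c (x - a) (y - b)); set B := sum2 N.+1 _.
have AB : nm (A * B - 1) <= M1 * (2 / k) * q ^+ N.+1.
  have := conv_sum2 nm_ge0 nm0P nm0 nmD nmM N.+1 c b' rr hq hx hy.
  have -> : sum2 N.+1 (term2 (conv *%R c b') (x - a) (y - b)) = 1.
    rewrite sum2_00 => [|m n h].
      by rewrite /term2 conv_invc //= !expr0 !mulr1.
    by rewrite /term2 conv_invc // (_ : _ && _ = false) ?mul0r //; apply/negbTE.
  move=> h; apply: le_trans h _; apply: ler_wpM2r; first exact: exprn_ge0.
  by apply: ler_pM => //; exact: abs2_ge0.
have Bb : nm B <= 2 / k.
  by apply: le_trans (absb N.+1); exact: (nm_term2 nm_ge0 nm0P nm0 nmD nmM _ _ rr hq).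
have fA : nm (f x y - A) <= M1 * q ^+ N.+1 by exact: k1.
have -> : (f x y)^-1 - B = (f x y)^-1 * (- (A * B - 1) - (f x y - A) * B).
  by field.
rewrite nmM; apply: (@le_trans _ _ (2 / k * (M1 * (2 / k) + M1 * (2 / k)) * q ^+ N.+1)); last first.
  by apply: ler_wpM2r; rewrite ?exprn_ge0 // lerDl.
rewrite -mulrA; apply: ler_pM => //; apply: le_trans (nmD _ _) _; rewrite !nmN nmM.
rewrite mulrDl; apply: lerD => //; rewrite mulrAC; exact: ler_pM.
Qed.

End Inverse.

(** * The maximum principle and the theorem of Liouville *)

Section Liouville.
Variables (R : realFieldType) (K : fieldType) (nm : K -> R).
Hypothesis nm_ge0 : forall x, 0 <= nm x.
Hypothesis nm0P : forall x, nm x = 0 -> x = 0.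
Hypothesis nm0 : nm 0 = 0.
Hypothesis nmN : forall x, nm (- x) = nm x.
Hypothesis nmD : forall x y, nm (x + y) <= nm x + nm y.
Hypothesis nmM : forall x y, nm (x * y) = nm x * nm y.
Hypothesis archR : forall x : R, exists n : nat, x < n%:R.
Variable iota : {rmorphism R -> K}.
Hypothesis nm_iota : forall t, nm (iota t) = `|t|.
Hypothesis rootK : forall m (z : K), (0 < m)%N -> exists x, x ^+ m = z.
(** The extreme value theorem on closed bounded sets, with closedness and continuity spelled out
    through [nm]. *)
Hypothesis evt : forall (A : K -> Prop) (u : K -> R) (L : R),
  (exists x, A x) -> (forall x, A x -> nm x <= L) ->
  (forall a, (forall e, 0 < e -> exists2 x, A x & nm (x - a) < e) -> A a) ->
  (forall a e, 0 < e -> exists2 d, 0 < d & forall x, nm (x - a) < d -> `|u x - u a| < e) ->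
  exists2 a, A a & forall x, A x -> u x <= u a.

Local Notation hol1 := (hol1 nm).
Local Notation taylor1 := (taylor1 nm).

Lemma le0_geometric (z M q : R) : 0 <= q -> q <= 1 / 2 -> (forall N, z <= M * q ^+ N) -> z <= 0.
Proof.
move=> q0 q1 h; rewrite leNgt; apply/negP => z0.
have M0 : 0 <= M by have := h 0%N; rewrite expr0 mulr1; apply: le_trans; exact: ltW.
have [N hN] := archR (M / z).
have qN : q ^+ N * N%:R <= 1.
  apply: (@le_trans _ _ ((1 / 2) ^+ N * 2 ^+ N)).
    apply: ler_pM; rewrite ?exprn_ge0 ?ler0n //.
      by apply: lerXn2r; rewrite ?nnegrE ?divr_ge0.
    by rewrite -natrX ler_nat ltnW // ltn_expl.
  by rewrite -exprMn mul1r mulVf ?expr1n // pnatr_eq0.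
have : z * N%:R <= M.
  apply: (@le_trans _ _ (M * q ^+ N * N%:R)); first by apply: ler_wpM2r.
  by rewrite -mulrA ler_piMr.
by move: hN; rewrite ltr_pdivrMr // mulrC => hN; rewrite leNgt hN.
Qed.

Lemma taylor1_coef0 g a c r M : taylor1 g a c r M -> c 0%N = g a.
Proof.
case=> r0 _ /(_ a 0); rewrite subrr nm0 mul0r lexx ler01 => /(_ isT isT 1%N).
rewrite big_ord_recl big_ord0 expr0 mulr1 addr0 expr1 mulr0 => h.
apply/esym/eqP; rewrite -subr_eq0; apply/eqP/nm0P/le_anti.
by rewrite h nm_ge0.
Qed.

Lemma taylor1_ge0 g a c r M : taylor1 g a c r M -> 0 <= M.
Proof. by case=> _ /(_ 0%N); rewrite big_ord0. Qed.

Lemma hol1_continuous g a : hol1 g a -> exists r M, 0 < r /\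
  forall x, nm (x - a) <= r -> nm (g x - g a) <= M * nm (x - a).
Proof.
move=> /(taylor1P nm_ge0 nm0)[c [r [M T]]]; have c0 := taylor1_coef0 T.
have [r0 _ k] := T; exists r, (M / r); split => // x hx.
have := k x (nm (x - a) / r); rewrite divrK ?unitfE ?gt_eqF // lexx.
rewrite divr_ge0 ?(ltW r0) // ler_pdivrMr // mul1r hx => /(_ isT isT 1%N).
by rewrite big_ord_recl big_ord0 expr0 mulr1 addr0 expr1 c0 mulrA mulrAC.
Qed.

(** Let c_(m+1) be the first nonzero coefficient after c_0. With z such that c_(m+1) z^(m+1) = g(a),
    a step t z multiplies g(a) by 1 + t^(m+1), up to a remainder of order t^(m+2). For small t this
    exceeds the maximum. *)
Lemma max_principle g a d : hol1 g a -> 0 < d ->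
  (forall x, nm (x - a) < d -> nm (g x) <= nm (g a)) ->
  exists2 e, 0 < e & forall x, nm (x - a) < e -> g x = g a.
Proof.
move=> hg d0 gmax; have [g0|gn0] := eqVneq (g a) 0.
  exists d => // x /gmax; rewrite g0 nm0 => h.
  by apply: nm0P; apply/le_anti; rewrite h nm_ge0.
have /(taylor1P nm_ge0 nm0)[c [r [M T]]] := hg; have c0 := taylor1_coef0 T.
have M0 := taylor1_ge0 T; have [r0 _ k] := T.
case: (boolp.EM (exists m, c m.+1 != 0)) => [hm|nm1']; last first.
  have cz m : c m.+1 = 0.
    by apply/eqP; apply: contraT => h; case: nm1'; exists m.
  exists (r / 2); first exact: divr_gt0.
  move=> x hx; apply/eqP; rewrite -subr_eq0; apply/eqP/nm0P/le_anti.
  rewrite nm_ge0 andbT; pose q := nm (x - a) / r.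
  have q0 : 0 <= q by rewrite divr_ge0 // ltW.
  have q1 : q <= 1 / 2 by rewrite ler_pdivrMr // mul1r mulrC ltW.
  have qle1 : q <= 1 by lra.
  apply: (le0_geometric (M := M) q0 q1) => -[|N].
    rewrite expr0 mulr1.
    have := k x q; rewrite q0 qle1 divrK ?unitfE ?gt_eqF // => /(_ isT (lexx _) 1%N).
    rewrite big_ord_recl big_ord0 expr0 mulr1 addr0 expr1 c0 => h.
    by apply: le_trans h _; rewrite ler_piMr.
  have := k x q; rewrite q0 qle1 divrK ?unitfE ?gt_eqF // => /(_ isT (lexx _) N.+1).
  rewrite big_ord_recl big1 => [|i _]; first by rewrite expr0 mulr1 addr0 c0.
  by rewrite cz mul0r.
case: (ex_minnP hm) => m cm min_m.
have [z hz] := rootK (g a / c m.+1) (ltn0Sn m).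
have z0 : z != 0.
  by apply: contraNneq gn0 => e; move: hz; rewrite e expr0n /= => /esym/eqP; rewrite mulf_eq0 invr_eq0 (negbTE cm) orbF.
have nz : 0 < nm z := nm_gt0 nm_ge0 nm0P z0.
have ng : 0 < nm (g a) := nm_gt0 nm_ge0 nm0P gn0.
pose s := nm z / r; have s0 : 0 < s by exact: divr_gt0.
(* The terms of [D] are the lower bounds needed for 1 / t: the step stays within d and within the
   radius r, and the remainder stays below |g(a)| t^(m+1). *)
pose D := 1 + nm z / d + s + M * s ^+ m.+2 / nm (g a).
have p1 : 0 <= nm z / d by apply: divr_ge0 => //; exact: ltW.
have p2 : 0 <= M * s ^+ m.+2 / nm (g a).
  by apply: divr_ge0 (ltW ng); apply: mulr_ge0 => //; exact/exprn_ge0/ltW.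
have D0 : 0 < D by rewrite /D; move: s0 p1 p2; lra.
pose t := D^-1; have t0 : 0 < t by rewrite invr_gt0.
have tle (y : R) : y < D -> t * y < 1 by move=> h; rewrite mulrC ltr_pdivrMr // mul1r.
have td : t * nm z < d.
  have : t * (nm z / d) < 1 by apply: tle; rewrite /D; move: s0 p1 p2; lra.
  by rewrite mulrA ltr_pdivrMr // mul1r.
have ts : t * s < 1 by apply: tle; rewrite /D; move: s0 p1 p2; lra.
have tM : t * (M * s ^+ m.+2) < nm (g a).
  have : t * (M * s ^+ m.+2 / nm (g a)) < 1 by apply: tle; rewrite /D; move: s0 p1 p2; lra.
  by rewrite mulrA ltr_pdivrMr // mul1r.
pose x := a + iota t * z.
have xa : x - a = iota t * z by rewrite /x addrC addKr.
have nxa : nm (x - a) = t * nm z by rewrite xa nmM nm_iota gtr0_norm.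
have : nm (g x) <= nm (g a) by apply: gmax; rewrite nxa.
have hq : 0 <= t * s <= 1 by apply/andP; split; apply: ltW => //; exact: mulr_gt0.
have := k x (t * s) hq.
rewrite nxa -mulrA divrK ?unitfE ?gt_eqF // lexx => /(_ isT m.+2).
rewrite big_ord_recl big_ord_recr /= big1 => [|i _]; last first.
  rewrite (_ : c _ = 0) ?mul0r //; apply/eqP; apply: contraT => h.
  by have := min_m i h; rewrite leqNgt ltn_ord.
rewrite expr0 mulr1 add0r /bump /= add1n c0 xa exprMn hz mulrCA.
rewrite [c _ * _]mulrC divrK ?unitfE //.
set e := g x - _ => he; move=> hgx.
have ge : g a * (1 + iota t ^+ m.+1) = g x - e.
  by rewrite /e; ring.
have : nm (g a) * (1 + t ^+ m.+1) <= nm (g x) + nm e.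
  have -> : 1 + t ^+ m.+1 = nm (1 + iota t ^+ m.+1).
    have tp : 0 < 1 + t ^+ m.+1 by rewrite ltr_wpDr ?exprn_ge0 // ltW.
    by rewrite -rmorphXn -(rmorph1 iota) -rmorphD nm_iota gtr0_norm.
  by rewrite -nmM ge -(nmN e); exact: nmD.
have tm0 : 0 < t ^+ m.+1 by exact: exprn_gt0.
have : M * (t * s) ^+ m.+2 < nm (g a) * t ^+ m.+1.
  have -> : M * (t * s) ^+ m.+2 = t * (M * s ^+ m.+2) * t ^+ m.+1.
    by rewrite exprMn [t ^+ m.+2]exprS; ring.
  by rewrite ltr_pM2r.
move: he hgx; set u := nm (g x); set v := nm e; set w := M * _; set y := nm (g a).
by rewrite mulrDr mulr1; lra.
Qed.

Lemma hol1_add f g a : hol1 f a -> hol1 g a -> hol1 (fun x => f x + g x) a.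
Proof. exact: hol2_add. Qed.

Lemma hol1_mul f g a : hol1 f a -> hol1 g a -> hol1 (fun x => f x * g x) a.
Proof. exact: hol2_mul. Qed.

Lemma hol1_cst k a : hol1 (fun=> k) a.
Proof. exact: hol2_cst. Qed.

Lemma hol1_ext f g a r : 0 < r -> (forall x, nm (x - a) <= r -> f x = g x) ->
  hol1 f a -> hol1 g a.
Proof. by move=> r0 fg; apply: (hol2_ext nm_ge0 r0) => x y /fg. Qed.

Lemma hol1_horner (p : {poly K}) a : hol1 (horner p) a.
Proof.
elim/poly_ind: p => [|p c IH].
  by apply: (hol1_ext ltr01 _ (hol1_cst 0 a)) => x _; rewrite horner0.
apply: (hol1_ext ltr01 _ (hol1_add (hol1_mul IH (hol1_id nm_ge0 nm0P nm0 nmD nmM a)) (hol1_cst c a))).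
by move=> x _; rewrite hornerMXaddC.
Qed.

(** Subtract the Taylor polynomial of degree n and divide by x^(n+1). The quotient is entire and
    tends to 0 at infinity, so if it is not zero its modulus has a maximum, attained at a point
    farthest from 0. By the maximum principle the quotient is constant near that point, yet some
    nearby points are farther. *)
Theorem liouville_poly f n C L : (forall a, hol1 f a) ->
  (forall x, L <= nm x -> nm (f x) <= C * nm x ^+ n) ->
  exists2 p : {poly K}, (size p <= n.+1)%N & forall x, f x = p.[x].
Proof.
move=> hf growth; have /(taylor1P nm_ge0 nm0)[c [r [M T]]] := hf 0.
pose p := \poly_(j < n.+1) c j.
exists p; first exact: size_poly.
(* The value at 0 is the next Taylor coefficient, which makes [g] holomorphic there. *)
pose g x := if x == 0 then c n.+1 else (f x - p.[x]) / x ^+ n.+1.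
have hpE x : p.[x] = \sum_(j < n.+1) c j * x ^+ j by rewrite horner_poly.
have hfp a : hol1 (fun x => f x - p.[x]) a.
  apply: (hol1_ext ltr01 _ (hol1_add (hf a) (hol1_mul (hol1_cst (-1) a) (hol1_horner p a)))).
  by move=> x _; rewrite mulN1r.
have hg a : hol1 g a.
  have [->|a0] := eqVneq a 0.
    have M0 := taylor1_ge0 T; have [r0 ch k] := T.
    have r1 : 0 < r ^+ n.+1 by exact: exprn_gt0.
    apply/(taylor1P nm_ge0 nm0); exists (fun j => c (n.+1 + j)%N), r, (M / r ^+ n.+1).
    split=> // [N|x q /andP[q0 q1]].
      rewrite ler_pdivlMr // mulr_suml; apply: le_trans (ch (n.+1 + N)%N).
      rewrite big_split_ord /= -[X in X <= _]add0r; apply: lerD.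
        by apply: sumr_ge0 => i _; rewrite mulr_ge0 // exprn_ge0 // ltW.
      by apply: ler_sum => i _; rewrite exprD -mulrA [r ^+ i * _]mulrC.
    rewrite subr0 => hx N; rewrite /g; case: eqVneq => [x0|x0].
      case: N => [|N].
        rewrite big_ord0 subr0 expr0 mulr1 ler_pdivlMr //.
        apply: le_trans (ch n.+2); rewrite big_ord_recr /= lerDr.
        by apply: sumr_ge0 => i _; rewrite mulr_ge0 // exprn_ge0 // ltW.
      rewrite big_ord_recl big1 => [|i _]; last by rewrite x0 expr0n mulr0.
      rewrite expr0 mulr1 addr0 addn0 subrr nm0 mulr_ge0 ?exprn_ge0 //.
      by rewrite divr_ge0 // ltW.
    have nx : 0 < nm x := nm_gt0 nm_ge0 nm0P x0.
    have xn0 : x ^+ n.+1 != 0 by rewrite expf_neq0.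
    have nxr : nm x <= r by apply: le_trans hx _; rewrite ler_piMl // ltW.
    pose q' := nm x / r.
    have q'0 : 0 <= q' by rewrite divr_ge0 ?ltW.
    have q'q : q' <= q by rewrite ler_pdivrMr.
    have := k x q'; rewrite q'0 ler_pdivrMr // mul1r nxr subr0.
    rewrite divrK ?unitfE ?gt_eqF // lexx => /(_ isT isT (n.+1 + N)%N).
    rewrite big_split_ord /= -hpE opprD addrA => h.
    have -> : (f x - p.[x]) / x ^+ n.+1 - \sum_(i < N) c (n.+1 + i)%N * x ^+ i =
        (f x - p.[x] - \sum_(i < N) c (n.+1 + i)%N * x ^+ (n.+1 + i)) / x ^+ n.+1.
      rewrite [in RHS]mulrBl; congr (_ - _); rewrite mulr_suml; apply: eq_bigr => i _.
      by rewrite exprD -mulrA [x ^+ n.+1 * _]mulrC mulfK.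
    rewrite nmM (nm_inv nm0P nm0 nmM) (nmX nm0P nmM) ler_pdivrMr ?exprn_gt0 //.
    apply: le_trans h _.
    have -> : M / r ^+ n.+1 * q ^+ N * nm x ^+ n.+1 = M * (q' ^+ n.+1 * q ^+ N).
      by rewrite /q' expr_div_n; field; rewrite expf_neq0 // gt_eqF.
    apply: ler_wpM2l => //; rewrite exprD; apply: ler_wpM2l; first exact: exprn_ge0.
    by apply: lerXn2r; rewrite ?nnegrE // (le_trans q'0).
  have na : 0 < nm a := nm_gt0 nm_ge0 nm0P a0.
  have h1 : hol1 (fun x => ('X^(n.+1)).[x]) a := hol1_horner 'X^(n.+1) a.
  have n0 : ('X^(n.+1)).[a] != 0 by rewrite hornerXn expf_neq0.
  have h2 := hol1_mul (hfp a) (hol2_inv nm_ge0 nm0P nm0 nmN nmD nmM n0 h1).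
  have na2 : 0 < nm a / 2 by exact: divr_gt0.
  apply: (hol1_ext na2 _ h2) => x hx; rewrite /g hornerXn; case: eqVneq => // x0.
  move: hx; rewrite x0 sub0r nmN => hx; exfalso; move: hx na; lra.
suff g0 x : g x = 0.
  move=> x; have [->|x0] := eqVneq x 0.
    rewrite hpE big_ord_recl big1 => [|i _]; last by rewrite expr0n mulr0.
    by rewrite expr0 mulr1 addr0 (taylor1_coef0 T).
  have := g0 x; rewrite /g (negbTE x0) => /eqP.
  by rewrite mulf_eq0 invr_eq0 expf_eq0 (negbTE x0) andbF orbF subr_eq0 => /eqP.
apply/eqP; apply: contraT => gx0.
have gx : 0 < nm (g x) := nm_gt0 nm_ge0 nm0P gx0.
pose B := \sum_(j < n.+1) nm (c j).
have B0 : 0 <= B by apply: sumr_ge0.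
(* Beyond [L1] the growth hypothesis applies, |p| is at most B |y|^n, and |g| is less than |g(x)|;
   the disc of radius [L1] also contains x. *)
pose L1 := 1 + `|L| + nm x + (`|C| + B) / nm (g x).
have LB : 0 <= (`|C| + B) / nm (g x) by rewrite divr_ge0 // addr_ge0.
have far y : L1 < nm y -> nm (g y) < nm (g x).
  move=> hy; have y1 : 1 < nm y.
    by apply: le_lt_trans hy; rewrite /L1 -!addrA lerDl !addr_ge0.
  have yL : L <= nm y.
    apply: ltW; apply: le_lt_trans hy; apply: le_trans (ler_norm L) _.
    by rewrite /L1; move: (nm_ge0 x) LB; lra.
  have yB : (`|C| + B) / nm (g x) < nm y.
    by apply: le_lt_trans hy; rewrite /L1; move: (nm_ge0 x) (normr_ge0 L); lra.
  have y0 : y != 0 by apply: contraTneq y1 => ->; rewrite nm0 ltr10.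
  rewrite {1}/g (negbTE y0) nmM (nm_inv nm0P nm0 nmM) (nmX nm0P nmM).
  have yp : 0 < nm y by apply: lt_trans y1.
  rewrite ltr_pdivrMr ?exprn_gt0 //.
  apply: (@le_lt_trans _ _ ((`|C| + B) * nm y ^+ n)).
    apply: le_trans (nmD _ _) _; rewrite nmN mulrDl; apply: lerD.
      apply: le_trans (growth _ yL) _; apply: ler_wpM2r; first by rewrite exprn_ge0.
      exact: ler_norm.
    rewrite hpE; apply: le_trans (nm_sum nm0 nmD _ _ _) _; rewrite /B mulr_suml.
    apply: ler_sum => j _; rewrite nmM (nmX nm0P nmM); apply: ler_wpM2l => //.
    by apply: ler_weXn2l; [exact: ltW|rewrite -ltnS].
  rewrite exprS mulrA ltr_pM2r ?exprn_gt0 //.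
  by move: yB; rewrite ltr_pdivrMr // mulrC.
have ucont h : (forall a, hol1 h a) -> forall a e, 0 < e ->
    exists2 d, 0 < d & forall y, nm (y - a) < d -> `|nm (h y) - nm (h a)| < e.
  move=> hh a e e0; have [s [M' [s0 hM]]] := hol1_continuous (hh a).
  exists (Num.min s (e / (`|M'| + 1))).
    by rewrite lt_min s0 divr_gt0 // ltr_wpDl.
  move=> y; rewrite lt_min => /andP[ys ye].
  have : nm (h y - h a) < e.
    apply: le_lt_trans (hM y (ltW ys)) _.
    move: ye; rewrite ltr_pdivlMr ?ltr_wpDl // => ye; apply: le_lt_trans ye.
    rewrite mulrC; apply: ler_wpM2l => //; apply: le_trans (ler_norm _) _.
    by rewrite lerDl.
  apply: le_lt_trans; rewrite ler_norml (nm_sub nmD) andbT lerNl opprB.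
  by rewrite -(opprB (h a)) nmN (nm_sub nmD).
have [a aL amax] : exists2 a, nm a <= L1 & forall y, nm y <= L1 -> nm (g y) <= nm (g a).
  apply: (evt (L := L1)) => //; last exact: ucont.
    exists x; rewrite /L1; move: LB (normr_ge0 L); lra.
  move=> a ha; rewrite leNgt; apply/negP => aL.
  have [|y yL ya] := ha (nm a - L1); first by rewrite subr_gt0.
  have := nm_sub nmD a y; rewrite -(opprB y) nmN; move: yL ya; lra.
have xL : nm x <= L1 by rewrite /L1; move: LB (normr_ge0 L); lra.
have gmax y : nm (g y) <= nm (g a).
  have [yL|yL] := leP (nm y) L1; first exact: amax.
  by apply: le_trans (ltW (far y yL)) _; exact: amax.
have [b gb bmax] : exists2 b, nm (g b) = nm (g a) & forall y, nm (g y) = nm (g a) -> nm y <= nm b.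
  apply: (evt (L := L1)); first by exists a.
  - move=> y ey; rewrite leNgt; apply/negP => /far; rewrite ey; apply/negP.
    by rewrite -leNgt amax.
  - move=> b hb; apply/eqP; rewrite -subr_eq0 -normr_eq0; apply/eqP/le_anti.
    rewrite normr_ge0 andbT leNgt; apply/negP => e0.
    have [dd dd0 hd] := ucont g hg b _ e0.
    by have [y ey yb] := hb dd dd0; have := hd y yb; rewrite ey distrC ltxx.
  - exact: (ucont id (hol1_id nm_ge0 nm0P nm0 nmD nmM)).
have [|e e0 ge] := max_principle (hg b) ltr01; first by move=> y _; rewrite gb.
(* The point [b] is moved radially outwards by half of [e]; at 0 any direction does. *)
have [y yb hy] : exists2 y, nm (y - b) < e & nm b < nm y.
  have [->|b0] := eqVneq b 0.
    exists (iota (e / 2)); first by rewrite subr0 nm_iota gtr0_norm ?divr_gt0 //; move: e0; lra.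
    by rewrite nm0 nm_iota gtr0_norm divr_gt0.
  have nb : 0 < nm b := nm_gt0 nm_ge0 nm0P b0.
  pose t := e / (2 * nm b); have t0 : 0 < t by rewrite divr_gt0 ?mulr_gt0.
  exists (iota (1 + t) * b).
    rewrite rmorphD rmorph1 mulrDl mul1r addrC addKr nmM nm_iota gtr0_norm //.
    by rewrite /t invfM mulrA divfK ?gt_eqF //; move: e0; lra.
  by rewrite nmM nm_iota gtr0_norm ?ltr_pMl ?ltrDl // addr_gt0.
by have := bmax y; rewrite ge // => /(_ gb); rewrite leNgt hy.
Qed.

End Liouville.

End PowerSeries.

From mathcomp Require Import finmap all_classical all_reals all_analysis.
From mathcomp Require mpoly.

Module Foliations.
From mathcomp Require Import complex lra ring zify.
Import (canonicals, coercions) mpoly.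
Import Algebra PowerSeries.
Set Implicit Arguments.
Unset Strict Implicit.
Unset Printing Implicit Defensive.
Import Order.TTheory GRing.Theory Num.Theory.
Import numFieldNormedType.Exports.
Local Open Scope classical_set_scope.
Local Open Scope ring_scope.

(** * Holomorphic functions and power series *)

Section ComplexNorm.
Variable R : realType.
Local Notation C := (complexes R).

(** The norm of [complexes R] takes values in [complexes R] itself; the power series lemmas need a
    real-valued one. *)
Definition rnorm (x : C) : R := complex.Re (`|x| : R[i]).

Definition rincl : R -> C := fun t => (t%:C)%C.
HB.instance Definition _ := GRing.RMorphism.copy rincl (real_complex R).

Lemma rnormE (x : C) : `|x| = rincl (rnorm x).
Proof. by rewrite /rincl /rnorm; apply/esym/RRe_real/normr_real. Qed.

Lemma rincl_le (s t : R) : (rincl s <= rincl t) = (s <= t).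
Proof. exact: lecR. Qed.

Lemma rincl_lt (s t : R) : (rincl s < rincl t) = (s < t).
Proof. exact: ltcR. Qed.

Lemma rincl_inj : injective rincl. Proof. exact: complexI. Qed.

Lemma rincl_gt0 (e : C) : 0 < e -> exists2 t, 0 < t & e = rincl t.
Proof.
move=> e0; have er : e = rincl (complex.Re (e : R[i])).
  by apply/esym/RRe_real; exact: gtr0_real.
by exists (complex.Re (e : R[i])) => //; rewrite -rincl_lt rmorph0 -er.
Qed.

Lemma rnorm_ge0 x : 0 <= rnorm x.
Proof. by rewrite -rincl_le rmorph0 -rnormE. Qed.

Lemma rnorm0P x : rnorm x = 0 -> x = 0.
Proof. by move=> h; apply/eqP; rewrite -normr_eq0 rnormE h rmorph0. Qed.

Lemma rnorm0 : rnorm 0 = 0.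
Proof. by apply: rincl_inj; rewrite -rnormE normr0 rmorph0. Qed.

Lemma rnormN x : rnorm (- x) = rnorm x.
Proof. by rewrite /rnorm normrN. Qed.

Lemma rnormD x y : rnorm (x + y) <= rnorm x + rnorm y.
Proof. by rewrite -rincl_le rmorphD -!rnormE; exact: ler_normD. Qed.

Lemma rnormM x y : rnorm (x * y) = rnorm x * rnorm y.
Proof. by apply: rincl_inj; rewrite rmorphM -!rnormE normrM. Qed.

Lemma rnorm_rincl t : rnorm (rincl t) = `|t|.
Proof.
rewrite /rnorm normc_def /= expr0n addr0 /= sqrtr_sqr //.
Qed.

Lemma archR (x : R) : exists n : nat, x < n%:R.
Proof. by exists (Num.bound `|x|); apply: le_lt_trans (ler_norm x) (archi_boundP _). Qed.

Lemma rootC m (z : C) : (0 < m)%N -> exists x, x ^+ m = z.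
Proof. by move=> m0; exists (m.-root z); exact: rootCK. Qed.

Definition ofrow (v : 'rV[R]_2) : C := (v 0 0 +i* v 0 1)%C.

Lemma rnorm_ofrow v : rnorm (ofrow v) <= `|v 0 0| + `|v 0 1|.
Proof.
have -> : ofrow v = rincl (v 0 0) + (0 +i* 1)%C * rincl (v 0 1).
  rewrite /ofrow /rincl; apply/eqP.
  by rewrite eq_complex /= !(mul0r, mulr0, mul1r, subr0, addr0, add0r) !eqxx.
apply: le_trans (rnormD _ _) _; rewrite rnormM !rnorm_rincl.
by rewrite /rnorm normc_def /= expr0n expr1n add0r sqrtr1 mul1r.
Qed.

Lemma ofrowB v w : ofrow v - ofrow w = ofrow (v - w).
Proof. by rewrite /ofrow; apply/eqP; rewrite eq_complex /= !mxE !eqxx. Qed.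

Lemma norm_coord (v : 'rV[R]_2) (i : 'I_2) : `|v 0 i| <= `|v|.
Proof. by rewrite [leRHS]/Num.Def.normr /= mx_normrE; exact: (le_bigmax _ _ (ord0, i)). Qed.

Lemma rnorm_ofrow_le v : rnorm (ofrow v) <= 2 * `|v|.
Proof.
apply: le_trans (rnorm_ofrow v) _.
by rewrite mulr_natl mulr2n; apply: lerD; exact: norm_coord.
Qed.

Lemma coord_le_rnorm (v : 'rV[R]_2) i : `|v 0 i| <= rnorm (ofrow v).
Proof.
have key (a b : R) : `|a| <= Num.sqrt (a ^+ 2 + b ^+ 2).
  by rewrite -sqrtr_sqr ler_sqrt ?addr_ge0 ?sqr_ge0 // lerDl sqr_ge0.
rewrite /rnorm normc_def /=.
have [->|->] : i = 0 \/ i = 1.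
  by case: i => [[|[|//]] h]; [left|right]; apply: val_inj.
  exact: key.
by rewrite addrC; exact: key.
Qed.

Lemma ofrow_surj (z : C) : exists v, ofrow v = z.
Proof.
case: z => a b; exists (\row_i (if i == 0 then a else b)).
by rewrite /ofrow !mxE.
Qed.

(** Compactness of closed bounded sets is taken from the real plane, through the bijection [ofrow],
    for which the norms are comparable. *)
Lemma evtC (A : C -> Prop) (u : C -> R) (L : R) :
  (exists x, A x) -> (forall x, A x -> rnorm x <= L) ->
  (forall a, (forall e, 0 < e -> exists2 x, A x & rnorm (x - a) < e) -> A a) ->
  (forall a e, 0 < e -> exists2 d, 0 < d & forall x, rnorm (x - a) < d -> `|u x - u a| < e) ->
  exists2 a, A a & forall x, A x -> u x <= u a.
Proof.
move=> [x0 Ax0] AL Acl ucont.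
pose B : set 'rV[R]_2 := [set v | A (ofrow v)].
have B0 : B !=set0.
  by have [v ev] := ofrow_surj x0; exists v; rewrite /B /= ev.
have Bb : bounded_set B.
  exists L; split; first exact: num_real.
  move=> M LM v Bv; rewrite /= [leLHS]/Num.Def.normr /= mx_normrE; apply: bigmax_le.
    by apply: le_trans (ltW LM); exact: le_trans (rnorm_ge0 _) (AL _ Bv).
  move=> [i j] _ /=; rewrite (ord1 i).
  by apply: le_trans (coord_le_rnorm _ _) _; apply: le_trans (AL _ Bv) (ltW LM).
have Bc : closed B.
  move=> v hv; apply: Acl => e e0.
  have e20 : 0 < e / 2 by rewrite divr_gt0.
  have /hv[w [Bw hw]] : nbhs v (ball v (e / 2)) by exact: nbhsx_ballx.
  exists (ofrow w) => //; rewrite ofrowB.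
  apply: le_lt_trans (rnorm_ofrow_le _) _.
  by move: hw; rewrite -ball_normE /= distrC => hw; move: hw; lra.
have ucont' : continuous (u \o ofrow).
  move=> v; apply/(@cvgrPdist_lt _ _ _ (nbhs v) (nbhs_filter v)) => e e0.
  have [d d0 hd] := ucont (ofrow v) e e0.
  have d20 : 0 < d / 2 by rewrite divr_gt0.
  have hb : nbhs v (ball v (d / 2)) by exact: nbhsx_ballx.
  apply: (@filterS _ (nbhs v) (nbhs_filter v) _ _ _ hb) => w.
  rewrite -ball_normE /= distrC => hw.
  rewrite distrC; apply: hd; rewrite ofrowB.
  by apply: le_lt_trans (rnorm_ofrow_le _) _; move: hw; lra.
have [v Bv vmax] := compact_EVT_max B0 (bounded_closed_compact Bb Bc)
  (continuous_subspaceT ucont').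
exists (ofrow v); first by move: Bv; rewrite inE.
move=> x Ax; have [w ew] := ofrow_surj x; rewrite -ew; apply: vmax.
by rewrite inE /B /= ew.
Qed.

End ComplexNorm.

Section Holomorphic.
Variable R : realType.
Local Notation C := (complexes R).
Local Notation rnorm := (@rnorm R).
Local Notation rincl := (@rincl R).

Definition row2 (x y : C) : 'rV[C]_2 := \row_l (if l == 0 then x else y).

Lemma row2_0 x y : row2 x y 0 0 = x. Proof. by rewrite mxE. Qed.
Lemma row2_1 x y : row2 x y 0 1 = y. Proof. by rewrite mxE. Qed.

Lemma row2E (w : 'rV[C]_2) : row2 (w 0 0) (w 0 1) = w.
Proof.
apply/rowP => l; rewrite mxE.
by case: l => [[|[|//]] h]; congr (w 0 _); apply: val_inj.
Qed.

Lemma forall_ord2 (P : 'I_2 -> Prop) : P 0 -> P 1 -> forall l, P l.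
Proof.
move=> p0 p1 [[|[|//]] h].
  by rewrite (_ : Ordinal h = 0) //; apply: val_inj.
by rewrite (_ : Ordinal h = 1) //; apply: val_inj.
Qed.

Lemma ball_rnorm (x y : C) (e : R) : ball x (rincl e) y <-> rnorm (x - y) < e.
Proof. by rewrite -ball_normE /= rnormE rincl_lt. Qed.

Lemma ball_row (a w : 'rV[C]_2) (e : R) : 0 < e ->
  ball a (rincl e) w <-> forall l, rnorm (w 0 l - a 0 l) < e.
Proof.
move=> e0; split=> [h l|h].
  have h' : forall i j, ball (a i j) (rincl e) (w i j) by case: h.
  by have /ball_rnorm := h' 0 l; rewrite -(opprB (w 0 l)) rnormN.
suff h' : forall i j, ball (a i j) (rincl e) (w i j).
  by split => //; rewrite -(rmorph0 rincl) rincl_lt.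
move=> i l; rewrite (ord1 i); apply/ball_rnorm.
by rewrite -(opprB (w 0 l)) rnormN.
Qed.

Lemma nbhs_row (a : 'rV[C]_2) (P : set 'rV[C]_2) :
  nbhs a P <-> exists2 e : R, 0 < e & forall w : 'rV[C]_2, (forall l, rnorm (w 0 l - a 0 l) < e) -> P w.
Proof.
split=> [/nbhs_ballP[e /= e0 he]|[e e0 he]].
  have [t t0 et] := rincl_gt0 e0; exists t => // w hw; apply: he.
  by rewrite et; apply/ball_row.
have e0' : 0 < rincl e by rewrite -(rmorph0 rincl) rincl_lt.
apply/nbhs_ballP; exists (rincl e) => //= w /(ball_row _ _ e0); exact: he.
Qed.

Local Notation hol2 := (hol2 rnorm).
Local Notation term2 := (@term2 C).

Lemma term2_norm c x y m n : `|term2 c x y m n| = rincl (rnorm (c m n) * rnorm x ^+ m * rnorm y ^+ n).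
Proof. by rewrite /PowerSeries.term2 !normrM !normrX !rnormE !rmorphM !rmorphXn. Qed.

(** Absolute convergence at one corner of a polydisc bounds [abs2]; the geometric bound for the
    remainders follows from [sum2_tail] by passing to the limit. *)
Lemma holomorphic_hol2 (f : 'rV[C]_2 -> C) a : holomorphic_at f a ->
  hol2 (fun x y => f (row2 x y)) (a 0 0) (a 0 1).
Proof.
move=> [c /nbhs_row[e e0 he]].
have [r [r0 re]] : exists r, 0 < r /\ r < e.
  by exists (e / 2); rewrite divr_gt0 //; split => //; move: e0; lra.
have near_r x y : rnorm (x - a 0 0) <= r -> rnorm (y - a 0 1) <= r ->
    forall l, rnorm (row2 x y 0 l - a 0 l) < e.
  by move=> hx hy; apply: forall_ord2; rewrite ?row2_0 ?row2_1; exact: le_lt_trans re.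
have rr : rnorm (rincl r) = r by rewrite rnorm_rincl gtr0_norm.
(* Both coordinates are shifted by the real number r, so the absolute values of the terms are |c_mn|
   r^(m+n). *)
have [|[M hM] _] := he (row2 (a 0 0 + rincl r) (a 0 1 + rincl r)).
  by apply: near_r; rewrite addrC addKr rr.
have M0 : 0 <= M by have := hM 0%N; rewrite big_ord0.
have [M' eM] : exists M', M = rincl M'.
  by exists (complex.Re (M : R[i])); apply/esym/RRe_real/ger0_real.
have absM N : abs2 rnorm c r N <= M'.
  rewrite -rincl_le -eM; apply: le_trans (hM N).
  rewrite /abs2 /sum2 rmorph_sum; apply: ler_sum => m _.
  rewrite rmorph_sum; apply: ler_sum => n _.
  have cancel_r z : z + rincl r - z = rincl r by rewrite addrC addKr.
  rewrite row2_0 row2_1 !cancel_r !normrM !normrX !rnormE rr exprD mulrA.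
  by rewrite !rmorphM !rmorphXn.
exists c, r, M'; split => // x y q hq hx hy N.
have [q0 q1] := andP hq.
have hx' : rnorm (x - a 0 0) <= r by apply: le_trans hx _; rewrite ler_piMl // ltW.
have hy' : rnorm (y - a 0 1) <= r by apply: le_trans hy _; rewrite ler_piMl // ltW.
have [_] := he _ (near_r _ _ hx' hy').
set T := (X in X @ \oo --> _); move=> Tf.
have TE K : T K = sum2 K (term2 c (x - a 0 0) (y - a 0 1)).
  by rewrite /T row2_0 row2_1.
apply/ler_addgt0Pr => eps eps0.
have eps0' : 0 < rincl eps by rewrite -(rmorph0 rincl) rincl_lt.
have /cvgrPdist_lt/(_ _ eps0')[K _ hK] := Tf.
have /= := hK (maxn K N) (leq_maxl _ _); rewrite rnormE rincl_lt TE => h1.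
have h2 := sum2_tail (@rnorm_ge0 R) (@rnorm0P R) (@rnorm0 R) (@rnormD R) (@rnormM R)
  c (leq_maxr K N) (ltW r0) hq hx hy.
rewrite -(subrKA (sum2 (maxn K N) (term2 c (x - a 0 0) (y - a 0 1)))) addrC.
apply: le_trans (rnormD _ _) _; apply: lerD; last exact: ltW.
apply: le_trans h2 _; apply: ler_wpM2r; last exact: absM.
exact: exprn_ge0.
Qed.

(** On half of the radius the remainders are at most M / 2^N, whence convergence. *)
Lemma hol2_holomorphic (f : 'rV[C]_2 -> C) (a : 'rV[C]_2) :
  hol2 (fun x y => f (row2 x y)) (a 0 0) (a 0 1) -> holomorphic_at f a.
Proof.
move=> [c [r [M T]]]; have M0 := taylor2_ge0 T; have [r0 hM hT] := T.
exists c; apply/nbhs_row; exists (r / 2); first by rewrite divr_gt0.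
move=> w hw; have h0 := hw 0; have h1 := hw 1.
have h2 l : rnorm (w 0 l - a 0 l) <= r.
  by apply: le_trans (ltW (hw l)) _; move: r0; lra.
split.
  exists (rincl M) => N; apply: (@le_trans _ _ (rincl (abs2 rnorm c r N))); last first.
    by rewrite rincl_le.
  rewrite /abs2 /sum2 rmorph_sum; apply: ler_sum => m _.
  rewrite rmorph_sum; apply: ler_sum => n _.
  rewrite -/(term2 c _ _ m n) term2_norm rincl_le -mulrA exprD.
  apply: ler_wpM2l; first exact: rnorm_ge0.
  have hp (z : C) t : rnorm z <= r -> rnorm z ^+ t <= r ^+ t.
    by move=> hz; apply: lerXn2r; rewrite ?nnegrE ?rnorm_ge0 // ltW.
  by apply: ler_pM; rewrite ?exprn_ge0 ?rnorm_ge0 ?hp.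
apply/cvgrPdist_lt => e /rincl_gt0[e' e0 ->].
have [K hK] := archR (M / e').
exists K => // N /= KN; rewrite rnormE rincl_lt.
have q01 : 0 <= 1 / 2 :> R by lra.
have := hT (w 0 0) (w 0 1) (1 / 2); rewrite q01 (_ : 1 / 2 <= 1 :> R) ?row2E; last by lra.
have -> : 1 / 2 * r = r / 2 by rewrite mul1r mulrC.
move=> /(_ isT).
move=> /(_ (ltW h0) (ltW h1) N) hh.
suff small : M * (1 / 2) ^+ N < e' by exact: (@le_lt_trans _ R _ _ _ hh small).
have KN' : M / e' < (2 ^ N)%:R.
  apply: lt_le_trans hK _; rewrite ler_nat; apply: leq_trans KN _.
  by apply: ltnW; exact: ltn_expl.
rewrite div1r exprVn ltr_pdivrMr ?exprn_gt0 // mulrC.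
by move: KN'; rewrite ltr_pdivrMr // natrX.
Qed.

End Holomorphic.

(** * Charts of the projective plane *)

Section Charts.
Variable R : realType.
Local Notation C := (complexes R).
Implicit Types (i j : 'I_3) (w v : 'rV[C]_2) (x : 'rV[C]_3).

(* The differential of [homc i]. *)
Definition dhomc i v : 'rV[C]_3 := \row_j (if unlift i j is Some j' then v 0 j' else 0).

Definition aff i x : 'rV[C]_2 := \row_l (x 0 (lift i l) / x 0 i).

Lemma homc_i i w : homc i w 0 i = 1.
Proof. by rewrite mxE unlift_none. Qed.

Lemma homc_lift i w l : homc i w 0 (lift i l) = w 0 l.
Proof. by rewrite mxE liftK. Qed.

Lemma dhomc_i i v : dhomc i v 0 i = 0.
Proof. by rewrite mxE unlift_none. Qed.

Lemma dhomc_lift i v l : dhomc i v 0 (lift i l) = v 0 l.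
Proof. by rewrite mxE liftK. Qed.

Lemma dhomcZ i (c : C) v : dhomc i (c *: v) = c *: dhomc i v.
Proof. by apply/rowP => j; rewrite !mxE; case: unlift => [l|]; rewrite ?mxE ?mulr0. Qed.

Lemma homcD i (h : C) v w : homc i (h *: v + w) = h *: dhomc i v + homc i w.
Proof.
by apply/rowP => j; rewrite !mxE; case: unlift => [l|]; rewrite ?mxE // mulr0 add0r.
Qed.

Lemma homc_aff i x : x 0 i != 0 -> homc i (aff i x) = (x 0 i)^-1 *: x.
Proof.
move=> xi; apply/rowP => j; rewrite !mxE; case: unliftP => [l ->|->].
  by rewrite mxE mulrC.
by rewrite mulVf.
Qed.

Lemma aff_homc i w : aff i (homc i w) = w.
Proof. by apply/rowP => l; rewrite mxE homc_i homc_lift divr1. Qed.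

Lemma aff_scale i (c : C) x : c != 0 -> aff i (c *: x) = aff i x.
Proof. by move=> c0; apply/rowP => l; rewrite !mxE -mulf_div divff // mul1r. Qed.

Lemma transition_aff i j w : transition i j w = aff j (homc i w).
Proof. by []. Qed.

Lemma chart_scale i j w w' (c : C) : c != 0 -> homc i w = c *: homc j w' ->
  chart i w = chart j w'.
Proof.
move=> c0 e; apply: val_inj => /=; apply/eqP; rewrite e.
rewrite eqEsubv; apply/andP; split; rewrite -memvE.
  by rewrite memvZ // memv_line.
by apply/vlineP; exists c^-1; rewrite scalerA mulVf // scale1r.
Qed.

Lemma chart_transition i j w : homc i w 0 j != 0 ->
  chart j (transition i j w) = chart i w.
Proof.
move=> hj; apply: (@chart_scale _ _ _ _ (homc i w 0 j)^-1); first by rewrite invr_eq0.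
exact: homc_aff.
Qed.

Lemma hcoord_chart i w : exists2 c : C, c != 0 & hcoord (chart i w) = c *: homc i w.
Proof.
have /vlineP[c e] : vpick <[homc i w]>%VS \in <[homc i w]>%VS by exact: memv_pick.
exists c => //; apply/eqP => c0; have := vpick0 <[homc i w]>%VS.
rewrite e c0 scale0r eqxx => /esym/eqP h.
by have := dim_homc i w; rewrite h dimv0.
Qed.

Lemma chart_dom_chart i w : chart_dom i (chart i w).
Proof.
have [c c0 e] := hcoord_chart i w; rewrite /chart_dom /= e mxE homc_i mulr1.
exact: c0.
Qed.

Lemma chart_dom_transition i j w : homc i w 0 j != 0 -> chart_dom j (chart i w).
Proof. by move=> /chart_transition <-; exact: chart_dom_chart. Qed.

Lemma twist_chart m i j w : twist_cocycle m i j (chart i w) = homc i w 0 j ^ m.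
Proof.
have [c c0 e] := hcoord_chart i w.
by rewrite /twist_cocycle e !mxE unlift_none mulr1 mulrAC divff // mul1r.
Qed.

End Charts.

(** * Derivatives of chart changes and of local equations *)

Section Derivatives.
Variable R : realType.
Local Notation C := (complexes R).
Implicit Types (i j : 'I_3) (w v : 'rV[C]_2).

Lemma derive_quotient (V W : normedModType C) (f : V -> W) (a v : V) (g : C -> W) :
  (\forall h \near 0^', h^-1 *: (f (h *: v + a) - f a) = g h) ->
  {for 0, continuous g} -> is_derive a v f (g 0).
Proof.
move=> fg gc.
have h : h^-1 *: ((f \o shift a) (h *: v) - f a) @[h --> 0^'] --> g 0.
  apply: cvg_trans; last exact: (continuous_withinNx g 0).1 gc.
  by apply: near_eq_cvg; apply: filterS fg => h /=.
apply: DeriveDef; last exact: cvg_lim h.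
by apply/cvg_ex; exists (g 0).
Qed.

Lemma cvg_affine (a b : C) : (a + h * b) @[h --> (0 : C)] --> a + 0 * b.
Proof.
have h1 : {for (0 : C), continuous (fun h : C => h * b)}.
  exact: mulrr_continuous.
have h0 : {for (0 : C), continuous (fun h : C => a)} by exact: cst_continuous.
exact: (continuousD h0 h1).
Qed.

Lemma derive_transition i j w v : homc i w 0 j != 0 ->
  'D_v (transition i j) w = \row_l
   ((dhomc i v 0 (lift j l) * homc i w 0 j - homc i w 0 (lift j l) * dhomc i v 0 j)
      / homc i w 0 j ^+ 2).
Proof.
move=> hj; set hx := homc i w in hj *; set dv := dhomc i v.
pose U : 'rV[C]_2 := \row_l ((dv 0 (lift j l) * hx 0 j - hx 0 (lift j l) * dv 0 j) / hx 0 j).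
pose g (h : C) := (hx 0 j + h * dv 0 j)^-1 *: U.
have hc : (hx 0 j + h * dv 0 j) @[h --> (0 : C)] --> hx 0 j + 0 * dv 0 j.
  exact: cvg_affine.
have n0 : hx 0 j + 0 * dv 0 j != 0 by rewrite mul0r addr0.
have gc : {for 0, continuous g} by exact: (cvgZr_tmp (cvgV n0 hc)).
have hd : is_derive w v (transition i j) (g 0).
  apply: derive_quotient gc.
  have nz : \forall h \near 0^', hx 0 j + h * dv 0 j != 0.
    by apply: nbhs_dnbhs; exact: (cvgr_neq0 _ hc).
  near=> h; have hn0 : h != 0 by near: h; exact: nbhs_dnbhs_neq.
  have hz : hx 0 j + h * dv 0 j != 0 by near: h.
  have eh : homc i (h *: v + w) = h *: dv + hx by exact: homcD.
  rewrite /transition eh -/hx; apply/rowP => l; rewrite /g; clearbody dv hx; rewrite !mxE.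
  by rewrite [h * dv 0 j + _]addrC; field; rewrite hn0 hj hz.
rewrite derive_val; apply/rowP => l; rewrite /g /U; clear - hj; clearbody dv hx; rewrite !mxE mul0r addr0.
by field.
Unshelve. all: by end_near. Qed.

Lemma is_derive_homc i w v (j : 'I_3) : is_derive w v (fun w => homc i w 0 j) (dhomc i v 0 j).
Proof.
apply: (@derive_quotient _ _ _ _ _ (fun=> dhomc i v 0 j)); last exact: cst_continuous.
near=> h; have hn0 : h != 0 by near: h; exact: nbhs_dnbhs_neq.
rewrite homcD mxE addrK mxE scalerA mulVf // scale1r //.
Unshelve. all: by end_near. Qed.

Lemma is_derive_local (f : mpoly.mpoly 3 C) i w v :
  is_derive w v (local_equation f i)
   (\sum_j dhomc i v 0 j * mpoly.meval (fun j => homc i w 0 j) (mpoly.mderiv j f)).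
Proof.
elim/mpoly_ring_ind: f => [c|j|p q IHp IHq|p q IHp IHq].
- have -> : local_equation (mpoly.mpolyC 3 c) i = fun=> c.
    by apply: boolp.funext => x; rewrite /local_equation mpoly.mevalC.
  apply: (is_derive_eq (is_derive_cst _ _ _)).
  by rewrite big1 // => j _; rewrite mpoly.mderivC mpoly.meval0 mulr0.
- have -> : local_equation (mpoly.mpolyX C (mpoly.mnm1 j)) i = fun x => homc i x 0 j.
    by apply: boolp.funext => x; rewrite /local_equation mpoly.mevalXU.
  apply: (is_derive_eq (is_derive_homc _ _ _ _)).
  rewrite (bigD1 j) //= big1 ?addr0.
    by rewrite mderivXU eqxx mpoly.meval1 mulr1.
  by move=> l lj; rewrite mderivXU eq_sym (negbTE lj) mpoly.meval0 mulr0.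
- have -> : local_equation (p + q) i = local_equation p i \+ local_equation q i.
    by apply: boolp.funext => x; rewrite /local_equation mpoly.mevalD.
  apply: (is_derive_eq (is_deriveD IHp IHq)).
  by rewrite -big_split; apply: eq_bigr => j _; rewrite linearD mpoly.mevalD mulrDr.
- have -> : local_equation (p * q) i = local_equation p i \* local_equation q i.
    by apply: boolp.funext => x; rewrite /local_equation mpoly.mevalM.
  apply: (is_derive_eq (is_deriveM IHp IHq)).
  rewrite !scaler_sumr -big_split; apply: eq_bigr => j _ /=.
  rewrite mpoly.mderivM mpoly.mevalD !mpoly.mevalM /local_equation.
  by rewrite /GRing.scale /=; ring.
Qed.

End Derivatives.

(** * Operations on holomorphic functions *)

Section HolomorphicClosure.
Variable R : realType.
Local Notation C := (complexes R).
Local Notation rnorm := (@rnorm R).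
Local Notation hol2 := (hol2 rnorm).
Implicit Types (f g : 'rV[C]_2 -> C) (a : 'rV[C]_2).

Lemma holomorphic_near f g a : (\forall w \near a, f w = g w) ->
  holomorphic_at f a -> holomorphic_at g a.
Proof.
move=> /nbhs_row[e e0 he] fa; apply: hol2_holomorphic.
have e2 : 0 < e / 2 by rewrite divr_gt0.
apply: (hol2_ext (@rnorm_ge0 R) e2 _ (holomorphic_hol2 fa)) => x y hx hy.
apply: he; apply: forall_ord2; rewrite ?row2_0 ?row2_1.
  by apply: le_lt_trans hx _; move: e0; lra.
by apply: le_lt_trans hy _; move: e0; lra.
Qed.

Lemma holomorphic_cst (c : C) a : holomorphic_at (fun=> c) a.
Proof. exact/hol2_holomorphic/(hol2_cst (@rnorm_ge0 R) (@rnorm0 R)). Qed.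

Lemma holomorphic_add f g a : holomorphic_at f a -> holomorphic_at g a ->
  holomorphic_at (fun w => f w + g w) a.
Proof.
move=> fa ga; apply: hol2_holomorphic.
exact: (hol2_add (@rnorm_ge0 R) (@rnormD R) (holomorphic_hol2 fa) (holomorphic_hol2 ga)).
Qed.

Lemma holomorphic_mul f g a : holomorphic_at f a -> holomorphic_at g a ->
  holomorphic_at (fun w => f w * g w) a.
Proof.
move=> fa ga; apply: hol2_holomorphic.
exact: (hol2_mul (@rnorm_ge0 R) (@rnorm0P R) (@rnorm0 R) (@rnormD R) (@rnormM R)
  (holomorphic_hol2 fa) (holomorphic_hol2 ga)).
Qed.

Lemma holomorphic_inv f a : f a != 0 -> holomorphic_at f a ->
  holomorphic_at (fun w => (f w)^-1) a.
Proof.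
move=> f0 fa; apply: hol2_holomorphic.
have := @hol2_inv R C rnorm; move=> h.
apply: (h _ _ _ _ _ _ (fun x y => f (row2 x y))); rewrite ?row2E //.
all: first [exact: rnorm_ge0|exact: rnorm0P|exact: rnorm0|exact: rnormN|exact: rnormD|exact: rnormM|exact: holomorphic_hol2].
Qed.

Lemma holomorphic_coord (l : 'I_2) a : holomorphic_at (fun w => w 0 l) a.
Proof.
apply: hol2_holomorphic; move: l; apply: forall_ord2.
  apply: (hol2_ext (@rnorm_ge0 R) (@ltr01 R)); last first.
    exact: (hol2_fst (@rnorm_ge0 R) (@rnorm0P R) (@rnorm0 R) (@rnormD R) (@rnormM R)).
  by move=> x y _ _ /=; rewrite row2_0.
apply: (hol2_ext (@rnorm_ge0 R) (@ltr01 R)); last first.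
  exact: (hol2_snd (@rnorm_ge0 R) (@rnorm0P R) (@rnorm0 R) (@rnormD R) (@rnormM R)).
by move=> x y _ _ /=; rewrite row2_1.
Qed.

Lemma holomorphic_homc i j a : holomorphic_at (fun w => homc i w 0 j) a.
Proof.
case: (unliftP i j) => [l|] ->.
  apply: (holomorphic_near _ (holomorphic_coord l a)); near=> w.
  by rewrite homc_lift.
apply: (holomorphic_near _ (holomorphic_cst 1 a)); near=> w.
by rewrite homc_i.
Unshelve. all: by end_near. Qed.

Lemma holomorphic_local (f : mpoly.mpoly 3 C) i a : holomorphic_at (local_equation f i) a.
Proof.
elim/mpoly_ring_ind: f => [c|j|p q IHp IHq|p q IHp IHq].
- apply: (holomorphic_near _ (holomorphic_cst c a)); near=> w.
  by rewrite /local_equation mpoly.mevalC.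
- apply: (holomorphic_near _ (holomorphic_homc i j a)); near=> w.
  by rewrite /local_equation mpoly.mevalXU.
- apply: (holomorphic_near _ (holomorphic_add IHp IHq)); near=> w.
  by rewrite /local_equation mpoly.mevalD.
- apply: (holomorphic_near _ (holomorphic_mul IHp IHq)); near=> w.
  by rewrite /local_equation mpoly.mevalM.
Unshelve. all: by end_near. Qed.

End HolomorphicClosure.

(** * Sections of O(e) *)

Section Sections.
Variables (R : realType).
Local Notation C := (complexes R).
Local Notation rnorm := (@rnorm R).

Lemma char0C j : j.+1%:R != 0 :> C.
Proof. by rewrite pnatr_eq0. Qed.

(* The sections of O(e), in the frames given by the powers of the coordinates. *)
Definition twisted_section (e : nat) (P : 'I_3 -> 'rV[C]_2 -> C) :=
  (forall i w, holomorphic_at (P i) w) /\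
  (forall i j w, homc i w 0 j != 0 -> P i w = homc i w 0 j ^+ e * P j (transition i j w)).

Definition upd n (w : 'rV[C]_n) (l : 'I_n) (t : C) : 'rV[C]_n :=
  \row_m (if m == l then t else w 0 m).

Lemma upd_id n (w : 'rV[C]_n) l : upd w l (w 0 l) = w.
Proof. by apply/rowP => m; rewrite mxE; case: eqP => [->|]. Qed.

Lemma holomorphic_line (G : 'rV[C]_2 -> C) (w : 'rV[C]_2) l a :
  (forall w, holomorphic_at G w) -> hol1 rnorm (fun t => G (upd w l t)) a.
Proof.
move=> hG; move: l; apply: forall_ord2.
  have h := holomorphic_hol2 (hG (row2 a (w 0 1))); rewrite row2_0 row2_1 in h.
  apply: (hol1_ext (@rnorm_ge0 R) (@ltr01 R)) (hol2_line (@rnorm_ge0 R) (@rnorm0 R) h).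
  move=> x _; congr G; apply/rowP; apply: forall_ord2; rewrite !mxE //.
have h := holomorphic_hol2 (hG (row2 (w 0 0) a)); rewrite row2_0 row2_1 in h.
apply: (hol1_ext (@rnorm_ge0 R) (@ltr01 R)) (hol2_line (@rnorm_ge0 R) (@rnorm0 R) (hol2_swap h)).
by move=> x _; congr G; apply/rowP; apply: forall_ord2; rewrite !mxE.
Qed.

Variables (e : nat) (P : 'I_3 -> 'rV[C]_2 -> C).
Hypothesis secP : twisted_section e P.

Lemma homc_upd i l w t m : lift i l != m -> homc i (upd w l t) 0 m = homc i w 0 m.
Proof.
move=> h; rewrite !mxE; case: unliftP => // j em; rewrite mxE.
by case: eqP => // ej; rewrite em ej eqxx in h.
Qed.

(** As t grows, the point of the line tends to the origin of the chart [lift i l], where the section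
    is bounded. The transition law multiplies by t^e, so the section grows at most like |t|^e and
    Liouville applies. *)
Lemma section_line i l w : exists2 p : {poly C}, (size p <= e.+1)%N &
  forall t, P i (upd w l t) = p.[t].
Proof.
have [holP lawP] := secP; set c := lift i l.
have [r [M [r0 hM]]] := hol2_bounded (holomorphic_hol2 (holP c 0)).
(* [B] bounds the homogeneous coordinates that stay fixed on the line; for |t| at least B / r, their
   quotients by t lie in the polydisc of radius r. *)
pose B : R := 1 + rnorm (w 0 0) + rnorm (w 0 1).
have Bw m : lift i l != m -> rnorm (homc i w 0 m) <= B.
  move=> _; have g0 := rnorm_ge0 (w 0 0); have g1 := rnorm_ge0 (w 0 1).
  case: (unliftP i m) => [j ->|->].
    rewrite homc_lift; move: j; apply: forall_ord2; rewrite /B; lra.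
  by rewrite homc_i -(rmorph1 (@rincl R)) rnorm_rincl normr1 /B; lra.
have B1 : 1 <= B.
  by have g0 := rnorm_ge0 (w 0 0); have g1 := rnorm_ge0 (w 0 1); rewrite /B; lra.
clearbody B; have Br : 0 < B / r by rewrite divr_gt0 //; lra.
have := @liouville_poly R C rnorm (@rnorm_ge0 R) (@rnorm0P R) (@rnorm0 R) (@rnormN R)
  (@rnormD R) (@rnormM R) (@archR R) (@rincl R) (@rnorm_rincl R) (@rootC R) (@evtC R)
  (fun t => P i (upd w l t)) e M (B / r).
apply; first by move=> a; exact: holomorphic_line.
move=> t ht; have t0 : 0 < rnorm t by exact: lt_le_trans ht.
have tn0 : t != 0 by apply: contraTneq t0 => ->; rewrite rnorm0 ltxx.
have ct : homc i (upd w l t) 0 c = t by rewrite homc_lift mxE eqxx.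
rewrite (lawP i c) ct // rnormM mulrC.
have -> : rnorm (t ^+ e) = rnorm t ^+ e.
  elim: (e) => [|n IH]; last by rewrite !exprS rnormM IH.
  by rewrite !expr0 -(rmorph1 (@rincl R)) rnorm_rincl normr1.
apply: ler_wpM2r; first by rewrite exprn_ge0 // rnorm_ge0.
have small m : rnorm (transition i c (upd w l t) 0 m - 0) <= r.
  rewrite subr0 mxE ct homc_upd ?neq_lift // rnormM.
  have et : rnorm t^-1 = (rnorm t)^-1.
    apply: (mulfI (lt0r_neq0 t0)); rewrite -rnormM mulfV // divff ?lt0r_neq0 //.
    by rewrite -(rmorph1 (@rincl R)) rnorm_rincl normr1.
  rewrite et ler_pdivrMr //; apply: le_trans (Bw _ (neq_lift _ _)) _.
  by rewrite mulrC -ler_pdivrMr.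
have := hM (transition i c (upd w l t) 0 0) (transition i c (upd w l t) 0 1).
by rewrite row2E !mxE; apply; [have := small 0|have := small 1]; rewrite !mxE.
Qed.

(** A polynomial on a coordinate line that vanishes off the origin vanishes everywhere; this is
    applied to the two affine coordinates in turn. *)
Lemma section_eq0 : (forall i w, (forall j, homc i w 0 j != 0) -> P i w = 0) ->
  forall i w, P i w = 0.
Proof.
move=> P0 i.
have key l w : (forall t, t != 0 -> P i (upd w l t) = 0) -> P i w = 0.
  move=> h; have [p _ hp] := section_line i l w.
  have p0 : p = 0.
    by apply: (poly_zero_nonzero char0C) => t t0; rewrite -hp h.
  by have := hp (w 0 l); rewrite upd_id p0 horner0.
move=> w; apply: (key 0) => s s0; apply: (key 1) => t t0; apply: P0 => j.
case: (unliftP i j) => [m|] ->; last by rewrite homc_i oner_neq0.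
by rewrite homc_lift; move: m; apply: forall_ord2; rewrite !mxE.
Qed.

(** The homogeneous function of degree [e] on C^3 defined by the section, read in the chart 0 and
    thus meaningful where x_0 is nonzero. *)
Definition torus_value (v : 'rV[C]_3) : C := v 0 0 ^+ e * P 0 (aff 0 v).

Lemma torus_valueE i (v : 'rV[C]_3) : v 0 0 != 0 -> v 0 i != 0 ->
  torus_value v = v 0 i ^+ e * P i (aff i v).
Proof.
have [_ lawP] := secP => v0 vi.
have h0 : homc i (aff i v) 0 0 = v 0 0 / v 0 i by rewrite homc_aff // mxE mulrC.
rewrite (lawP i 0) h0 ?mulf_neq0 ?invr_eq0 // mulrA -exprMn mulrCA divff // mulr1.
by rewrite transition_aff homc_aff // aff_scale // invr_eq0.
Qed.

(** Read in a chart i other than c, changing the coordinate c alone moves the point along a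
    coordinate line of that chart, where [section_line] applies. *)
Lemma torus_value_line c (v : 'rV[C]_3) : (forall i, v 0 i != 0) ->
  exists2 p : {poly C}, (size p <= e.+1)%N &
    forall x, x != 0 -> torus_value (upd v c x) = p.[x].
Proof.
move=> v0.
have [i ic] : exists i : 'I_3, i != c.
  by case: (eqVneq c 0) => [->|h]; [exists 1|exists 0; rewrite eq_sym].
case: (unliftP i c) => [l ec|ec]; last by rewrite ec eqxx in ic.
have [p sp hp] := section_line i l (aff i v).
exists (v 0 i ^+ e *: (p \Po ((v 0 i)^-1 *: 'X))).
  apply: leq_trans (size_scale_leq _ _) _; apply: leq_trans (size_comp_poly_leq _ _) _.
  set b := (v 0 i)^-1; rewrite ltnS; have : (size (b *: 'X : {poly C}) <= 2)%N.
    by apply: leq_trans (size_scale_leq _ _) _; rewrite size_polyX.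
  move=> hs; have hs1 : ((size (b *: 'X : {poly C})).-1 <= 1)%N by rewrite -subn1 leq_subLR.
  apply: leq_trans (leq_mul (leqnn _) hs1) _.
  by rewrite muln1 -subn1 leq_subLR.
move=> x x0; have ux (j : 'I_3) : upd v c x 0 j != 0 by rewrite mxE; case: (j =P c) => _; [exact: x0|exact: v0].
rewrite (torus_valueE (ux 0) (ux i)) mxE (negbTE ic).
rewrite hornerZ horner_comp hornerZ hornerX -hp; congr (_ * P i _).
apply/rowP => m; rewrite !mxE (negbTE ic) ec (inj_eq lift_inj).
by case: eqP => // _; rewrite mulrC.
Qed.

Lemma torus_valueZ t (v : 'rV[C]_3) : t != 0 -> torus_value (t *: v) = t ^+ e * torus_value v.
Proof. by move=> t0; rewrite /torus_value aff_scale // mxE exprMn mulrA. Qed.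

End Sections.

Section Polynomials.
Variables (R : realType) (e : nat).
Local Notation C := (complexes R).
Local Notation poly3 := (mpoly.mpoly 3 C).
Implicit Types (W : poly3) (P : 'I_3 -> 'rV[C]_2 -> C).

Lemma local_equation_transition W i j w : homogeneous e W -> homc i w 0 j != 0 ->
  local_equation W i w = homc i w 0 j ^+ e * local_equation W j (transition i j w).
Proof.
move=> We hj; rewrite /local_equation transition_aff homc_aff // -homog_meval //.
by apply: mpoly.meval_eq => l; move: (homc i w) hj => h hj; rewrite mxE mulrA divff // mul1r.
Qed.

Lemma twisted_section_local W : homogeneous e W -> twisted_section e (local_equation W).
Proof.
by move=> We; split=> [i w|i j w]; [exact: holomorphic_local|exact: local_equation_transition].
Qed.

Lemma twisted_section_sub P Q : twisted_section e P -> twisted_section e Q ->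
  twisted_section e (fun i w => P i w + -1 * Q i w).
Proof.
move=> [hP lP] [hQ lQ]; split=> [i w|i j w hj].
  by apply: holomorphic_add => //; apply: holomorphic_mul => //; exact: holomorphic_cst.
by rewrite (lP i j w hj) (lQ i j w hj) mulrDr; congr (_ + _); rewrite mulrCA.
Qed.

(** Where all coordinates are nonzero, the section is a homogeneous function, polynomial of degree
    at most e in each coordinate. Interpolation gives a polynomial, and its component of degree e
    has the same values. The difference from the section is again a section, and it vanishes there,
    hence everywhere. *)
Theorem twisted_section_polynomial P : twisted_section e P ->
  exists2 W, homogeneous e W & forall i w, P i w = local_equation W i w.
Proof.
move=> sP; pose row3 (x y z : C) : 'rV[C]_3 :=
  \row_j (if j == 0 then x else if j == 1 then y else z).
have nz x y z : x != 0 -> y != 0 -> z != 0 -> forall i, row3 x y z 0 i != 0.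
  by move=> x0 y0 z0 i; rewrite mxE; case: ifP => _ //; case: ifP.
have one0 : 1 != 0 :> C by exact: oner_neq0.
have ord3P (Q : 'I_3 -> Prop) : Q 0 -> Q 1 -> Q ord_max -> forall i, Q i.
  move=> q0 q1 q2 [[|[|[|//]]] h].
  - by rewrite (_ : Ordinal h = 0) //; apply: val_inj.
  - by rewrite (_ : Ordinal h = 1) //; apply: val_inj.
  - by rewrite (_ : Ordinal h = ord_max) //; apply: val_inj.
have [|||W0 hW0] := @separately_polynomial C e (@char0C R)
    (fun x y z => torus_value e P (row3 x y z)).
- move=> y z y0 z0; have [p sp hp] := torus_value_line sP 0 (nz 1 y z one0 y0 z0).
  exists p => // x /hp <-; congr torus_value; apply/rowP; apply: ord3P; by rewrite !mxE.
- move=> x z x0 z0; have [p sp hp] := torus_value_line sP 1 (nz x 1 z x0 one0 z0).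
  exists p => // y /hp <-; congr torus_value; apply/rowP; apply: ord3P; by rewrite !mxE.
- move=> x y x0 y0; have [p sp hp] := torus_value_line sP ord_max (nz x y 1 x0 y0 one0).
  exists p => // z /hp <-; congr torus_value; apply/rowP; apply: ord3P; by rewrite !mxE.
have hW1 (v : 'rV[C]_3) : (forall i, v 0 i != 0) -> torus_value e P v = mpoly.meval (fun j => v 0 j) W0.
  move=> v0; rewrite -hW0 //; congr torus_value; apply/rowP; apply: ord3P; rewrite !mxE /=;
    by congr (v _ _); apply: val_inj.
have hW := homogeneous_values (@char0C R) (e := e) (W := W0).
have {}hW : forall v, (forall i, v i != 0) ->
    mpoly.meval v W0 = mpoly.meval v (mpoly.pihomog mpoly.mdeg e W0).
  move=> u u0; apply: (hW _ u u0); move=> {u u0} s u s0 u0; have := torus_valueZ e P (\row_j u j) s0.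
  rewrite !hW1.
  - move=> E; rewrite (mpoly.meval_eq (v2 := fun j => (s *: (\row_j u j) : 'rV[C]_3) 0 j)).
      by rewrite E; congr (_ * _); apply: mpoly.meval_eq => j; rewrite mxE.
    by move=> j; rewrite !mxE.
  - by move=> j; rewrite mxE.
  - by move=> j; rewrite !mxE mulf_neq0.
exists (mpoly.pihomog mpoly.mdeg e W0); first exact: mpoly.pihomogP.
have sW := twisted_section_local (mpoly.pihomogP mpoly.mdeg e W0).
have h0 := section_eq0 (twisted_section_sub sP sW).
move=> i w; apply/eqP; rewrite -subr_eq0 -[X in _ - X]mul1r -mulNr; apply/eqP.
apply: h0 => {i w} i w wn0; apply/eqP; rewrite mulN1r subr_eq0 -/(local_equation _ _ _); apply/eqP.
rewrite /local_equation -hW //.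
  rewrite -(hW1 (homc i w)) // (torus_valueE sP (i := i)) // aff_homc homc_i expr1n mul1r //.
Qed.

End Polynomials.

(** * The homogeneous vector field of a foliation *)

Section Field.
Variables (R : realType) (F : foliation R) (d : nat).
Local Notation C := (complexes R).
Local Notation poly3 := (mpoly.mpoly 3 C).

(** The case i = j of the isomorphism says that the local fields multiplied by [s i a] agree on
    overlaps, so they glue to one field per chart. In a change of charts the cocycle contributes the
    exponent d - 1 and the quotient rule a square, together d + 1. *)
Lemma foliation_twisted_field : foliation_degree F d ->
  exists (V : vfield R) (s : 'I_3 -> fol_index F -> P2 R -> C),
  [/\ forall i a, invertible_on (chart_dom i `&` fol_dom a) (s i a),
      forall i a w, fol_dom a (chart i w) -> V i w = s i a (chart i w) *: fol_vf a i w,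
      forall i l w, holomorphic_at (fun w' => V i w' 0 l) w &
      forall i j c w, homc i w 0 j != 0 ->
        dhomc i (V i w) 0 c * homc i w 0 j - homc i w 0 c * dhomc i (V i w) 0 j
        = homc i w 0 j ^+ d.+1 * dhomc j (V j (transition i j w)) 0 c].
Proof.
move=> [s [sI sg]].
have s0 i a w : fol_dom a (chart i w) -> s i a (chart i w) != 0.
  by move=> aw; apply: (sI i a).2; split => //; exact: chart_dom_chart.
have sind i a b w : fol_dom a (chart i w) -> fol_dom b (chart i w) ->
    s i a (chart i w) *: fol_vf a i w = s i b (chart i w) *: fol_vf b i w.
  move=> aw bw; have ci := chart_dom_chart i w.
  rewrite (fol_glue (conj aw bw)) scalerA (sg i i a b _ ci ci aw bw).
  by rewrite twist_chart homc_i exp1rz mul1r.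
(* An index is chosen at each point without any regularity; by [sind] the field does not depend on
   it. *)
have [idx idxP] : exists idx : 'I_3 -> 'rV[C]_2 -> fol_index F,
    forall i w, fol_dom (idx i w) (chart i w).
  exists (fun i w => projT1 (cid (fol_cover F (chart i w)))) => i w.
  exact: projT2 (cid (fol_cover F (chart i w))).
pose V : vfield R := fun i w => s i (idx i w) (chart i w) *: fol_vf (idx i w) i w.
have VE i a w : fol_dom a (chart i w) -> V i w = s i a (chart i w) *: fol_vf a i w.
  exact: sind.
exists V, s; split => //.
- move=> i l w; set a := idx i w; have aw : fol_dom a (chart i w) by exact: idxP.
  have h1 : holomorphic_at (fun w' => (s i a \o chart i) w' * fol_vf a i w' 0 l) w.
    apply: holomorphic_mul; last exact: (fol_holo a).1.
    by apply: (sI i a).1; split => //; exact: chart_dom_chart.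
  apply: holomorphic_near h1.
  have aopen : \forall w' \near w, fol_dom a (chart i w').
    have oa : open_nbhs w (chart i @^-1` fol_dom a) by split; [exact: fol_open|exact: aw].
    exact: open_nbhs_nbhs oa.
  by apply: filterS aopen => w' /VE ->; rewrite mxE.
- move=> i j c w hj.
  set a := idx i w; have aw : fol_dom a (chart i w) by exact: idxP.
  have aw' : fol_dom a (chart j (transition i j w)) by rewrite chart_transition.
  have ee : s i a (chart i w) = homc i w 0 j ^ (d%:Z - 1) * s j a (chart i w).
    have ci := chart_dom_chart i w; have cj := chart_dom_transition hj.
    have := sg i j a a _ ci cj aw aw; rewrite twist_chart.
    have := sg i i a a _ ci ci aw aw; rewrite twist_chart homc_i exp1rz mul1r.
    rewrite -[RHS]mulr1 => /(mulfI (s0 _ _ _ aw)) ->.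
    by rewrite mulr1.
  have dV := (fol_holo a).2 i j w aw hj.
  rewrite (derive_transition _ hj) in dV.
  rewrite (VE i a w aw) (VE j a _ aw') chart_transition // -dV ee.
  rewrite !dhomcZ.
  move: (fol_vf a i w) => v.
  have hd : homc i w 0 j ^ (d%:Z - 1) * homc i w 0 j ^+ 2 = homc i w 0 j ^+ d.+1.
    rewrite -[homc i w 0 j ^+ 2]/(homc i w 0 j ^ 2%:Z) -expfzDr //.
    by rewrite -[RHS]/(homc i w 0 j ^ d.+1%:Z); congr (_ ^ _); lia.
  have sE (b : C) (x : 'rV[C]_3) m : (b *: x) 0 m = b * x 0 m by rewrite mxE.
  rewrite !sE; have [->|cj] := eqVneq c j.
    by rewrite !dhomc_i !mulr0 [X in _ - X]mulrC subrr.
  case: (unliftP j c) cj => [l -> _|->]; last by rewrite eqxx.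
  rewrite -hd dhomc_lift.
  move: (homc i w) (dhomc i v) hj hd => h dh hj _; rewrite !mxE.
  by field.
Qed.

End Field.

Section ClosedField.
Variable R : realType.
Local Notation C := (complexes R).
Local Notation poly3 := (mpoly.mpoly 3 C).

Lemma unitC (x : C) : x != 0 -> x \is a GRing.unit.
Proof. by rewrite unitfE. Qed.

Lemma nonrootC (p : {poly C}) : p != 0 -> exists x, p.[x] != 0.
Proof. by move=> /closed_nonrootP[x px]; exists x. Qed.

Lemma root_polyC (p : {poly C}) : size p != 1%N -> exists x, p.[x] = 0.
Proof. by move=> /closed_rootP[x /eqP px]; exists x. Qed.

Lemma homog_meval_chart e (W : poly3) i (v : 'rV[C]_3) : homogeneous e W -> v 0 i != 0 ->
  mpoly.meval (fun j => v 0 j) W = v 0 i ^+ e * local_equation W i (aff i v).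
Proof.
move=> We vi; rewrite /local_equation -homog_meval //; apply: mpoly.meval_eq => j.
by rewrite homc_aff // mxE mulrA divff // mul1r.
Qed.

Lemma homog_meval0 e (W : poly3) (v : 'I_3 -> C) : homogeneous e W -> (0 < e)%N ->
  (forall i, v i = 0) -> mpoly.meval v W = 0.
Proof.
move=> We e0 v0; rewrite (mpoly.meval_eq (v2 := fun i => 0 * v i)).
  by rewrite (homog_meval _ _ We) expr0n gtn_eqF // mul0r.
by move=> i; rewrite mul0r v0.
Qed.

Lemma homog_eq0_chart e (W : poly3) : homogeneous e W -> (0 < e)%N ->
  (forall i w, local_equation W i w = 0) -> W = 0.
Proof.
move=> We e0 W0; apply: (mpoly_eq0_eval nonrootC) => v.
have [[i vi]|nex] := EM (exists i, v i != 0); last first.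
  apply: homog_meval0 We e0 _ => i; apply/eqP/contraT => vi.
  by case: nex; exists i.
have rv : (\row_j v j : 'rV[C]_3) 0 i != 0 by rewrite mxE.
have := homog_meval_chart We rv; rewrite W0 mulr0 => <-.
by apply: mpoly.meval_eq => j; rewrite mxE.
Qed.

End ClosedField.

Section LocalEquation.
Variables (R : realType) (i : 'I_3) (w : 'rV[complexes R]_2).
Local Notation le p := (local_equation p i w).
Implicit Types (p q : mpoly.mpoly 3 (complexes R)).

Lemma local_equationD p q : le (p + q) = le p + le q.
Proof. exact: mpoly.mevalD. Qed.

Lemma local_equationB p q : le (p - q) = le p - le q.
Proof. exact: mpoly.mevalB. Qed.

Lemma local_equationM p q : le (p * q) = le p * le q.
Proof. exact: mpoly.mevalM. Qed.

Lemma local_equationX j : le (mpoly.mpolyX _ (mpoly.mnm1 j)) = homc i w 0 j.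
Proof. exact: mpoly.mevalXU. Qed.

End LocalEquation.

(** * From the twisted field to a homogeneous polynomial field *)

Section PolynomialField.
Variables (R : realType) (d : nat) (V : vfield R).
Local Notation C := (complexes R).
Local Notation poly3 := (mpoly.mpoly 3 C).
Hypothesis holV : forall i l w, holomorphic_at (fun w' => V i w' 0 l) w.
Hypothesis lawV : forall i j c w, homc i w 0 j != 0 ->
  dhomc i (V i w) 0 c * homc i w 0 j - homc i w 0 c * dhomc i (V i w) 0 j
    = homc i w 0 j ^+ d.+1 * dhomc j (V j (transition i j w)) 0 c.

(** Adding a multiple of the radial field leaves this minor unchanged, so it does not depend on how
    the field is lifted to C^3. *)
Definition field_minor a b i w : C :=
  dhomc i (V i w) 0 a * homc i w 0 b - dhomc i (V i w) 0 b * homc i w 0 a.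

Lemma field_minor_section a b : twisted_section d.+1 (field_minor a b).
Proof.
split=> [i w|i j w hj].
  have hd c : holomorphic_at (fun w' => dhomc i (V i w') 0 c) w.
    case: (unliftP i c) => [l|] ->.
      by apply: holomorphic_near (holV i l w); near=> w'; rewrite dhomc_lift.
    by apply: holomorphic_near (holomorphic_cst 0 w); near=> w'; rewrite dhomc_i.
  have hm c c' := holomorphic_mul (hd c) (holomorphic_homc i c' w).
  apply: holomorphic_near (holomorphic_add (hm a b)
    (holomorphic_mul (holomorphic_cst (-1) w) (hm b a))).
  by near=> w'; rewrite /field_minor mulN1r.
have ht c : homc j (transition i j w) 0 c = homc i w 0 c / homc i w 0 j.
  by rewrite transition_aff homc_aff //; move: (homc i w) => h; rewrite mxE mulrC.
rewrite /field_minor !ht; have la := lawV a hj; have lb := lawV b hj.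
apply: (mulfI hj); rewrite [in RHS]mulrBr [RHS]mulrBr.
set x := dhomc i _ 0 a in la *; set y := dhomc i _ 0 b in lb *.
set x' := dhomc j _ 0 a in la *; set y' := dhomc j _ 0 b in lb *.
set z := dhomc i _ 0 j in la lb *.
move: (homc i w 0 a) (homc i w 0 b) (homc i w 0 j) hj la lb => ha hb hj hj0 la lb.
have -> : hj * (hj ^+ d.+1 * (x' * (hb / hj))) = (hj ^+ d.+1 * x') * hb.
  by field.
have -> : hj * (hj ^+ d.+1 * (y' * (ha / hj))) = (hj ^+ d.+1 * y') * ha.
  by field.
by rewrite -la -lb; ring.
Unshelve. all: by end_near. Qed.

(** The lift of [V i] has zero i-th component, so it is [X] minus the multiple of the radial field
    that kills that component. The identities required by the Koszul argument hold in every chart,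
    hence for the polynomials. *)
Lemma polynomial_field : exists X : 'I_3 -> poly3, (forall c, homogeneous d (X c)) /\
  forall i c w, dhomc i (V i w) 0 c =
    local_equation (X c) i w - homc i w 0 c * local_equation (X i) i w.
Proof.
have h a b := twisted_section_polynomial (field_minor_section a b).
have [Om OmP] : exists Om : 'I_3 -> 'I_3 -> poly3, forall a b, homogeneous d.+1 (Om a b) /\
    forall i w, field_minor a b i w = local_equation (Om a b) i w.
  exists (fun a b => s2val (cid2 (h a b))) => a b; split.
    exact: s2valP (cid2 (h a b)).
  exact: s2valP' (cid2 (h a b)).
have Omh a b : homogeneous d.+1 (Om a b) by case: (OmP a b).
have OmE a b i w : local_equation (Om a b) i w = field_minor a b i w.
  by case: (OmP a b) => _ ->.
have anti a b : Om a b = - Om b a.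
  apply/eqP; rewrite -subr_eq0 opprK; apply/eqP.
  apply: (@homog_eq0_chart _ d.+1) => //; first by apply: rpredD; [exact: Omh|exact: Omh].
  move=> i w; rewrite local_equationD !OmE.
  by rewrite /field_minor; ring.
have cyc a b c : mpoly.mpolyX C (mpoly.mnm1 c) * Om a b
    + mpoly.mpolyX C (mpoly.mnm1 a) * Om b c + mpoly.mpolyX C (mpoly.mnm1 b) * Om c a = 0.
  have hX (j : 'I_3) : homogeneous 1 (mpoly.mpolyX C (mpoly.mnm1 j)).
    by rewrite /homogeneous mpoly.dhomogX /= mpoly.mdeg1.
  have hXO a' b' c' : homogeneous d.+2 (mpoly.mpolyX C (mpoly.mnm1 c') * Om a' b').
    exact: mpoly.dhomogM (hX c') (Omh a' b').
  apply: (@homog_eq0_chart _ d.+2) => //.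
    exact: rpredD (rpredD (hXO a b c) (hXO b c a)) (hXO c a b).
  move=> i w; rewrite !local_equationD !local_equationM !local_equationX !OmE /field_minor; ring.
exists (koszul_field d.+1 Om); split.
  by move=> c; exact: (koszul_field_homog (e := d.+1) Omh c).
move=> i c w.
have := koszul_field_minor (@char0C R) Omh anti cyc c i.
move: (koszul_field _ _ c) (koszul_field _ _ i) => Xc Xi eX.
have := OmE c i i w; rewrite -eX /field_minor homc_i dhomc_i mul0r subr0 mulr1 => <-.
by rewrite local_equationB !local_equationM !local_equationX homc_i mul1r.
Qed.

End PolynomialField.

(** * Invariant curves *)

Section Invariance.
Variables (R : realType) (F : foliation R) (d k : nat).
Local Notation C := (complexes R).
Local Notation poly3 := (mpoly.mpoly 3 C).
Variables (V : vfield R) (s : 'I_3 -> fol_index F -> P2 R -> C) (X : 'I_3 -> poly3).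
Hypothesis d_gt0 : (0 < d)%N.
Hypothesis k_gt0 : (0 < k)%N.
Hypothesis sI : forall i a, invertible_on (chart_dom i `&` fol_dom a) (s i a).
Hypothesis VE : forall i a w, fol_dom a (chart i w) -> V i w = s i a (chart i w) *: fol_vf a i w.
Hypothesis Xd : forall c, homogeneous d (X c).
Hypothesis VX : forall i c w, dhomc i (V i w) 0 c =
  local_equation (X c) i w - homc i w 0 c * local_equation (X i) i w.

(** The lift of [V i] is [X] minus X_i times the radial field, and Euler's identity turns the radial
    part into m X_i f. *)
Lemma field_derive m (f : poly3) a i w : homogeneous m f -> fol_dom a (chart i w) ->
  s i a (chart i w) * 'D_(fol_vf a i w) (local_equation f i) w =
  local_equation (vder X f) i w - m%:R * local_equation (X i) i w * local_equation f i w.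
Proof.
move=> fm aw; have hd := is_derive_local f i w (fol_vf a i w).
rewrite derive_val mulr_sumr.
transitivity (\sum_j dhomc i (V i w) 0 j * local_equation (mpoly.mderiv j f) i w).
  by apply: eq_bigr => j _; rewrite mulrA (VE aw) dhomcZ; move: (dhomc i _) => x; rewrite mxE; ring.
under eq_bigr => j _ do rewrite VX mulrBl.
rewrite sumrB; congr (_ - _).
  rewrite /vder /local_equation raddf_sum; apply: eq_bigr => j _.
  by rewrite /= mpoly.mevalM.
have e : m%:R * local_equation f i w = \sum_j homc i w 0 j * local_equation (mpoly.mderiv j f) i w.
  rewrite /local_equation mulr_natl -mpoly.mevalMn -(euler_homog fm) raddf_sum.
  by apply: eq_bigr => j _; rewrite /= mpoly.mevalM mpoly.mevalXU.
rewrite mulrAC e mulr_suml; apply: eq_bigr => j _; ring.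
Qed.

(** At a zero of [f] in a chart, both the cofactor term and the Euler term of [field_derive] vanish,
    so [vder X f] vanishes too. The origin of C^3, which is in no chart, is settled by positive
    degree. *)
Lemma invariant_rdiv (f : poly3) : irreducible_poly3 f -> homogeneous k f ->
  invariant_curve F f -> rdiv f (vder X f).
Proof.
move=> firr fk finv.
have hX : homogeneous (k + d.-1) (vder X f) by exact: dhomog_vder.
apply: (irr_nullstellensatz (@unitC R) (@nonrootC R) (@root_polyC R) firr) => v fv.
have [[i vi]|nex] := EM (exists i, v i != 0); last first.
  apply: homog_meval0 hX _ _ => [|i]; first by rewrite addn_gt0 k_gt0.
  by apply/eqP/contraT => vi; case: nex; exists i.
have rv : (\row_j v j : 'rV[C]_3) 0 i != 0 by rewrite mxE.
have ev (g : poly3) : mpoly.meval v g = mpoly.meval (fun j => (\row_j v j : 'rV[C]_3) 0 j) g.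
  by apply: mpoly.meval_eq => j; rewrite mxE.
move: fv; rewrite !ev (homog_meval_chart fk rv) (homog_meval_chart hX rv).
move=> /eqP; rewrite mulf_eq0 expf_eq0 (negbTE rv) andbF /= => /eqP f0.
move: (aff i _) f0 => w f0.
have [a aw] := fol_cover F (chart i w).
have [h /(_ w aw)[_ hw]] := finv a i.
have := field_derive fk aw; rewrite hw f0 !mulr0 subr0 => <-.
by rewrite mulr0.
Qed.

(** Solving [field_derive] for the derivative gives the cofactor (L - m X_i) / s, holomorphic
    because [s] is invertible. *)
Lemma cofactor_invariant m (f L : poly3) : homogeneous m f -> vder X f = L * f ->
  invariant_curve F f.
Proof.
move=> fm fL a i.
exists (fun w => (s i a (chart i w))^-1 *
  (local_equation L i w + - m%:R * local_equation (X i) i w)) => w aw.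
have sw0 : s i a (chart i w) != 0.
  by apply: (sI i a).2; split => //; exact: chart_dom_chart.
split.
  apply: holomorphic_mul.
    apply: (@holomorphic_inv _ (s i a \o chart i)) => //.
    by apply: (sI i a).1; split => //; exact: chart_dom_chart.
  apply: holomorphic_add; first exact: holomorphic_local.
  by apply: holomorphic_mul; [exact: holomorphic_cst|exact: holomorphic_local].
apply: (mulfI sw0); rewrite (field_derive fm aw) fL local_equationM.
by rewrite [RHS]mulrA mulVKf //; ring.
Qed.

(** The cofactor [L] is common to P and Q, hence to all members of the pencil. *)
Lemma pencil_first_integral m P Q : pencil_integral X m P Q ->
  rational_first_integral F m P Q.
Proof.
move=> PQ; have [L [PL QL]] := pencil_integral_cofactor (@unitC R) PQ.
have [Pm Qm cop nc _] := PQ; split => //.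
  by move=> h u v eP eQ; apply: cop; [exists u; rewrite eP mulrC|exists v; rewrite eQ mulrC].
move=> a b _; apply: (@cofactor_invariant m _ L).
  by apply: rpredD; apply: rpredZ.
by rewrite vderD !vderZ PL QL mulrDr !scalerAr.
Qed.

(** Curves are counted as point sets; this is what makes the equations of distinct curves
    indivisible by one another. *)
Lemma zero_locus_rdiv (f g : poly3) : irreducible_poly3 f -> irreducible_poly3 g ->
  rdiv f g -> zero_locus f = zero_locus g.
Proof.
move=> [f0 fu _] [_ _ girr] [c ec].
have cu : c \is a GRing.unit by case: (girr _ _ ec) => // fu'; rewrite fu' in fu.
have ef : f = c^-1 * g by rewrite ec mulKr.
apply/seteqP; split=> p; rewrite /zero_locus /=.
  by rewrite ec mpoly.mevalM => ->; rewrite mulr0.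
by rewrite ef mpoly.mevalM => ->; rewrite mulr0.
Qed.

Hypothesis hfi : forall m, (m <= k)%N -> ~ has_rational_first_integral F m.

(** The bound is proved for finite lists of curves, from which the finiteness of the whole set is
    deduced next. *)
Lemma invariant_curves_count (zs : seq (set (P2 R))) : uniq zs ->
  (forall Z, Z \in zs -> invariant_curves F k Z) -> (size zs * k <= extactic_degree d k)%N.
Proof.
move=> uzs zsP.
have [eq EQ] : exists eq : set (P2 R) -> poly3, forall Z, Z \in zs ->
    [/\ curve_equation k (eq Z), irreducible_poly3 (eq Z), invariant_curve F (eq Z)
      & Z = zero_locus (eq Z)].
  exists (fun Z => if pselect (invariant_curves F k Z) is left h then projT1 (cid h) else 0).
  by move=> Z /zsP h; case: pselect => // h'; exact: projT2 (cid h').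
have eqI : {in zs &, injective eq}.
  by move=> Z Z' /EQ[_ _ _ eZ] /EQ[_ _ _ eZ'] e; rewrite eZ eZ' e.
rewrite -(size_map eq).
apply: (invariant_count (@unitC R) (@char0C R) Xd d_gt0 k_gt0).
- by move=> m P Q mk PQ; apply: (hfi mk); exists P, Q; exact: pencil_first_integral.
- by rewrite map_inj_in_uniq.
- move=> f /mapP[Z /EQ[[_ fk _] firr finv _] ->].
  by split => //; exact: invariant_rdiv.
- move=> f g /mapP[Z Zs ->] /mapP[Z' Zs' ->] /negP ne dv; apply: ne; apply/eqP.
  have [_ i1 _ e1] := EQ _ Zs; have [_ i2 _ e2] := EQ _ Zs'.
  by congr eq; rewrite e1 e2; exact: zero_locus_rdiv dv.
Qed.

Lemma finite_invariant_curves : finite_set (invariant_curves F k).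
Proof.
apply: contrapT => /(@infinite_set_fset _ _ (extactic_degree d k).+1)[B BA hB].
have h : (#|` B| * k <= extactic_degree d k)%N.
  by apply: invariant_curves_count => [|Z ZB]; [exact: fset_uniq|exact: BA].
have := leq_trans hB (leq_trans (leq_pmulr _ k_gt0) h).
by rewrite ltnn.
Qed.

Lemma num_invariant_curves_bound :
  (num_invariant_curves F k * k <= extactic_degree d k)%N.
Proof.
apply: invariant_curves_count => [|Z]; first exact: fset_uniq.
by rewrite (in_fset_set finite_invariant_curves) => /set_mem.
Qed.

End Invariance.

(** * The degree of the extactic curve and the numerical bound *)

(** The number n of monomials satisfies 2 n = (k + 1)(k + 2), so 2 n - 2 = k (k + 3); this is why k
    factors out of both terms of the degree. *)
Lemma extactic_degreeE d k : (0 < d)%N ->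
  8 * (extactic_degree d k)%:R =
  k%:R * ((k%:R + 1) * (k%:R + 2) * (4 + (d%:R - 1) * (k%:R + 3))) :> rat.
Proof.
move=> d0; rewrite /extactic_degree size_kmonomials; set n := 'C(k + 2, k).
have en : 2 * n%:R = (k%:R + 1) * (k%:R + 2) :> rat.
  have eb : (2 * n = k.+2 * k.+1)%N.
    have := bin_sub (leq_addl k 2); rewrite addnK /n => ->; rewrite mulnC addn2.
    by have := bin_ffact k.+2 2; rewrite (_ : 2`! = 2)%N // !ffactnS ffactn0 muln1.
  have := congr1 (fun m => m%:R : rat) eb; rewrite !natrM => ->.
  by rewrite -[k.+2]addn2 -[k.+1]addn1 !natrD; ring.
have es m : 2 * (\sum_(j < m) (k + j * d.-1))%N%:R =
    2 * (m%:R * k%:R) + (d%:R - 1) * (m%:R * (m%:R - 1)) :> rat.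
  elim: m => [|m IH]; first by rewrite big_ord0; ring.
  rewrite big_ord_recr /= natrD mulrDr IH natrD natrM -[m.+1]addn1 natrD.
  have -> : d.-1%:R = d%:R - 1 :> rat by rewrite -subn1 natrB.
  ring.
have -> : 8 * (\sum_(j < n) (k + j * d.-1))%N%:R =
    2 * (2 * k%:R * (2 * n%:R)) + (d%:R - 1) * (2 * n%:R * (2 * n%:R - 2)) :> rat.
  by rewrite (_ : 8 = 4 * 2) // -mulrA es; ring.
by rewrite en; ring.
Qed.

Lemma virtual_genusE (R : realType) k (D : mpoly.mpoly 3 (complexes R)) :
  curve_equation k D -> 2 - 2 * virtual_genus D = 3 * k%:R - k%:R ^+ 2.
Proof.
move=> [D0 Dk _].
have dk : (mpoly.msize D).-1 = k.
  exact: mpoly.dhomog_uniq D0 (mpoly.dhomog_msize Dk) Dk.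
rewrite /virtual_genus /intersection_number /curve_degree /canonical_degree dk.
rewrite rmorphD !rmorphM rmorphN /= -!pmulrn.
by field.
Qed.

(** Dividing the degree by k gives 8 N <= (k + 1)(k + 2)(4 + (d - 1)(k + 3)). The right side plus 4
    (3 k - k^2) is the numerator of the stated fraction. *)
Lemma extactic_degree_bound (d k N : nat) : (0 < d)%N -> (0 < k)%N ->
  (N * k <= extactic_degree d k)%N ->
  3 * k%:R - k%:R ^+ 2 <=
    (d%:R * (k%:R ^+ 3 + 6 * k%:R ^+ 2 + 11 * k%:R + 6)
       - k%:R ^+ 3 - 6 * k%:R ^+ 2 + 13 * k%:R + 2) / 4 - 2 * N%:R :> rat.
Proof.
move=> d0 k0; rewrite -(ler_nat rat) natrM => hN.
have k0' : 0 < k%:R :> rat by rewrite ltr0n.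
have := extactic_degreeE k d0.
move: N%:R (extactic_degree d k)%:R hN => {}N E hN eE.
have hN8 : 8 * N <= (k%:R + 1) * (k%:R + 2) * (4 + (d%:R - 1) * (k%:R + 3)).
  by rewrite -(ler_pM2l k0') -eE mulrCA ler_pM2l // mulrC.
move: hN8; clear; move: (k%:R) (d%:R) => x y h; lra.
Qed.

End Foliations.

Import Foliations.
Local Open Scope ring_scope.

(** Finiteness belongs to the conclusion because [fset_set] sends an infinite set to the empty one;
    with it, [num_invariant_curves] is the actual number of curves. *)
Theorem theorem1p1 (R : realType) (F : foliation R) (d k : nat)
    (hd : (2 <= d)%N) (hdeg : foliation_degree F d)
    (hfi : forall m : nat, (m <= k)%N -> ~ has_rational_first_integral F m)
    (D : mpoly.mpoly 3 (complexes R)) (hD : curve_equation k D)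
    (hinv : invariant_curve F D) :
  finite_set (invariant_curves F k) /\
  2 - 2 * virtual_genus D <=
    (d%:R * (k%:R ^+ 3 + 6 * k%:R ^+ 2 + 11 * k%:R + 6)
       - k%:R ^+ 3 - 6 * k%:R ^+ 2 + 13 * k%:R + 2) / 4
    - 2 * (num_invariant_curves F k)%:R :> rat.
Proof.
have d0 : (0 < d)%N by exact: ltnW.
have [_ _ k0] := hD.
have [V [s [sI VE holV lawV]]] := foliation_twisted_field hdeg.
have [X [Xd VX]] := polynomial_field holV lawV.
split; first exact: finite_invariant_curves VE Xd VX hfi.
rewrite (virtual_genusE hD); apply: extactic_degree_bound => //.
exact: num_invariant_curves_bound d0 k0 sI VE Xd VX hfi.
Qed.
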